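(* Let $n\ge1$ and let $q\in k^\times$ be a primitive $\ell$-th root of unity. There exists a natural Hopf algebra isomorphism $$\bar{\mathscr A}_q(n)\cong\left(\bar{\mathscr A}_q(1)^{\otimes n}\right)^{\sigma},$$ where $\sigma$ is the Hopf 2-cocycle on $\bar{\mathscr A}_q(1)^{\otimes n}$ given as the bilinear form defined on basis vectors $a,b$ of the form $x^\gamma K(\alpha)$ by $$\sigma(a,b)=\begin{cases}q^{-\beta*\alpha},& a=K(\alpha)\text{ and }b=K(\beta),\ \alpha,\beta\in\Lambda,\\ 0,& a\text{ or }b\notin \operatorname{span}_k\{K(\alpha)\mid\alpha\in\Lambda\}.\end{cases}$$
   Context: Throughout, $k$ is an algebraically closed field of characteristic $0$. **Lattice notation.** $\Lambda=\bigoplus_{i=1}^n\mathbb Z\epsilon_i$ is the free abelian group with standard basis $\epsilon_1,\dots,\epsilon_n$. For $\alpha,\beta\in\Lambda$: $\alpha*\beta=\sum_{j=1}^{n-1}\sum_{i>j}\alpha_i\beta_j$ and $\theta(\alpha,\beta)=q^{\alpha*\beta-\beta*\alpha}$. Put $\Lambda_+^{\le\kappa}=\{\alpha\in\Lambda: 0\le\alpha_i\le \ell-1\text{ for all }i\}$. **The $n$-rank Taft algebra.** $\bar{\mathscr A}_q(n)$ is the $k$-algebra generated by $K(\epsilon_i)^{\pm1},x_i$ ($1\le i\le n$) with relations: the $K(\epsilon_i)$ commute and are invertible; $K(\epsilon_i)^\ell=1$; $K(\epsilon_i)x_jK(\epsilon_i)^{-1}=\theta(\epsilon_i,\epsilon_j)q^{\delta_{ij}}x_j$;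 $x_ix_j=\theta(\epsilon_i,\epsilon_j)x_jx_i$; $x_i^\ell=0$. Write $K(\alpha)=\prod_iK(\epsilon_i)^{\alpha_i}$ and $x^\gamma=x_1^{\gamma_1}\cdots x_n^{\gamma_n}$. It is a Hopf algebra with $\Delta(K(\epsilon_i)^{\pm1})=K(\epsilon_i)^{\pm1}\otimes K(\epsilon_i)^{\pm1}$, $\Delta(x_i)=x_i\otimes1+K(\epsilon_i)\otimes x_i$, $\varepsilon(K(\epsilon_i)^{\pm1})=1$, $\varepsilon(x_i)=0$, $s(K(\epsilon_i)^{\pm1})=K(\epsilon_i)^{\mp1}$, $s(x_i)=-K(\epsilon_i)^{-1}x_i$. The algebra $\bar{\mathscr A}_q(1)$ (the case $n=1$) is the Taft algebra of dimension $\ell^2$. In the tensor product Hopf algebra $\bar{\mathscr A}_q(1)^{\otimes n}$ the basis vectors are written $x^\gamma K(\alpha):=x_1^{\gamma_1}K(\alpha_1\epsilon_1)\otimes\cdots\otimes x_1^{\gamma_n}K(\alpha_n\epsilon_1)$ for $\alpha,\gamma\in\Lambda_+^{\le\kappa}$ (and $K(\alpha)$ is defined likewise for all $\alpha\in\Lambda$). **2-cocycle twist.** A Hopf 2-cocycle on a bialgebra $H$ is a convolution-invertible bilinear form $\sigma:H\times H\to k$ with $\sigma(a,1)=\sigma(1,a)=\varepsilon(a)$ and $\sigma(a_{(1)},b_{(1)})\sigma(a_{(2)}b_{(2)},c)=\sigma(b_{(1)},c_{(1)})\sigma(a,b_{(2)}c_{(2)})$ for all $a,b,c\in H$. The twist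 $H^\sigma$ is the same coalgebra with new multiplication $a\cdot_\sigma b=\sigma(a_{(1)},b_{(1)})\,a_{(2)}b_{(2)}\,\sigma^{-1}(a_{(3)},b_{(3)})$; if $H$ is a Hopf algebra with antipode $S$, so is $H^\sigma$, with antipode $S^\sigma(a)=\mathscr U(a_{(1)})S(a_{(2)})\mathscr U^{-1}(a_{(3)})$, where $\mathscr U=\sigma(\mathrm{Id}\otimes S)\Delta$ and $\mathscr U^{-1}=\sigma^{-1}(S\otimes \mathrm{Id})\Delta$. *)

(* Defs.v *)
From HB Require Import structures.
From mathcomp Require Import all_boot all_order all_algebra.
From mathcomp Require Import boolp.
From mathcomp Require Import finmap.
From mathcomp Require Import monalg.

Set Implicit Arguments.
Unset Strict Implicit.
Unset Printing Implicit Defensive.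

Import GRing.Theory.
Local Open Scope ring_scope.
Local Open Scope quotient_scope.

Record submodule (k : fieldType) (F : lmodType k) := Submodule {
  submodule_in :> F -> Prop;
  submodule0 : submodule_in 0;
  submoduleP : forall (a : k) (x y : F),
    submodule_in x -> submodule_in y -> submodule_in (a *: x + y) }.

Section QuotientModule.
Variables (k : fieldType) (F : lmodType k) (J : submodule F).

Definition eqmodJ (x y : F) : bool := `[< J (x - y) >].

Lemma submoduleD x y : J x -> J y -> J (x + y).
Proof. by move=> Jx Jy; rewrite -[x]scale1r; apply: submoduleP. Qed.

Lemma submoduleZ a x : J x -> J (a *: x).
Proof. by move=> Jx; rewrite -[_ *: x]addr0; apply: submoduleP (submodule0 J). Qed.

Lemma submoduleN x : J x -> J (- x).
Proof. by move=> Jx; rewrite -scaleN1r; apply: submoduleZ. Qed.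

Lemma eqmodJ_equiv : equiv_class_of eqmodJ.
Proof.
split=> [x|x y|y x z].
- by apply/asboolP; rewrite subrr; apply: submodule0.
- by apply/asboolP/asboolP=> /submoduleN; rewrite opprB.
move=> /asboolP Jxy /asboolP Jyz; apply/asboolP.
by have := submoduleD Jxy Jyz; rewrite addrA subrK.
Qed.

Canonical eqmodJ_equivRel := EquivRelPack eqmodJ_equiv.
Canonical eqmodJ_encModRel := defaultEncModRel eqmodJ.

Definition quotmod : Type := {eq_quot eqmodJ}.

HB.instance Definition _ : EqQuotient F eqmodJ quotmod :=
  EqQuotient.on quotmod.
HB.instance Definition _ := Choice.on quotmod.

Lemma quotmodP (x y : F) : reflect (J (x - y)) (\pi_quotmod x == \pi_quotmod y).
Proof. by rewrite piE; apply: asboolP. Qed.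

Lemma quotmod_eq (x y : F) : J (x - y) -> \pi_quotmod x = \pi_quotmod y.
Proof. by move/quotmodP/eqP. Qed.

Lemma repr_quotmod (x : F) : J (repr (\pi_quotmod x) - x).
Proof. by apply/quotmodP; rewrite reprK. Qed.

Lemma quotmodW (P : quotmod -> Prop) :
  (forall x, P (\pi_quotmod x)) -> forall u, P u.
Proof. by move=> Ppi u; rewrite -[u]reprK; apply: Ppi. Qed.

Definition quot_zero : quotmod := \pi_quotmod 0.
Definition quot_opp (u : quotmod) : quotmod := \pi_quotmod (- repr u).
Definition quot_add (u v : quotmod) : quotmod := \pi_quotmod (repr u + repr v).
Definition quot_scale (a : k) (u : quotmod) : quotmod := \pi_quotmod (a *: repr u).

Lemma quot_oppE x : quot_opp (\pi_quotmod x) = \pi_quotmod (- x).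
Proof.
by apply: quotmod_eq; rewrite -opprD; apply: submoduleN; apply: repr_quotmod.
Qed.

Lemma quot_addE x y : quot_add (\pi_quotmod x) (\pi_quotmod y) = \pi_quotmod (x + y).
Proof.
apply: quotmod_eq; rewrite opprD addrACA.
by apply: submoduleD; apply: repr_quotmod.
Qed.

Lemma quot_scaleE a x : quot_scale a (\pi_quotmod x) = \pi_quotmod (a *: x).
Proof.
by apply: quotmod_eq; rewrite -scalerBr; apply: submoduleZ; apply: repr_quotmod.
Qed.

Let quotE := (quot_oppE, quot_addE, quot_scaleE).

Lemma quot_addA : associative quot_add.
Proof.
by elim/quotmodW=> x; elim/quotmodW=> y; elim/quotmodW=> z; rewrite !quotE addrA.
Qed.

Lemma quot_addC : commutative quot_add.
Proof. by elim/quotmodW=> x; elim/quotmodW=> y; rewrite !quotE addrC. Qed.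

Lemma quot_add0 : left_id quot_zero quot_add.
Proof. by elim/quotmodW=> x; rewrite !quotE add0r. Qed.

Lemma quot_addN : left_inverse quot_zero quot_opp quot_add.
Proof. by elim/quotmodW=> x; rewrite !quotE addNr. Qed.

HB.instance Definition _ :=
  GRing.isZmodule.Build quotmod quot_addA quot_addC quot_add0 quot_addN.

Lemma quot_scaleA a b u : quot_scale a (quot_scale b u) = quot_scale (a * b) u.
Proof. by elim/quotmodW: u => x; rewrite !quotE scalerA. Qed.

Lemma quot_scale1 : left_id 1 quot_scale.
Proof. by elim/quotmodW=> x; rewrite !quotE scale1r. Qed.

Lemma quot_scaleDr : right_distributive quot_scale +%R.
Proof.
move=> a; elim/quotmodW=> x; elim/quotmodW=> y.
by rewrite /GRing.add /= !quotE scalerDr.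
Qed.

Lemma quot_scaleDl u : {morph quot_scale^~ u : a b / a + b}.
Proof.
by move=> a b; elim/quotmodW: u => x; rewrite /GRing.add /= !quotE scalerDl.
Qed.

HB.instance Definition _ := GRing.Zmodule_isLmodule.Build k quotmod
  quot_scaleA quot_scale1 quot_scaleDr quot_scaleDl.

Lemma quotmod_pi_linear : linear (\pi_quotmod : F -> quotmod).
Proof.
by move=> a x y; rewrite /GRing.add /GRing.scale /= !quotE.
Qed.

End QuotientModule.

Definition mlift (k : fieldType) (K : choiceType) (W : lmodType k)
    (f : K -> W) (p : {malg k[K]}) : W :=
  \sum_(m <- msupp p) p@_m *: f m.

Lemma mliftEw (k : fieldType) (K : choiceType) (W : lmodType k)
    (f : K -> W) (p : {malg k[K]}) (d : {fset K}) :
  (msupp p `<=` d)%fset -> mlift f p = \sum_(m <- d) p@_m *: f m.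
Proof.
move=> le; rewrite /mlift (big_fset_incl _ le) //= => x xd /mcoeff_outdom ->.
by rewrite scale0r.
Qed.

Lemma mlift_linear (k : fieldType) (K : choiceType) (W : lmodType k)
    (f : K -> W) : linear (mlift f).
Proof.
move=> a p r.
pose d := (msupp p `|` msupp r)%fset.
have led : (msupp (a *: p + r) `<=` d)%fset.
  apply: (fsubset_trans (msuppD_le _ _)).
  by apply: fsetSU; apply: msuppZ_le.
rewrite (mliftEw f led) (mliftEw (d := d) f) ?fsubsetUl //.
rewrite (mliftEw (d := d) f (p := r)) ?fsubsetUr //.
rewrite scaler_sumr -big_split /=; apply: eq_bigr => m _.
by rewrite mcoeffD mcoeffZ scalerDl scalerA.
Qed.

Lemma mliftU (k : fieldType) (K : choiceType) (W : lmodType k)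
    (f : K -> W) (m : K) : mlift f << m >> = f m.
Proof. by rewrite /mlift msuppU oner_eq0 big_seq_fset1 mcoeffUU scale1r. Qed.

Lemma mliftUc (k : fieldType) (K : choiceType) (W : lmodType k)
    (f : K -> W) (c : k) (m : K) : mlift f << c *g m >> = c *: f m.
Proof. by rewrite (mliftEw f msuppU_le) big_seq_fset1 mcoeffUU. Qed.

Definition upd n (V : Type) (v : {ffun 'I_n -> V}) (i : 'I_n) (u : V) :
  {ffun 'I_n -> V} := [ffun j => if j == i then u else v j].

Section TensorPower.
Variables (k : fieldType) (n : nat) (V : lmodType k).

(* tens is the free module on the n-tuples of vectors modulo multilinearity.  *)
Inductive multilin_span : {malg k[{ffun 'I_n -> V}]} -> Prop :=
| MultilinRel (v : {ffun 'I_n -> V}) (i : 'I_n) (a : k) (u w : V) :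
    multilin_span (<< upd v i (a *: u + w) >>
                   - (a *: << upd v i u >> + << upd v i w >>))
| Multilin0 : multilin_span 0
| MultilinP (a : k) x y :
    multilin_span x -> multilin_span y -> multilin_span (a *: x + y).

Definition multilin_submodule : submodule {malg k[{ffun 'I_n -> V}]} :=
  Submodule Multilin0 MultilinP.

Definition tens : Type := quotmod multilin_submodule.
HB.instance Definition _ := GRing.Lmodule.on tens.

Definition ptens (v : {ffun 'I_n -> V}) : tens :=
  \pi_(quotmod multilin_submodule) << v >>.

Definition multilinear (W : lmodType k) (f : {ffun 'I_n -> V} -> W) : Prop :=
  forall v i (a : k) (u w : V),
    f (upd v i (a *: u + w)) = a *: f (upd v i u) + f (upd v i w).

(* The linear map sending v_1 (x) ... (x) v_n to f v; this is independent of  *)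
(* the representative, as stated in tlift_ptens, when f is multilinear.       *)
Definition tlift (W : lmodType k) (f : {ffun 'I_n -> V} -> W) (t : tens) : W :=
  mlift f (repr t).

Lemma ptens_multilinear : multilinear ptens.
Proof.
move=> v i a u w; rewrite /ptens -quotmod_pi_linear.
by apply: quotmod_eq; apply: MultilinRel.
Qed.

Section Lift.
Variables (W : lmodType k) (f : {ffun 'I_n -> V} -> W).
Hypothesis fML : multilinear f.

HB.instance Definition _ :=
  GRing.isLinear.Build k {malg k[{ffun 'I_n -> V}]} W *:%R (mlift f)
    (@mlift_linear k _ W f).

Lemma mlift_multilin_span x : multilin_span x -> mlift f x = 0.
Proof.
elim=> [v i a u w||a y z _ IHy _ IHz]; last 1 first.
- by rewrite linearP /= IHy IHz scaler0 addr0.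
- by rewrite linearB /= linearP /= !mliftU fML subrr.
by rewrite linear0.
Qed.

Lemma tlift_pi x : tlift f (\pi_(quotmod multilin_submodule) x) = mlift f x.
Proof.
apply/eqP; rewrite -subr_eq0 -linearB /=; apply/eqP.
by apply: mlift_multilin_span; apply: (@repr_quotmod k _ multilin_submodule).
Qed.

Lemma tlift_ptens v : tlift f (ptens v) = f v.
Proof. by rewrite tlift_pi mliftU. Qed.

Lemma tlift_linear : linear (tlift f).
Proof.
move=> a s t; rewrite -[s]reprK -[t]reprK -quotmod_pi_linear !tlift_pi.
exact: mlift_linear.
Qed.

End Lift.

End TensorPower.

Definition tens2 (k : fieldType) (V : lmodType k) (a b : V) : tens 2 V :=
  ptens [ffun i : 'I_2 => nth 0 [:: a; b] i].

Definition tens3 (k : fieldType) (V : lmodType k) (a b c : V) : tens 3 V :=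
  ptens [ffun i : 'I_3 => nth 0 [:: a; b; c] i].

Section Presentation.
Variables (k : fieldType) (X : choiceType).
Local Notation F := {malg k[{fmonom X}]}.

Definition fgen (g : X) : F := << fmu g >>.

Inductive ideal_span (rel : F -> F -> Prop) : F -> Prop :=
| IdealRel l r : rel l r -> ideal_span rel (l - r)
| Ideal0 : ideal_span rel 0
| IdealD x y : ideal_span rel x -> ideal_span rel y -> ideal_span rel (x + y)
| IdealM a x b : ideal_span rel x -> ideal_span rel (a * x * b).

Variable rel : F -> F -> Prop.

Lemma ideal_spanP (a : k) (x y : F) :
  ideal_span rel x -> ideal_span rel y -> ideal_span rel (a *: x + y).
Proof.
move=> Ix Iy; apply: IdealD => //.
by have := IdealM (a *: 1) 1 Ix; rewrite mulr1 -scalerAl mul1r.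
Qed.

Definition ideal_submodule : submodule F :=
  Submodule (Ideal0 rel) ideal_spanP.

(* The algebra with generators X and relations l = r whenever rel l r.        *)
Definition palg : Type := quotmod ideal_submodule.
HB.instance Definition _ := GRing.Lmodule.on palg.

Definition palg_pi (x : F) : palg := \pi_(quotmod ideal_submodule) x.
Definition palg_repr (u : palg) : F := repr u.

Definition palg_one : palg := palg_pi 1.
Definition palg_mul (u v : palg) : palg := palg_pi (palg_repr u * palg_repr v).

Lemma palgW (P : palg -> Prop) : (forall x, P (palg_pi x)) -> forall u, P u.
Proof. by move=> Ppi u; rewrite -[u]reprK; apply: Ppi. Qed.

Lemma palg_mulE x y : palg_mul (palg_pi x) (palg_pi y) = palg_pi (x * y).
Proof.
apply: quotmod_eq => /=.
set x' := palg_repr _; set y' := palg_repr _.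
have Ix : ideal_span rel (x' - x) by apply: (@repr_quotmod k _ ideal_submodule).
have Iy : ideal_span rel (y' - y) by apply: (@repr_quotmod k _ ideal_submodule).
have -> : x' * y' - x * y = 1 * (x' - x) * y' + x * (y' - y) * 1.
  by rewrite mul1r mulr1 mulrBl mulrBr addrA subrK.
by apply: IdealD; apply: IdealM.
Qed.

Lemma palg_piD x y : palg_pi (x + y) = palg_pi x + palg_pi y.
Proof. by have := quotmod_pi_linear ideal_submodule 1 x y; rewrite !scale1r. Qed.

Lemma palg_mulA : associative palg_mul.
Proof.
by elim/palgW=> x; elim/palgW=> y; elim/palgW=> z; rewrite !palg_mulE mulrA.
Qed.

Lemma palg_mul1l : left_id palg_one palg_mul.
Proof. by elim/palgW=> x; rewrite palg_mulE mul1r. Qed.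

Lemma palg_mul1r : right_id palg_one palg_mul.
Proof. by elim/palgW=> x; rewrite palg_mulE mulr1. Qed.

Lemma palg_mulDl : left_distributive palg_mul +%R.
Proof.
elim/palgW=> x; elim/palgW=> y; elim/palgW=> z.
by rewrite -palg_piD !palg_mulE mulrDl palg_piD.
Qed.

Lemma palg_mulDr : right_distributive palg_mul +%R.
Proof.
elim/palgW=> x; elim/palgW=> y; elim/palgW=> z.
by rewrite -palg_piD !palg_mulE mulrDr palg_piD.
Qed.

HB.instance Definition _ := GRing.Zmodule_isPzRing.Build palg
  palg_mulA palg_mul1l palg_mul1r palg_mulDl palg_mulDr.

Definition pgen (g : X) : palg := palg_pi (fgen g).

(* The linear map x_1 ... x_r |-> f x_1 ... f x_r on the free algebra, with   *)
(* values in (W, mul, one), and the map it induces on palg. The latter is the *)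
(* algebra map extending f, independently of the representative, when         *)
(* (W, mul, one) is an algebra in which f satisfies the relations: see        *)
(* pext_pi, pext_pgen and pextM.                                              *)
Definition fext (W : lmodType k) (mul : W -> W -> W) (one : W) (f : X -> W) :
    F -> W :=
  mlift (fun m : {fmonom X} => \big[mul/one]_(g <- m) f g).

Definition pext (W : lmodType k) (mul : W -> W -> W) (one : W) (f : X -> W)
    (u : palg) : W :=
  fext mul one f (palg_repr u).

Section Extension.
Variables (W : lmodType k) (mul : W -> W -> W) (one : W) (f : X -> W).
Hypothesis mulP : (forall v, linear (mul^~ v)) /\ (forall u, linear (mul u)).
Hypothesis mulA : associative mul.
Hypothesis mul1l : left_id one mul.
Hypothesis mul1r : right_id one mul.
Hypothesis frel : forall x y, rel x y -> fext mul one f x = fext mul one f y.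

HB.instance Definition _ :=
  GRing.isLinear.Build k F W *:%R (fext mul one f)
    (@mlift_linear k _ W (fun m : {fmonom X} => \big[mul/one]_(g <- m) f g)).
HB.instance Definition _ u :=
  GRing.isLinear.Build k W W *:%R (mul u) (mulP.2 u).
Let mull v u := mul u v.
HB.instance Definition _ v :=
  GRing.isLinear.Build k W W *:%R (mull v) (mulP.1 v).

HB.instance Definition _ := Monoid.isLaw.Build W one mul mulA mul1l mul1r.

Lemma fextM x y :
  fext mul one f (x * y) = mul (fext mul one f x) (fext mul one f y).
Proof.
pose F1 (m : {fmonom X}) := \big[mul/one]_(g <- m) f g.
have fextU c m : fext mul one f << c *g m >> = c *: F1 m by apply: mliftUc.
have fextE z : fext mul one f z = \sum_(m <- msupp z) z@_m *: F1 m by [].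
rewrite malgME linear_sum [in RHS](fextE x) -[RHS]/(mull _ _) linear_sum.
apply: eq_bigr => m1 _; rewrite linear_sum linearZ /= /mull (fextE y).
rewrite linear_sum scaler_sumr; apply: eq_bigr => m2 _.
rewrite linearZ /= scalerA fextU; congr (_ *: _).
by rewrite /F1 -[mmul m1 m2]/(fmmul m1 m2) fmmulE big_cat.
Qed.

Lemma fext_ideal_span x : ideal_span rel x -> fext mul one f x = 0.
Proof.
elim=> [y z /frel yz||y z _ IHy _ IHz|a y b _ IHy].
- by rewrite linearB /= yz subrr.
- by rewrite linear0.
- by rewrite linearD /= IHy IHz addr0.
by rewrite !fextM IHy linear0 -[LHS]/(mull _ 0) linear0.
Qed.

Lemma pext_pi x : pext mul one f (palg_pi x) = fext mul one f x.
Proof.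
apply/eqP; rewrite -subr_eq0 -linearB /=; apply/eqP.
by apply: fext_ideal_span; apply: (@repr_quotmod k _ ideal_submodule).
Qed.

Lemma pext_pgen g : pext mul one f (pgen g) = f g.
Proof. by rewrite pext_pi /fext mliftU fmuE big_seq1. Qed.

Lemma pextM u v :
  pext mul one f (u * v) = mul (pext mul one f u) (pext mul one f v).
Proof.
elim/palgW: u => x; elim/palgW: v => y.
by rewrite [_ * _]palg_mulE !pext_pi fextM.
Qed.

End Extension.

End Presentation.

(* The operations of a Hopf algebra, without axioms (these are is_hopf below):*)
(* the twist is defined for arbitrary forms, and its multiplication satisfies *)
(* the axioms only when the form is a 2-cocycle.                              *)

Record hopf_data (k : fieldType) := HopfData {
  hsort :> lmodType k;
  hmul : hsort -> hsort -> hsort;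
  hone : hsort;
  hcomul : hsort -> tens 2 hsort;
  hcounit : hsort -> k;
  hantipode : hsort -> hsort }.

(* The factorwise product (a_1 (x) ... )(b_1 (x) ...) = a_1 b_1 (x) ...       *)
Definition tmul (k : fieldType) (n : nat) (V : lmodType k)
    (mul : V -> V -> V) (s t : tens n V) : tens n V :=
  tlift (fun a : {ffun 'I_n -> V} =>
    tlift (fun b : {ffun 'I_n -> V} =>
      ptens [ffun i => mul (a i) (b i)]) t) s.

Section HopfDefs.
Variables (k : fieldType) (H : hopf_data k).

(* Sweedler sums: sweedler f a stands for f a_(1) a_(2), and sweedler3 f a    *)
(* for f a_(1) a_(2) a_(3).                                                   *)
Definition sweedler (W : lmodType k) (f : H -> H -> W) (a : H) : W :=
  tlift (fun c : {ffun 'I_2 -> H} => f (c ord0) (c ord_max)) (hcomul a).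

Definition sweedler3 (W : lmodType k) (f : H -> H -> H -> W) (a : H) : W :=
  sweedler (fun a1 a' => sweedler (fun a2 a3 => f a1 a2 a3) a') a.

Definition is_algebra : Prop :=
  [/\ forall b, linear ((@hmul k H)^~ b),
      forall a, linear (@hmul k H a),
      associative (@hmul k H),
      left_id (hone H) (@hmul k H)
    & right_id (hone H) (@hmul k H)].

Definition is_coalgebra : Prop :=
  [/\ linear (@hcomul k H),
      scalar (@hcounit k H),
      forall a : H,
        sweedler (fun a1 a2 => sweedler (fun b c => tens3 b c a2) a1) a
        = sweedler (fun a1 a2 => sweedler (fun b c => tens3 a1 b c) a2) a,
      forall a : H, sweedler (fun a1 a2 => hcounit a1 *: a2) a = a
    & forall a : H, sweedler (fun a1 a2 => hcounit a2 *: a1) a = a].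

Definition is_bialgebra : Prop :=
  [/\ is_algebra /\ is_coalgebra,
      forall a b : H,
        hcomul (hmul a b) = tmul (@hmul k H) (hcomul a) (hcomul b),
      hcomul (hone H) = tens2 (hone H) (hone H),
      forall a b : H, hcounit (hmul a b) = hcounit a * hcounit b
    & hcounit (hone H) = 1].

Definition is_hopf : Prop :=
  [/\ is_bialgebra,
      linear (@hantipode k H),
      forall a : H,
        sweedler (fun a1 a2 => hmul (hantipode a1) a2) a = hcounit a *: hone H
    & forall a : H,
        sweedler (fun a1 a2 => hmul a1 (hantipode a2)) a = hcounit a *: hone H].

Definition is_bilinear_form (s : H -> H -> k) : Prop :=
  (forall b, scalar (s^~ b)) /\ (forall a, scalar (s a)).

(* t is the inverse of s in the convolution algebra of (H (x) H)^*. *)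
Definition conv_inverse (s t : H -> H -> k) : Prop :=
  forall a b : H,
    sweedler (W := k^o) (fun a1 a2 =>
      sweedler (W := k^o) (fun b1 b2 => s a1 b1 * t a2 b2) b) a
      = hcounit a * hcounit b
    /\
    sweedler (W := k^o) (fun a1 a2 =>
      sweedler (W := k^o) (fun b1 b2 => t a1 b1 * s a2 b2) b) a
      = hcounit a * hcounit b.

(* s is a Hopf 2-cocycle whose convolution inverse is t. *)
Definition hopf_2cocycle (s t : H -> H -> k) : Prop :=
  [/\ is_bilinear_form s /\ is_bilinear_form t,
      conv_inverse s t,
      forall a : H, s a (hone H) = hcounit a /\ s (hone H) a = hcounit a
    & forall a b c : H,
        sweedler (W := k^o) (fun a1 a2 =>
          sweedler (W := k^o) (fun b1 b2 =>
            s a1 b1 * s (hmul a2 b2) c) b) a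
        = sweedler (W := k^o) (fun b1 b2 =>
          sweedler (W := k^o) (fun c1 c2 =>
            s b1 c1 * s a (hmul b2 c2)) c) b].

Section Twist.
Variables s t : H -> H -> k.

Definition twist_mul (a b : H) : H :=
  sweedler3 (fun a1 a2 a3 =>
    sweedler3 (fun b1 b2 b3 => (s a1 b1 * t a3 b3) *: hmul a2 b2) b) a.

Definition twist_U (a : H) : k :=
  sweedler (W := k^o) (fun a1 a2 => s a1 (hantipode a2)) a.

Definition twist_Uinv (a : H) : k :=
  sweedler (W := k^o) (fun a1 a2 => t (hantipode a1) a2) a.

Definition twist_antipode (a : H) : H :=
  sweedler3 (fun a1 a2 a3 => (twist_U a1 * twist_Uinv a3) *: hantipode a2) a.

(* t plays the role of the convolution inverse of s. *)
Definition twist : hopf_data k :=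
  HopfData twist_mul (hone H) (@hcomul k H) (@hcounit k H) twist_antipode.

End Twist.

Section HopfPower.
Variable n : nat.

Definition hslot (i : 'I_n) (a : H) : tens n H :=
  ptens [ffun j => if j == i then a else hone H].

Definition hslot2 (i : 'I_n) : tens 2 H -> tens 2 (tens n H) :=
  tlift (fun c : {ffun 'I_2 -> H} =>
    tens2 (hslot i (c ord0)) (hslot i (c ord_max))).

Definition hpow_mul : tens n H -> tens n H -> tens n H := tmul (@hmul k H).

Definition hpow_one : tens n H := ptens [ffun=> hone H].

(* The sum of the (a_1(1) (x) ... (x) a_n(1)) (x) (a_1(2) (x) ... (x) a_n(2)),*)
(* obtained as the product in the algebra (H^(x)n) (x) (H^(x)n) of the images *)
(* of the Delta(a_i) under the i-th slot inclusions, which commute.           *)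
Definition hpow_comul : tens n H -> tens 2 (tens n H) :=
  tlift (fun a : {ffun 'I_n -> H} =>
    \big[tmul hpow_mul/tens2 hpow_one hpow_one]_(i < n)
      hslot2 i (hcomul (a i))).

Definition hpow_counit : tens n H -> k :=
  tlift (W := k^o) (fun a : {ffun 'I_n -> H} => \prod_(i < n) hcounit (a i)).

Definition hpow_antipode : tens n H -> tens n H :=
  tlift (fun a : {ffun 'I_n -> H} => ptens [ffun i => hantipode (a i)]).

Definition hpow : hopf_data k :=
  HopfData hpow_mul hpow_one hpow_comul hpow_counit hpow_antipode.

End HopfPower.

End HopfDefs.

Definition hopf_iso (k : fieldType) (A B : hopf_data k) (f : A -> B) : Prop :=
  [/\ linear f /\ bijective f,
      (forall a b, f (hmul a b) = hmul (f a) (f b)) /\ f (hone A) = hone B,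
      forall a, hcomul (f a) = sweedler (fun a1 a2 => tens2 (f a1) (f a2)) a,
      forall a, hcounit (f a) = hcounit a
    & forall a, f (hantipode a) = hantipode (f a)].

Definition lattice (n : nat) := {ffun 'I_n -> int}.

Definition eps n (i : 'I_n) : lattice n := [ffun j => (j == i)%:Z].

Definition star n (a b : lattice n) : int :=
  \sum_(j < n) \sum_(i < n | (j < i)%N) a i * b j.

Definition theta (k : fieldType) (q : k) n (a b : lattice n) : k :=
  q ^ (star a b - star b a).

(* The box 0 <= a_i <= l - 1 of exponents. *)
Definition in_box (l : nat) n (a : lattice n) : Prop :=
  forall i, 0 <= a i <= l%:Z - 1.

Inductive taft_gen (n : nat) : Type :=
| GenK of 'I_n
| GenKinv of 'I_n
| GenX of 'I_n.

HB.instance Definition _ n := gen_eqMixin (taft_gen n).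
HB.instance Definition _ n := gen_choiceMixin (taft_gen n).

Section Taft.
Variables (k : fieldType) (l : nat) (q : k) (n : nat).

Local Notation fK i := (fgen k (GenK i)).
Local Notation fV i := (fgen k (GenKinv i)).
Local Notation fX i := (fgen k (GenX i)).

Inductive taft_rel :
  {malg k[{fmonom taft_gen n}]} -> {malg k[{fmonom taft_gen n}]} -> Prop :=
| TaftKKinv i : taft_rel (fK i * fV i) 1
| TaftKinvK i : taft_rel (fV i * fK i) 1
| TaftKC i j : taft_rel (fK i * fK j) (fK j * fK i)
| TaftKl i : taft_rel (fK i ^+ l) 1
| TaftKX i j : taft_rel (fK i * fX j * fV i)
    ((theta q (eps i) (eps j) * q ^+ (i == j)) *: fX j)
| TaftXX i j : taft_rel (fX i * fX j)
    (theta q (eps i) (eps j) *: (fX j * fX i))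
| TaftXl i : taft_rel (fX i ^+ l) 0.

Definition taft_alg : Type := palg taft_rel.
HB.instance Definition _ := GRing.Lmodule.on taft_alg.
HB.instance Definition _ := GRing.PzRing.on taft_alg.

Definition tK (i : 'I_n) : taft_alg := pgen taft_rel (GenK i).
Definition tKinv (i : 'I_n) : taft_alg := pgen taft_rel (GenKinv i).
Definition tX (i : 'I_n) : taft_alg := pgen taft_rel (GenX i).

(* K(alpha), with inverses K(eps_i)^-1 given by the generators tKinv. *)
Definition tKpow (a : lattice n) : taft_alg :=
  \prod_(i < n) match a i with
                | Posz m => tK i ^+ m
                | Negz m => tKinv i ^+ m.+1
                end.

Definition taft_mul (u v : taft_alg) : taft_alg := u * v.

Definition taft_comul : taft_alg -> tens 2 taft_alg :=
  pext (W := tens 2 taft_alg) (tmul taft_mul) (tens2 (1 : taft_alg) 1) (fun g => match g with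
    | GenK i => tens2 (tK i) (tK i)
    | GenKinv i => tens2 (tKinv i) (tKinv i)
    | GenX i => tens2 (tX i) 1 + tens2 (tK i) (tX i)
    end).

Definition taft_counit : taft_alg -> k :=
  pext (W := k^o) *%R 1 (fun g => match g with
    | GenK _ => 1
    | GenKinv _ => 1
    | GenX _ => 0
    end).

(* The antipode is an algebra map to the opposite algebra. *)
Definition taft_antipode : taft_alg -> taft_alg :=
  pext (W := taft_alg) (fun u v => taft_mul v u) 1 (fun g => match g with
    | GenK i => tKinv i
    | GenKinv i => tK i
    | GenX i => - (tKinv i * tX i)
    end).

Definition taft : hopf_data k :=
  HopfData taft_mul 1 taft_comul taft_counit taft_antipode.

End Taft.

Section TaftPower.
Variables (k : fieldType) (l : nat) (q : k) (n : nat).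

Definition taft_pow : hopf_data k := hpow (taft l q 1) n.

(* K(alpha) in the tensor power. *)
Definition powK (a : lattice n) : taft_pow :=
  ptens [ffun i => tKpow l q (eps (ord0 : 'I_1) *~ a i)].

(* x^gamma K(alpha) with gamma = c; used for c >= 0 only. *)
Definition powXK (c a : lattice n) : taft_pow :=
  ptens [ffun i => tX l q (ord0 : 'I_1) ^+ `|c i|%N
                   * tKpow l q (eps (ord0 : 'I_1) *~ a i)].

Definition is_basis_vector (u : taft_pow) : Prop :=
  exists c a : lattice n, [/\ in_box l c, in_box l a & u = powXK c a].

Definition in_spanK (u : taft_pow) : Prop :=
  exists s : seq (k * lattice n), u = \sum_(p <- s) p.1 *: powK p.2.

Definition taft_cocycle_spec (sigma : taft_pow -> taft_pow -> k) : Prop :=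
  (forall a b : lattice n, sigma (powK a) (powK b) = q ^ (- star b a))
  /\ (forall u v : taft_pow, is_basis_vector u -> is_basis_vector v ->
        ~ in_spanK u \/ ~ in_spanK v -> sigma u v = 0).

End TaftPower.

(* Main.v *)
(** No PBW basis is needed. The characters chi_c of the torus, K(a) |-> q^(c.a)
    and x_i |-> 0, are algebra maps on both sides; the maps
    a |-> chi_c(a_(1)) a_(2) and a |-> chi_c(a_(2)) a_(1) are then commuting
    algebra automorphisms for which every word in the generators is a joint
    eigenvector, so words carry a left and a right degree in Z^n. The cocycle is
    a bicharacter of the torus pulled back along x_i |-> 0, written as a linear
    combination of products of characters by Fourier inversion. Hence on
    homogeneous elements of bidegrees (g, h) and (g', h') the twisted product is
    just the product times q^(w(g, g') - w(h, h')), and all axioms reduce to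
    identities between exponents. The presentation of the Taft algebra gives an
    algebra map to the twisted tensor power, and the tensor power maps in the
    same way to the Taft algebra twisted by the inverse form. Both maps rescale
    words by powers of q that are inverse to each other, so they are mutually
    inverse. That the coproduct respects x_i^l = 0 is the q-binomial formula at a
    primitive l-th root of unity. *)

Require Import Defs.
From HB Require Import structures.
From mathcomp Require Import all_boot all_order all_algebra.
From mathcomp Require Import boolp finmap monalg ring zify.

Set Implicit Arguments.
Unset Strict Implicit.
Unset Printing Implicit Defensive.

Import GRing.Theory.
Local Open Scope ring_scope.

(** * Linear and bilinear maps *)

(** [GenK i] and [GenKinv i] have equal left and right degrees, whereas [GenX i] has left degree e_i
    and right degree 0. So the twist leaves the relations among the K(e_i) alone, and when x_j is
    exchanged with a letter of another index only left degrees contribute, through the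
    antisymmetrisation w(e_i, e_j) - w(e_j, e_i). For w(a, b) = - b * a this is the exponent of
    theta(e_i, e_j): that choice of sigma turns commuting tensor factors into the q-commutation of
    the Taft algebra.

    The obstacle is that no dimension is available on either side, so bijectivity cannot come from a
    surjection and a count; an inverse has to be constructed. It is a second instance of the same
    construction, which is why the twist is studied for an arbitrary Hopf algebra of type
    [taft_like] and then applied on both sides. Characteristic 0 gives l <> 0 in k, so that Fourier
    inversion can divide by l^n. *)

Section AdditiveMaps.
Variables (U V : zmodType) (f : U -> V).
Hypothesis fD : {morph f : x y / x + y}.

Lemma morphD0 : f 0 = 0.
Proof. by apply: (addrI (f 0)); rewrite -fD !addr0. Qed.

Lemma morphDN x : f (- x) = - f x.
Proof. by apply/eqP; rewrite -addr_eq0 -fD addNr morphD0. Qed.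

Lemma morphDMn x m : f (x *+ m) = f x *+ m.
Proof. by elim: m => [|m IH]; rewrite ?morphD0 // !mulrS fD IH. Qed.

End AdditiveMaps.

Section LinearMaps.
Variables (k : fieldType) (U V W : lmodType k).

Definition bilin (f : U -> V -> W) : Prop :=
  (forall v, linear (f^~ v)) /\ (forall u, linear (f u)).

Variables (f : U -> V) (f_lin : linear f).

Lemma lin0 : f 0 = 0.
Proof. by have := f_lin (-1) 0 0; rewrite !scaleN1r !addNr. Qed.

Lemma linD x y : f (x + y) = f x + f y.
Proof. by have := f_lin 1 x y; rewrite !scale1r. Qed.

Lemma linZ a x : f (a *: x) = a *: f x.
Proof. by have := f_lin a x 0; rewrite lin0 !addr0. Qed.

Lemma linN x : f (- x) = - f x.
Proof. by rewrite -!scaleN1r linZ. Qed.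

Lemma linear_comp (g : V -> W) : linear g -> linear (g \o f).
Proof. by move=> g_lin a x y /=; rewrite f_lin g_lin. Qed.

Lemma linear_lincomb (g : U -> V) (c : k) :
  linear g -> linear (fun x => c *: f x + g x).
Proof.
move=> g_lin a x y.
by rewrite f_lin g_lin !scalerDr !scalerA addrACA [c * a]mulrC.
Qed.

Lemma linearZ_fun (c : k) : linear (fun x => c *: f x).
Proof. by move=> a x y; rewrite f_lin scalerDr !scalerA mulrC. Qed.

End LinearMaps.

Lemma linear_scale (k : fieldType) (U V : lmodType k) (v : V) (f : U -> k) :
  scalar f -> linear (fun x => f x *: v).
Proof. by move=> f_lin a x y; rewrite f_lin scalerDl scalerA. Qed.

Lemma linear_sum_fun (k : fieldType) (U V : lmodType k) (I : Type) (r : seq I)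
    (F : I -> U -> V) :
  (forall i, linear (F i)) -> linear (fun x => \sum_(i <- r) F i x).
Proof.
move=> F_lin a x y; rewrite scaler_sumr -big_split /=.
by apply: eq_bigr => i _; rewrite F_lin.
Qed.

(** * Algebras given by a bare product and unit *)

Section Algebras.
Variable k : fieldType.

Definition is_alg (W : lmodType k) (mul : W -> W -> W) (one : W) : Prop :=
  [/\ forall b, linear (mul^~ b), forall a, linear (mul a), associative mul,
      left_id one mul & right_id one mul].

Definition is_alg_map (U W : lmodType k) (mulU : U -> U -> U) (oneU : U)
    (mulW : W -> W -> W) (oneW : W) (f : U -> W) : Prop :=
  [/\ linear f, f oneU = oneW
    & forall a b, f (mulU a b) = mulW (f a) (f b)].

(* A carrier type on which the ring notations and theory become available. *)
Definition kring (W : lmodType k) (mul : W -> W -> W) (one : W)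
  (algW : is_alg mul one) : Type := W.

Section Ring.
Variables (W : lmodType k) (mul : W -> W -> W) (one : W).
Variable algW : is_alg mul one.

Let mulA : associative mul. Proof. by case: algW. Qed.
Let mul1l : left_id one mul. Proof. by case: algW. Qed.
Let mul1r : right_id one mul. Proof. by case: algW. Qed.
Let mulDl : left_distributive mul +%R.
Proof. by case: algW => Hl _ _ _ _ x y z; apply: (linD (Hl z)). Qed.
Let mulDr : right_distributive mul +%R.
Proof. by case: algW => _ Hr _ _ _ x y z; apply: (linD (Hr x)). Qed.

HB.instance Definition _ := GRing.Lmodule.on (kring algW).
HB.instance Definition _ := GRing.Zmodule_isPzRing.Build (kring algW)
  mulA mul1l mul1r mulDl mulDr.

Lemma kscalerAl (c : k) (x y : kring algW) : c *: (x * y) = (c *: x) * y.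
Proof. by case: algW => Hl _ _ _ _; rewrite -(linZ (Hl y)). Qed.

Lemma kscalerAr (c : k) (x y : kring algW) : c *: (x * y) = x * (c *: y).
Proof. by case: algW => _ Hr _ _ _; rewrite -(linZ (Hr x)). Qed.

Lemma kring_expE (x : W) m :
  iter m (mul x) one = (x : kring algW) ^+ m.
Proof. by elim: m => // m IHm; rewrite exprS /= IHm. Qed.

End Ring.

Lemma field_alg : is_alg (W := k^o) *%R 1.
Proof.
split=> [b a x y|a c x y| | |]; first by rewrite mulrDl -mulrA.
- by rewrite mulrDr; congr (_ + _); rewrite mulrCA.
- exact: mulrA.
- exact: mul1r.
- exact: mulr1.
Qed.

Lemma opp_alg (W : lmodType k) (mul : W -> W -> W) (one : W) :
  is_alg mul one -> is_alg (fun u v => mul v u) one.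
Proof. by case=> Hl Hr mulA mul1l mul1r; split=> // x y z; rewrite mulA. Qed.

End Algebras.

Lemma malg_ind (k : fieldType) (K : choiceType) (P : {malg k[K]} -> Prop) :
    P 0 -> (forall a x y, P x -> P y -> P (a *: x + y)) ->
    (forall m, P << m >>) -> forall x, P x.
Proof.
move=> P0 PD PU x; rewrite (monalgE x).
apply: big_ind => // [y z Py Pz|m _].
  by rewrite -[y]scale1r; apply: PD.
rewrite -[<< _ *g _ >>]addr0; suff -> : << x@_m *g m >> = x@_m *: << m >>.
  by apply: PD.
by apply/malgP => i; rewrite mcoeffZ !mcoeffU mulrnAr mulr1.
Qed.

(** * Tensors *)

(* The unification of two distinct instances of [tlift] or [tmul] would unfold
   them down to the quotient structure; the locked copies prevent this. *)
HB.lock Definition llift (k : fieldType) (n : nat) (V W : lmodType k)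
  (f : {ffun 'I_n -> V} -> W) (t : tens n V) : W := tlift f t.

Lemma llift_ptens (k : fieldType) (n : nat) (V W : lmodType k)
    (f : {ffun 'I_n -> V} -> W) v :
  multilinear f -> llift f (ptens v) = f v.
Proof. by rewrite llift.unlock => /tlift_ptens ->. Qed.

Lemma llift_linear (k : fieldType) (n : nat) (V W : lmodType k)
    (f : {ffun 'I_n -> V} -> W) : multilinear f -> linear (llift f).
Proof. by rewrite llift.unlock; apply: tlift_linear. Qed.

HB.lock Definition lmul (k : fieldType) (n : nat) (V : lmodType k)
    (mul : V -> V -> V) (s t : tens n V) : tens n V :=
  llift (fun a : {ffun 'I_n -> V} =>
    llift (fun b : {ffun 'I_n -> V} => ptens [ffun i => mul (a i) (b i)]) t) s.

Lemma lmulE (k : fieldType) (n : nat) (V : lmodType k) (mul : V -> V -> V) :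
  @lmul k n V mul = tmul mul.
Proof. by rewrite lmul.unlock llift.unlock. Qed.

Section BilinearMaps.
Variables (k : fieldType) (U V W X Y : lmodType k).

Lemma bilin_comp (h : W -> X -> Y) (f : U -> W) (g : V -> X) :
  bilin h -> linear f -> linear g -> bilin (fun a b => h (f a) (g b)).
Proof. by move=> [hl hr] f_lin g_lin; split=> [b|a] c x y; rewrite (f_lin, g_lin) (hl, hr). Qed.

Lemma bilin_swap (h : U -> V -> W) : bilin h -> bilin (fun a b => h b a).
Proof. by case=> hl hr; split=> [b|a]; [apply: hr | apply: hl]. Qed.

Lemma bilin_scale (f : U -> k) : scalar f -> bilin (fun a (v : V) => f a *: v).
Proof.
move=> f_lin; split=> [b|a] c x y.
  by rewrite f_lin scalerDl scalerA.
by rewrite scalerDr !scalerA mulrC.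
Qed.

Lemma bilin_alg (mul : W -> W -> W) (one : W) : is_alg mul one -> bilin mul.
Proof. by case. Qed.

Lemma linear_id : linear (id : W -> W). Proof. by []. Qed.

End BilinearMaps.
Arguments linear_id {k} W.

Section Tensors.
Variable k : fieldType.

Section Ext.
Variables (n : nat) (V : lmodType k).

Lemma tens_ind (P : tens n V -> Prop) :
    P 0 -> (forall a x y, P x -> P y -> P (a *: x + y)) ->
    (forall v, P (ptens v)) -> forall t, P t.
Proof.
move=> P0 PD Pp; elim/quotmodW => x.
have pi_lin := quotmod_pi_linear (multilin_submodule n V).
elim/malg_ind: x => [|a x y Px Py|m]; last exact: Pp.
  by have -> := lin0 pi_lin.
by rewrite pi_lin; apply: PD.
Qed.

Lemma tens_ext (W : lmodType k) (f g : tens n V -> W) :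
  linear f -> linear g -> (forall v, f (ptens v) = g (ptens v)) -> f =1 g.
Proof.
move=> f_lin g_lin efg; elim/tens_ind => [|a x y fx fy|v //].
  by rewrite (lin0 f_lin) (lin0 g_lin).
by rewrite f_lin g_lin fx fy.
Qed.

End Ext.

Section TensorAlgebra.
Variables (n : nat) (V : lmodType k) (mul : V -> V -> V) (one : V).

Lemma upd_mull (a b : {ffun 'I_n -> V}) i u :
  [ffun j => mul (upd a i u j) (b j)]
  = upd [ffun j => mul (a j) (b j)] i (mul u (b i)).
Proof. by apply/ffunP=> j; rewrite !ffunE; case: eqP => [->|]. Qed.

Lemma upd_mulr (a b : {ffun 'I_n -> V}) i u :
  [ffun j => mul (a j) (upd b i u j)]
  = upd [ffun j => mul (a j) (b j)] i (mul (a i) u).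
Proof. by apply/ffunP=> j; rewrite !ffunE; case: eqP => [->|]. Qed.

Hypothesis algV : is_alg mul one.

Let mulr_ML (a : {ffun 'I_n -> V}) :
  multilinear (fun b : {ffun 'I_n -> V} => ptens [ffun i => mul (a i) (b i)]).
Proof.
move=> b i c u w; rewrite !upd_mulr -ptens_multilinear.
by case: algV => _ -> _ _ _.
Qed.

Let mull_ML (t : tens n V) :
  multilinear (fun a : {ffun 'I_n -> V} =>
    llift (fun b : {ffun 'I_n -> V} => ptens [ffun i => mul (a i) (b i)]) t).
Proof.
move=> a i c u w.
apply: (tens_ext (f := llift _) (g := fun t => c *: llift _ t + llift _ t)).
- exact: llift_linear.
- by apply: linear_lincomb; apply: llift_linear.
move=> b; rewrite !(llift_ptens _ (@mulr_ML _)) !upd_mull -ptens_multilinear.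
by case: algV => -> _ _ _ _.
Qed.

Lemma lmul_ptens (a b : {ffun 'I_n -> V}) :
  lmul mul (ptens a) (ptens b) = ptens [ffun i => mul (a i) (b i)].
Proof. by rewrite lmul.unlock (llift_ptens _ (@mull_ML _)) (llift_ptens _ (@mulr_ML _)). Qed.

Lemma lmul_linl (t : tens n V) : linear ((lmul mul)^~ t).
Proof. by rewrite lmul.unlock; apply: (llift_linear (@mull_ML t)). Qed.

Lemma lmul_linr (s : tens n V) : linear (lmul mul s).
Proof.
elim/tens_ind: s => [|c s s' IHs IHs'|a] d x y; last 1 first.
- by rewrite lmul.unlock !(llift_ptens _ (@mull_ML _)) (llift_linear (@mulr_ML a) d).
- by rewrite !(lin0 (@lmul_linl _)) scaler0 addr0.
- rewrite !(@lmul_linl _ c s s').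
  exact: (linear_lincomb IHs c IHs').
Qed.

Lemma tens_alg : is_alg (lmul mul) (ptens [ffun=> one] : tens n V).
Proof.
have [_ _ mulA mul1l mul1r] := algV.
split; [exact: lmul_linl | exact: lmul_linr | | |].
- move=> x y z.
  elim/tens_ind: x => [|c x x' IH IH'|a].
  + by rewrite !(lin0 (@lmul_linl _)).
  + by rewrite !(@lmul_linl _ c) IH IH'.
  elim/tens_ind: y => [|c y y' IH IH'|b].
  + by rewrite (lin0 (@lmul_linl _)) !(lin0 (@lmul_linr _)) (lin0 (@lmul_linl _)).
  + by rewrite (@lmul_linl _ c) !(@lmul_linr _ c) IH IH' (@lmul_linl _ c).
  elim/tens_ind: z => [|c z z' IH IH'|d].
  + by rewrite !(lin0 (@lmul_linr _)).
  + by rewrite !(@lmul_linr _ c) IH IH'.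
  rewrite !lmul_ptens; congr ptens; apply/ffunP=> i.
  by rewrite !ffunE mulA.
- apply: tens_ext => [||v]; [exact: lmul_linr | by move=> c x y |].
  by rewrite lmul_ptens; congr ptens; apply/ffunP=> i; rewrite !ffunE mul1l.
- apply: tens_ext => [||v]; [exact: lmul_linl | by move=> c x y |].
  by rewrite lmul_ptens; congr ptens; apply/ffunP=> i; rewrite !ffunE mul1r.
Qed.

End TensorAlgebra.

(** * Maps out of the tensor square *)

Section Tens2.
Variable V : lmodType k.

Lemma tens2E (v : {ffun 'I_2 -> V}) : ptens v = tens2 (v ord0) (v ord_max).
Proof.
congr ptens; apply/ffunP=> i; rewrite ffunE.
by case: i => [[|[|//]] p] /=; congr (v _); apply: val_inj.
Qed.

Lemma tens2_ind (P : tens 2 V -> Prop) :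
    P 0 -> (forall a x y, P x -> P y -> P (a *: x + y)) ->
    (forall a b, P (tens2 a b)) -> forall t, P t.
Proof. by move=> P0 PD Pt; apply: tens_ind => // v; rewrite tens2E. Qed.

Lemma tens2_ext (W : lmodType k) (f g : tens 2 V -> W) :
  linear f -> linear g -> (forall a b, f (tens2 a b) = g (tens2 a b)) ->
  f =1 g.
Proof. by move=> f_lin g_lin efg; apply: tens_ext => // v; rewrite tens2E. Qed.

Definition lift2 (W : lmodType k) (f : V -> V -> W) : tens 2 V -> W :=
  llift (fun c : {ffun 'I_2 -> V} => f (c ord0) (c ord_max)).

Lemma bilin_multilinear (W : lmodType k) (f : V -> V -> W) :
  bilin f -> multilinear (fun c : {ffun 'I_2 -> V} => f (c ord0) (c ord_max)).
Proof.
move=> [Hl Hr] v i a u w; rewrite !ffunE.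
by case: i => [[|[|//]] p] /=; rewrite ?(Hl _ a) ?(Hr _ a).
Qed.

Lemma lift2_linear (W : lmodType k) (f : V -> V -> W) :
  bilin f -> linear (lift2 f).
Proof. by move/bilin_multilinear/llift_linear. Qed.

Lemma lift2_tens2 (W : lmodType k) (f : V -> V -> W) a b :
  bilin f -> lift2 f (tens2 a b) = f a b.
Proof.
by move=> fB; rewrite /lift2 (llift_ptens _ (bilin_multilinear fB)) !ffunE.
Qed.

(** Reduces linearity of [tens2] and [tens3] in one argument to [ptens_multilinear]. The 0 standing
    at the varied position of [v] in the applications is a placeholder that [upd] overwrites. *)
Lemma linear_ptens_upd (n : nat) (g : V -> {ffun 'I_n -> V}) v i :
  (forall u, g u = upd v i u) -> linear (fun u => ptens (g u)).
Proof.
by move=> gE a x y; rewrite (gE (a *: x + y)) (gE x) (gE y); apply: ptens_multilinear.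
Qed.

Lemma tens2_bilin : bilin (@tens2 k V).
Proof.
split=> [b|a].
  apply: (linear_ptens_upd (v := [ffun i : 'I_2 => nth 0 [:: 0; b] i]) (i := ord0)) => u.
  by apply/ffunP=> i; rewrite !ffunE; case: i => [[|[|//]] p].
apply: (linear_ptens_upd (v := [ffun i : 'I_2 => nth 0 [:: a; 0] i]) (i := ord_max)) => u.
by apply/ffunP=> i; rewrite !ffunE; case: i => [[|[|//]] p].
Qed.

Lemma tens3_lin1 b c : linear (fun a : V => tens3 a b c).
Proof.
apply: (linear_ptens_upd (v := [ffun i : 'I_3 => nth 0 [:: 0; b; c] i])
  (i := ord0)) => u.
by apply/ffunP=> i; rewrite !ffunE; case: i => [[|[|[|//]]] p].
Qed.

Lemma tens3_lin2 a c : linear (fun b : V => tens3 a b c).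
Proof.
apply: (linear_ptens_upd (v := [ffun i : 'I_3 => nth 0 [:: a; 0; c] i])
  (i := lift ord0 ord0)) => u.
by apply/ffunP=> i; rewrite !ffunE; case: i => [[|[|[|//]]] p].
Qed.

Lemma tens3_lin3 a b : linear (fun c : V => tens3 a b c).
Proof.
apply: (linear_ptens_upd (v := [ffun i : 'I_3 => nth 0 [:: a; b; 0] i])
  (i := ord_max)) => u.
by apply/ffunP=> i; rewrite !ffunE; case: i => [[|[|[|//]]] p].
Qed.

Lemma lift2_comp (W X : lmodType k) (f : V -> V -> W) (g : W -> X) t :
  bilin f -> linear g -> g (lift2 f t) = lift2 (fun a b => g (f a b)) t.
Proof.
move=> fB g_lin.
have gfB : bilin (fun a b => g (f a b)).
  by case: fB => fl fr; split=> [b|a] c x y; rewrite (fl, fr) g_lin.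
apply: (tens2_ext (f := g \o lift2 f)).
- exact: (linear_comp (lift2_linear fB) g_lin).
- exact: lift2_linear.
by move=> a b /=; rewrite !lift2_tens2.
Qed.

Lemma eq_lift2 (W : lmodType k) (f g : V -> V -> W) t :
  (forall a b, f a b = g a b) -> lift2 f t = lift2 g t.
Proof.
by move=> efg; suff -> : f = g by []; apply/funext => a; apply/funext => b.
Qed.

Lemma lift2_commute (W : lmodType k) (mulW : W -> W -> W) (oneW : W)
    (f g : V -> V -> W) s t :
  is_alg mulW oneW -> bilin f -> bilin g ->
  (forall a b c d, mulW (f a b) (g c d) = mulW (g c d) (f a b)) ->
  mulW (lift2 f s) (lift2 g t) = mulW (lift2 g t) (lift2 f s).
Proof.
move=> [Wl Wr _ _ _] fB gB fg; have fL := lift2_linear fB; have gL := lift2_linear gB.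
move: s; apply: tens2_ext => [||a b].
- exact: (linear_comp fL (Wl _)).
- exact: (linear_comp fL (Wr _)).
move: t; apply: tens2_ext => [||c d].
- exact: (linear_comp gL (Wr _)).
- exact: (linear_comp gL (Wl _)).
by rewrite !lift2_tens2.
Qed.

Lemma linear_lift2_param (U W : lmodType k) (h : U -> V -> V -> W) t :
  (forall a b, linear (fun u => h u a b)) -> (forall u, bilin (h u)) ->
  linear (fun u => lift2 (h u) t).
Proof.
move=> h_lin hB c x y; apply: (tens2_ext (f := lift2 (h _))
  (g := fun t => c *: lift2 (h x) t + lift2 (h y) t)).
- exact: lift2_linear.
- by apply: linear_lincomb; apply: lift2_linear.
by move=> a b; rewrite !lift2_tens2 // (h_lin a b c).
Qed.

Lemma lift2_sum (W : lmodType k) (I : Type) (r : seq I) (F : I -> V -> V -> W) t :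
  (forall i, bilin (F i)) ->
  lift2 (fun a b => \sum_(i <- r) F i a b) t = \sum_(i <- r) lift2 (F i) t.
Proof.
move=> FB; have FsB : bilin (fun a b => \sum_(i <- r) F i a b).
  by split=> [b|a]; apply: linear_sum_fun => i; case: (FB i).
apply: (tens2_ext (g := fun t => \sum_(i <- r) lift2 (F i) t)).
- exact: lift2_linear.
- by apply: linear_sum_fun => i; apply: lift2_linear.
by move=> a b; rewrite lift2_tens2 //; apply: eq_bigr => i _; rewrite lift2_tens2.
Qed.

Variables (mul : V -> V -> V) (one : V).
Hypothesis algV : is_alg mul one.

Lemma lmul_tens2 a b c d :
  lmul mul (tens2 a b) (tens2 c d) = tens2 (mul a c) (mul b d).
Proof.
rewrite (lmul_ptens algV); congr ptens; apply/ffunP=> i; rewrite !ffunE.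
by case: i => [[|[|//]] p].
Qed.

Lemma tens2_alg : is_alg (lmul mul) (tens2 one one).
Proof.
suff -> : tens2 one one = ptens [ffun=> one] by apply: tens_alg.
by rewrite tens2E !ffunE.
Qed.

Lemma lmul_tens3 a b c d e f :
  lmul mul (tens3 a b c) (tens3 d e f) = tens3 (mul a d) (mul b e) (mul c f).
Proof.
rewrite (lmul_ptens algV); congr ptens; apply/ffunP=> i; rewrite !ffunE.
by case: i => [[|[|[|//]]] p].
Qed.

(** The three maps may differ because a further leg can enter as a parameter: [tens3 b c (mul x y)]
    splits into factors with last entries x and y, as coassociativity requires. *)
Lemma lift2_mul (W : lmodType k) (mulW : W -> W -> W) (oneW : W)
    (f g h : V -> V -> W) s t :
  is_alg mulW oneW -> bilin f -> bilin g -> bilin h ->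
  (forall a b c d, h (mul a c) (mul b d) = mulW (f a b) (g c d)) ->
  lift2 h (lmul mul s t) = mulW (lift2 f s) (lift2 g t).
Proof.
move=> [Wl Wr _ _ _] fB gB hB fM.
have fL := lift2_linear fB; have gL := lift2_linear gB.
have hL := lift2_linear hB.
have [Tl Tr _ _ _] := tens2_alg.
elim/tens2_ind: s => [|c x y IH IH'|a b].
- by rewrite (lin0 (Tl _)) (lin0 hL) (lin0 fL) (lin0 (Wl _)).
- by rewrite Tl hL fL IH IH' Wl.
elim/tens2_ind: t => [|e x y IH IH'|c d].
- by rewrite (lin0 (Tr _)) (lin0 hL) (lin0 gL) (lin0 (Wr _)).
- by rewrite Tr hL gL IH IH' Wr.
by rewrite lmul_tens2 !lift2_tens2.
Qed.

Lemma lift2_alg_map (W : lmodType k) (mulW : W -> W -> W) (oneW : W)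
    (f : V -> V -> W) :
  is_alg mulW oneW -> bilin f -> f one one = oneW ->
  (forall a b c d, f (mul a c) (mul b d) = mulW (f a b) (f c d)) ->
  is_alg_map (lmul mul) (tens2 one one) mulW oneW (lift2 f).
Proof.
move=> algW fB f1 fM; split; first exact: lift2_linear.
  by rewrite lift2_tens2.
by move=> s t; apply: (lift2_mul s t algW).
Qed.

End Tens2.

End Tensors.

(** * Words in generators, presented algebras *)

Section Words.
Variables (k : fieldType) (X : Type).

Definition mon (W : lmodType k) (mul : W -> W -> W) (one : W) (f : X -> W)
  (w : seq X) : W := \big[mul/one]_(g <- w) f g.

(** Words in the generators span, encoded as the induction principle in which this is used. *)
Definition spanned (W : lmodType k) (mul : W -> W -> W) (one : W)
    (f : X -> W) : Prop :=
  forall P : W -> Prop, P 0 -> (forall a x y, P x -> P y -> P (a *: x + y)) ->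
    (forall w, P (mon mul one f w)) -> forall x, P x.

Section One.
Variables (U : lmodType k) (mulU : U -> U -> U) (oneU : U).

Lemma mon_nil (f : X -> U) : mon mulU oneU f [::] = oneU.
Proof. by rewrite /mon big_nil. Qed.

Lemma mon_cons (f : X -> U) g w :
  mon mulU oneU f (g :: w) = mulU (f g) (mon mulU oneU f w).
Proof. by rewrite /mon big_cons. Qed.

Lemma mon_cat (f : X -> U) w1 w2 : is_alg mulU oneU ->
  mon mulU oneU f (w1 ++ w2) = mulU (mon mulU oneU f w1) (mon mulU oneU f w2).
Proof.
case=> _ _ mulA mul1l _; elim: w1 => [|g w1 IH] /=; first by rewrite mon_nil mul1l.
by rewrite !mon_cons IH mulA.
Qed.

Lemma eq_mon (f g : X -> U) w : f =1 g -> mon mulU oneU f w = mon mulU oneU g w.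
Proof. by move=> efg; elim: w => [|x w IH]; rewrite ?mon_nil ?mon_cons ?IH ?efg. Qed.

End One.

Variables (U W : lmodType k) (mulU : U -> U -> U) (oneU : U).
Variables (mulW : W -> W -> W) (oneW : W).

Lemma mon_map (f : X -> U) (h : U -> W) w :
  is_alg_map mulU oneU mulW oneW h ->
  h (mon mulU oneU f w) = mon mulW oneW (h \o f) w.
Proof.
move=> [_ h1 hM]; elim: w => [|g w IH]; first by rewrite !mon_nil h1.
by rewrite !mon_cons hM IH.
Qed.

Lemma spanned_ext (f : X -> U) (h1 h2 : U -> W) :
  spanned mulU oneU f -> linear h1 -> linear h2 ->
  (forall w, h1 (mon mulU oneU f w) = h2 (mon mulU oneU f w)) -> h1 =1 h2.
Proof.
move=> Uspan h1_lin h2_lin eh; apply: Uspan => [|a x y ex ey|//].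
  by rewrite (lin0 h1_lin) (lin0 h2_lin).
by rewrite h1_lin h2_lin ex ey.
Qed.

Lemma alg_map_ext (f : X -> U) (h1 h2 : U -> W) :
  spanned mulU oneU f ->
  is_alg_map mulU oneU mulW oneW h1 -> is_alg_map mulU oneU mulW oneW h2 ->
  (forall g, h1 (f g) = h2 (f g)) -> h1 =1 h2.
Proof.
move=> Uspan h1M h2M eh; have [h1_lin _ _] := h1M; have [h2_lin _ _] := h2M.
apply: (spanned_ext Uspan) => // w.
by rewrite (mon_map _ _ h1M) (mon_map _ _ h2M); apply: eq_mon.
Qed.

Lemma alg_map_id : is_alg_map mulU oneU mulU oneU id.
Proof. by split. Qed.

Lemma alg_map_comp (Y : lmodType k) (mulY : Y -> Y -> Y) (oneY : Y)
    (h1 : U -> W) (h2 : W -> Y) :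
  is_alg_map mulU oneU mulW oneW h1 -> is_alg_map mulW oneW mulY oneY h2 ->
  is_alg_map mulU oneU mulY oneY (h2 \o h1).
Proof.
move=> [l1 u1 m1] [l2 u2 m2]; split=> [||a b] /=.
- exact: linear_comp.
- by rewrite u1.
- by rewrite m1 m2.
Qed.

End Words.

(** * Presented algebras and their universal property *)

Section Presentations.
Variables (k : fieldType) (X : choiceType).
Variable rel : {malg k[{fmonom X}]} -> {malg k[{fmonom X}]} -> Prop.

Definition pmul (u v : palg rel) : palg rel := u * v.

Lemma pmul_pi x y : pmul (palg_pi rel x) (palg_pi rel y) = palg_pi rel (x * y).
Proof. exact: palg_mulE. Qed.

Lemma malg_scalerAr (a : k) (x y : {malg k[{fmonom X}]}) :
  x * (a *: y) = a *: (x * y).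
Proof.
rewrite (malgMEw (fsubset_refl (msupp x)) (msuppZ_le a y)).
rewrite [x * y]malgME scaler_sumr; apply: eq_bigr => i _.
rewrite scaler_sumr; apply: eq_bigr => j _; apply/malgP => m.
by rewrite (mcoeffZ a y) mcoeffU [RHS]mcoeffZ mcoeffU mulrnAr; congr (_ *+ _); apply: mulrCA.
Qed.

Lemma palg_pi_linear : linear (palg_pi rel).
Proof. exact: (@quotmod_pi_linear _ _ (ideal_submodule rel)). Qed.

Lemma palg_alg : is_alg pmul (1 : palg rel).
Proof.
split=> [b a x y|b a x y|||].
- elim/palgW: x => x; elim/palgW: b => b; elim/palgW: y => y.
  rewrite -(palg_pi_linear a x y) (pmul_pi _ b) (pmul_pi x b) (pmul_pi y b).
  by rewrite -palg_pi_linear mulrDl scalerAl.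
- elim/palgW: x => x; elim/palgW: b => b; elim/palgW: y => y.
  rewrite -(palg_pi_linear a x y) (pmul_pi b _) (pmul_pi b x) (pmul_pi b y).
  by rewrite -palg_pi_linear mulrDr malg_scalerAr.
- exact: mulrA.
- exact: mul1r.
- exact: mulr1.
Qed.

Lemma palg_pi_mon (m : {fmonom X}) :
  palg_pi rel << m >> = mon pmul 1 (pgen rel) m.
Proof.
case: m => m; elim: m => [|g m IH] /=.
  rewrite mon_nil [RHS]/(palg_pi rel 1); congr (palg_pi rel << _ >>).
  by apply: val_inj; rewrite /= fm1.
rewrite mon_cons -IH pmul_pi; congr palg_pi.
rewrite malgM_def fgmulUU mulr1; congr (<< _ >>).
by apply: val_inj; rewrite /= -[mmul _ _]/(fmmul (fmu g) (FMonom m)) fmmulE fmuE.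
Qed.

Lemma palg_spanned : spanned pmul 1 (pgen rel).
Proof.
move=> P P0 PD Pm; elim/palgW => x.
elim/malg_ind: x => [|a x y Px Py|m].
- by rewrite (lin0 palg_pi_linear).
- by rewrite palg_pi_linear; apply: PD.
by rewrite palg_pi_mon.
Qed.

(** With [palg_pi_rel] it shows that the generators of a presented algebra satisfy its defining
    relations. *)
Lemma fext_pgen x : fext pmul 1 (pgen rel) x = palg_pi rel x.
Proof.
have L := @mlift_linear k _ (palg rel)
  (fun m : {fmonom X} => \big[pmul/1]_(g <- m) pgen rel g).
elim/malg_ind: x => [|a x y Px Py|m].
- by rewrite (lin0 palg_pi_linear); apply: lin0 L.
- by rewrite palg_pi_linear -Px -Py; apply: L.
by rewrite palg_pi_mon; apply: mliftU.
Qed.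

Lemma palg_pi_rel x y : rel x y -> palg_pi rel x = palg_pi rel y.
Proof. by move=> xy; apply: quotmod_eq; apply: IdealRel. Qed.

Variables (W : lmodType k) (mul : W -> W -> W) (one : W) (f : X -> W).
Hypothesis algW : is_alg mul one.

Lemma fext1 : fext mul one f 1 = one.
Proof.
have e : (1 : {malg k[{fmonom X}]}) = << (mone : {fmonom X}) >> by [].
by rewrite e /fext mliftU fm1 big_nil.
Qed.

Lemma fext_fgen g : fext mul one f (fgen k g) = f g.
Proof.
by rewrite /fext mliftU fmuE big_cons big_nil; case: algW.
Qed.

Lemma fext_linear : linear (fext mul one f).
Proof. exact: mlift_linear. Qed.

Lemma fext_mul x y :
  fext mul one f (x * y) = mul (fext mul one f x) (fext mul one f y).
Proof. by case: algW => Hl Hr mulA mul1l mul1r; apply: fextM. Qed.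

Lemma fext_exp x m :
  fext mul one f (x ^+ m) = iter m (mul (fext mul one f x)) one.
Proof. by elim: m => [|m IH]; rewrite ?fext1 // exprS fext_mul IH. Qed.

Lemma fext_fgen2 g h : fext mul one f (fgen k g * fgen k h) = mul (f g) (f h).
Proof. by rewrite (fext_mul (fgen k g)) (fext_fgen g) (fext_fgen h). Qed.

Lemma fext_fgen3 g h i :
  fext mul one f (fgen k g * fgen k h * fgen k i) = mul (mul (f g) (f h)) (f i).
Proof.
by rewrite (fext_mul (fgen k g * fgen k h)) (fext_fgen2 g h) (fext_fgen i).
Qed.

Lemma fext_fgen_exp g m :
  fext mul one f (fgen k g ^+ m) = iter m (mul (f g)) one.
Proof. by rewrite (fext_exp (fgen k g)) (fext_fgen g). Qed.

Hypothesis frel :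
  forall x y, rel x y -> fext mul one f x = fext mul one f y.

Lemma pext_alg_map :
  is_alg_map pmul (1 : palg rel) mul one (pext mul one f).
Proof.
have [Hl Hr mulA mul1l mul1r] := algW.
split=> [a x y||a b].
- elim/palgW: x => x; elim/palgW: y => y.
  rewrite -(palg_pi_linear a x y).
  by rewrite !(pext_pi (conj Hl Hr) mulA mul1l mul1r frel) (fext_linear a x y).
- by rewrite [1]/(palg_pi rel 1) (pext_pi (conj Hl Hr) mulA mul1l mul1r frel) fext1.
- exact: (pextM (conj Hl Hr) mulA mul1l mul1r frel).
Qed.

Lemma pext_gen g : pext mul one f (pgen rel g) = f g.
Proof.
by case: algW => Hl Hr mulA mul1l mul1r; apply: (pext_pgen (conj Hl Hr)).
Qed.

End Presentations.

(** * Hopf algebras on Taft generators *)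

Lemma sweedlerE (k : fieldType) (H : hopf_data k) (W : lmodType k)
    (f : H -> H -> W) a : sweedler f a = lift2 f (hcomul a).
Proof. by rewrite /lift2 llift.unlock. Qed.

Lemma eq_sweedler (k : fieldType) (H : hopf_data k) (W : lmodType k)
    (f g : H -> H -> W) a :
  (forall x y, f x y = g x y) -> sweedler f a = sweedler g a.
Proof. by move=> efg; rewrite !sweedlerE; apply: eq_lift2. Qed.

Section TaftLike.
Variables (k : fieldType) (n : nat) (D : hopf_data k) (gen : taft_gen n -> D).

Definition gen_comul (g : taft_gen n) : tens 2 D :=
  match g with
  | GenX i => tens2 (gen (GenX i)) (hone D) + tens2 (gen (GenK i)) (gen (GenX i))
  | _ => tens2 (gen g) (gen g)
  end.

Definition gen_counit (g : taft_gen n) : k := if g is GenX _ then 0 else 1.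

Definition gen_antipode (g : taft_gen n) : D :=
  match g with
  | GenK i => gen (GenKinv i)
  | GenKinv i => gen (GenK i)
  | GenX i => - hmul (gen (GenKinv i)) (gen (GenX i))
  end.

(* Holds of the Taft algebra, of the tensor power and of their twists alike. *)
Record taft_like : Prop := TaftLike {
  tl_alg : is_alg (@hmul k D) (hone D);
  tl_span : spanned (@hmul k D) (hone D) gen;
  tl_comul : is_alg_map (@hmul k D) (hone D)
    (lmul (@hmul k D)) (tens2 (hone D) (hone D)) (@hcomul k D);
  tl_counit : is_alg_map (W := k^o) (@hmul k D) (hone D) *%R 1 (@hcounit k D);
  tl_antipode : is_alg_map (@hmul k D) (hone D)
    (fun u v => hmul v u) (hone D) (@hantipode k D);
  tl_comul_gen : forall g, hcomul (gen g) = gen_comul g;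
  tl_counit_gen : forall g, hcounit (gen g) = gen_counit g;
  tl_antipode_gen : forall g, hantipode (gen g) = gen_antipode g;
  tl_KV : forall i, hmul (gen (GenK i)) (gen (GenKinv i)) = hone D;
  tl_VK : forall i, hmul (gen (GenKinv i)) (gen (GenK i)) = hone D }.

Hypothesis tlD : taft_like.

Let algD := tl_alg tlD.
Let spanD := tl_span tlD.
Let comulM := tl_comul tlD.
Let counitM := tl_counit tlD.
Let antipodeM := tl_antipode tlD.
Let comul_lin : linear (@hcomul k D). Proof. by case: comulM. Qed.
Let counit_lin : scalar (@hcounit k D). Proof. by case: counitM. Qed.
Let antipode_lin : linear (@hantipode k D). Proof. by case: antipodeM. Qed.

Let mul_linl b : linear ((@hmul k D)^~ b). Proof. by case: algD. Qed.
Let mul_linr a : linear (@hmul k D a). Proof. by case: algD. Qed.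
Let mulA : associative (@hmul k D). Proof. by case: algD. Qed.
Let mul1l : left_id (hone D) (@hmul k D). Proof. by case: algD. Qed.
Let mul1r : right_id (hone D) (@hmul k D). Proof. by case: algD. Qed.

Local Notation word w := (mon (@hmul k D) (hone D) gen w).
Local Notation one3 := (ptens [ffun=> hone D] : tens 3 D).

Let one3E : tens3 (hone D) (hone D) (hone D) = one3.
Proof.
by congr ptens; apply/ffunP=> i; rewrite !ffunE; case: i => [[|[|[|//]]] p].
Qed.

Let alg2 : is_alg (lmul (@hmul k D)) (tens2 (hone D) (hone D)) := tens2_alg algD.
Let alg3 : is_alg (lmul (@hmul k D)) one3 := tens_alg 3 algD.

Lemma linear_lift2_comul (W : lmodType k) (f : D -> D -> W) :
  bilin f -> linear (fun a => lift2 f (hcomul a)).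
Proof. by move=> fB; apply: (linear_comp comul_lin (lift2_linear fB)). Qed.

Lemma lift2_comul_gen (W : lmodType k) (f : D -> D -> W) g :
  bilin f -> lift2 f (hcomul (gen g)) =
    match g with
    | GenX i => f (gen (GenX i)) (hone D) + f (gen (GenK i)) (gen (GenX i))
    | _ => f (gen g) (gen g)
    end.
Proof.
move=> fB; rewrite (tl_comul_gen tlD); case: g => i; rewrite /= ?lift2_tens2 //.
by rewrite (linD (lift2_linear fB)) !lift2_tens2.
Qed.

Let coassoc_l (a : D) : tens 3 D :=
  lift2 (fun a1 a2 => lift2 (fun b c => tens3 b c a2) (hcomul a1)) (hcomul a).
Let coassoc_r (a : D) : tens 3 D :=
  lift2 (fun a1 a2 => lift2 (fun b c => tens3 a1 b c) (hcomul a2)) (hcomul a).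

Let t3l_bilin a : bilin (fun b c : D => tens3 b c a).
Proof. by split=> [c|b]; [apply: tens3_lin1 | apply: tens3_lin2]. Qed.

Let t3r_bilin a : bilin (fun b c : D => tens3 a b c).
Proof. by split=> [c|b]; [apply: tens3_lin2 | apply: tens3_lin3]. Qed.

Let cl_bilin :
  bilin (fun a1 a2 : D => lift2 (fun b c => tens3 b c a2) (hcomul a1)).
Proof.
split=> [a2|a1].
  exact: linear_lift2_comul.
by apply: (linear_lift2_param (h := fun a2 b c => tens3 b c a2)) => // a b; apply: tens3_lin3.
Qed.

Let cr_bilin :
  bilin (fun a1 a2 : D => lift2 (fun b c => tens3 a1 b c) (hcomul a2)).
Proof.
split=> [a2|a1].
  by apply: (linear_lift2_param (h := fun a1 b c => tens3 a1 b c)) => // a b; apply: tens3_lin1.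
exact: linear_lift2_comul.
Qed.

Let coassoc_lM :
  is_alg_map (@hmul k D) (hone D) (lmul (@hmul k D)) one3 coassoc_l.
Proof.
have [_ c1 cM] := comulM.
apply: (alg_map_comp comulM); apply: (lift2_alg_map algD alg3).
- exact: cl_bilin.
- by rewrite c1 lift2_tens2.
move=> a b c d; rewrite cM; apply: (lift2_mul algD _ _ alg3) => // x y z t.
by rewrite (lmul_tens3 algD).
Qed.

Let coassoc_rM :
  is_alg_map (@hmul k D) (hone D) (lmul (@hmul k D)) one3 coassoc_r.
Proof.
have [_ c1 cM] := comulM.
apply: (alg_map_comp comulM); apply: (lift2_alg_map algD alg3).
- exact: cr_bilin.
- by rewrite c1 lift2_tens2.
move=> a b c d; rewrite cM; apply: (lift2_mul algD _ _ alg3) => // x y z t.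
by rewrite (lmul_tens3 algD).
Qed.

(** Both iterated coproducts are algebra maps to the tensor cube, so the generators decide. *)
Lemma taft_like_coassoc : coassoc_l =1 coassoc_r.
Proof.
have [_ c1 _] := comulM.
apply: (alg_map_ext spanD coassoc_lM coassoc_rM) => g.
rewrite /coassoc_l /coassoc_r (lift2_comul_gen _ cl_bilin).
rewrite (lift2_comul_gen _ cr_bilin).
by case: g => i; rewrite !lift2_comul_gen // ?c1 ?lift2_tens2 // addrA.
Qed.

Let scale_bilin : bilin (fun a b : D => hcounit a *: b).
Proof. exact: bilin_scale. Qed.

Lemma counit_left a : lift2 (fun a1 a2 : D => hcounit a1 *: a2) (hcomul a) = a.
Proof.
have [_ e1 eM] := counitM; move: a.
apply: (alg_map_ext (h2 := id) spanD _ (alg_map_id _ _)).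
  apply: (alg_map_comp comulM); apply: (lift2_alg_map algD algD scale_bilin).
    by rewrite e1 scale1r.
  by move=> a b c d; rewrite eM (linZ (mul_linl _)) (linZ (mul_linr _)) scalerA.
move=> g; rewrite (lift2_comul_gen _ scale_bilin).
by case: g => i; rewrite !(tl_counit_gen tlD) /= ?scale1r // scale0r add0r.
Qed.

Lemma counit_right a : lift2 (fun a1 a2 : D => hcounit a2 *: a1) (hcomul a) = a.
Proof.
have [_ e1 eM] := counitM; move: a; have fB := bilin_swap scale_bilin.
apply: (alg_map_ext (h2 := id) spanD _ (alg_map_id _ _)).
  apply: (alg_map_comp comulM); apply: (lift2_alg_map algD algD fB).
    by rewrite e1 scale1r.
  move=> a b c d; rewrite eM (linZ (mul_linl _)) (linZ (mul_linr _)).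
  by rewrite scalerA.
move=> g; rewrite (lift2_comul_gen _ fB).
case: g => i; rewrite !(tl_counit_gen tlD) /= ?scale1r //.
by rewrite e1 scale1r scale0r addr0.
Qed.

Let SaB : bilin (fun a b : D => hmul (hantipode a) b).
Proof.
by apply: (bilin_comp (bilin_alg algD) antipode_lin (linear_id D)).
Qed.

Let aSB : bilin (fun a b : D => hmul a (hantipode b)).
Proof.
by apply: (bilin_comp (bilin_alg algD) (linear_id D) antipode_lin).
Qed.

Let antipode_gens g :
  lift2 (fun a b : D => hmul (hantipode a) b) (hcomul (gen g))
    = hcounit (gen g) *: hone D /\ lift2 (fun a b : D => hmul a (hantipode b)) (hcomul (gen g))
    = hcounit (gen g) *: hone D.
Proof.
have [_ S1 _] := antipodeM.
rewrite !lift2_comul_gen // !(tl_counit_gen tlD).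
case: g => i; rewrite /= !(tl_antipode_gen tlD) /= ?(tl_KV tlD) ?(tl_VK tlD) ?scale1r //.
rewrite S1 ?mul1r scale0r ?addNr; split=> //.
by rewrite (linN (mul_linr _)) mulA (tl_KV tlD) mul1l addrN.
Qed.

(** The convolution of the antipode with the identity is not multiplicative, so generators alone do
    not suffice. For a word g w, with legs a, b of g and u, v of w, the sum is S(u) S(a) b v: the
    inner pair collapses to the counit of g, and the induction hypothesis handles w. *)
Lemma antipode_left a :
  lift2 (fun a b : D => hmul (hantipode a) b) (hcomul a) = hcounit a *: hone D.
Proof.
have [_ S1 SM] := antipodeM; have [_ e1 eM] := counitM.
have [_ c1 cM] := comulM.
move: a; apply: (spanned_ext spanD); first exact: linear_lift2_comul.
  exact: linear_scale.
elim=> [|g w IH]; first by rewrite mon_nil c1 lift2_tens2 // S1 mul1l e1 scale1r.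
have lL := lift2_linear SaB.
have [Tl Tr _ _ _] := alg2.
rewrite mon_cons cM eM -scalerA -IH.
elim/tens2_ind: (hcomul (word w)) => [|c x y IHx IHy|u v].
- by rewrite (lin0 (Tr _)) (lin0 lL) scaler0.
- by rewrite Tr !lL IHx IHy scalerDr !scalerA [c * _]mulrC.
have -> : hcounit (gen g) *: lift2 (fun a b : D => hmul (hantipode a) b) (tens2 u v)
    = hmul (hmul (hantipode u) (hcounit (gen g) *: hone D)) v.
  by rewrite lift2_tens2 // (linZ (mul_linr _)) mul1r (linZ (mul_linl _)).
rewrite -(proj1 (antipode_gens g)).
move: (hcomul (gen g)); apply: tens2_ext.
- exact: (linear_comp (Tl _) lL).
- exact: (linear_comp (linear_comp lL (mul_linr _)) (mul_linl v)).
by move=> a b; rewrite (lmul_tens2 algD) !lift2_tens2 // SM !mulA.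
Qed.

(** Mirror image of [antipode_left]: for g w the inner pair now comes from w, so the induction
    hypothesis is applied inside and the letter g is handled outside. *)
Lemma antipode_right a :
  lift2 (fun a b : D => hmul a (hantipode b)) (hcomul a) = hcounit a *: hone D.
Proof.
have [_ S1 SM] := antipodeM; have [_ e1 eM] := counitM.
have [_ c1 cM] := comulM.
move: a; apply: (spanned_ext spanD); first exact: linear_lift2_comul.
  exact: linear_scale.
elim=> [|g w IH]; first by rewrite mon_nil c1 lift2_tens2 // S1 mul1l e1 scale1r.
have lL := lift2_linear aSB.
have [Tl Tr _ _ _] := alg2.
rewrite mon_cons cM eM mulrC -scalerA -(proj2 (antipode_gens g)).
elim/tens2_ind: (hcomul (gen g)) => [|c x y IHx IHy|u v].
- by rewrite (lin0 (Tl _)) (lin0 lL) scaler0.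
- by rewrite Tl !lL IHx IHy scalerDr !scalerA [c * _]mulrC.
have -> : hcounit (word w) *: lift2 (fun a b : D => hmul a (hantipode b)) (tens2 u v)
    = hmul (hmul u (hcounit (word w) *: hone D)) (hantipode v).
  by rewrite lift2_tens2 // (linZ (mul_linr _)) mul1r (linZ (mul_linl _)).
rewrite -IH.
move: (hcomul (word w)); apply: tens2_ext.
- exact: (linear_comp (Tr _) lL).
- exact: (linear_comp (linear_comp lL (mul_linr _)) (mul_linl _)).
by move=> a b; rewrite (lmul_tens2 algD) !lift2_tens2 // SM !mulA.
Qed.

Lemma taft_like_hopf : is_hopf D.
Proof.
have [_ c1 cM] := comulM; have [_ e1 eM] := counitM.
have assoc (a : D) : sweedler (fun a1 a2 => sweedler (fun b c => tens3 b c a2) a1) a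
    = sweedler (fun a1 a2 => sweedler (fun b c => tens3 a1 b c) a2) a.
  rewrite [LHS]sweedlerE [RHS]sweedlerE; transitivity (coassoc_l a).
    by apply: eq_lift2 => x y; rewrite sweedlerE.
  rewrite taft_like_coassoc /coassoc_r.
  by apply: eq_lift2 => x y; rewrite sweedlerE.
have coalg : is_coalgebra D.
  split; [exact: comul_lin | exact: counit_lin | exact: assoc | |] => a;
    rewrite sweedlerE; [exact: counit_left | exact: counit_right].
have bialg : is_bialgebra D.
  split; [by split | | exact: c1 | exact: eM | exact: e1] => a b.
  by rewrite cM lmulE.
split; [exact: bialg | exact: antipode_lin | |] => a; rewrite sweedlerE.
  exact: antipode_left.
exact: antipode_right.
Qed.

End TaftLike.

(** * Algebra maps that preserve the generators *)

Section TaftLikeMorphism.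
Variables (k : fieldType) (n : nat) (D D' : hopf_data k).
Variables (gen : taft_gen n -> D) (gen' : taft_gen n -> D') (f : D -> D').
Hypotheses (tlD : taft_like gen) (tlD' : taft_like gen').
Hypothesis fM : is_alg_map (@hmul k D) (hone D) (@hmul k D') (hone D') f.
Hypothesis f_gen : forall g, f (gen g) = gen' g.

Let ffB : bilin (fun a b => tens2 (f a) (f b)).
Proof.
have [L _ _] := fM; have [B1 B2] := tens2_bilin D'.
by split=> [b|a]; [apply: (linear_comp L (B1 _)) | apply: (linear_comp L (B2 _))].
Qed.

(** Both sides are algebra maps into the tensor square of the target and agree on generators. A map
    matching generators thus respects the coalgebra structure for free. *)
Lemma taft_like_map_comul a :
  hcomul (f a) = sweedler (fun a1 a2 => tens2 (f a1) (f a2)) a.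
Proof.
have [f_lin f1 fm] := fM; have algD' := tl_alg tlD'.
rewrite sweedlerE; move: a; apply: (alg_map_ext (tl_span tlD)).
- exact: (alg_map_comp fM (tl_comul tlD')).
- apply: (alg_map_comp (tl_comul tlD)).
  apply: (lift2_alg_map (tl_alg tlD) (tens2_alg algD') ffB); first by rewrite f1.
  by move=> a b c d; rewrite !fm (lmul_tens2 algD').
move=> g; rewrite /= (lift2_comul_gen tlD _ ffB) f_gen (tl_comul_gen tlD').
by case: g => i; rewrite /= ?f_gen ?f1.
Qed.

Lemma taft_like_map_counit a : hcounit (f a) = hcounit a.
Proof.
move: a; apply: (alg_map_ext (W := k^o) (mulW := *%R) (oneW := 1) (tl_span tlD)).
- exact: (alg_map_comp fM (tl_counit tlD')).
- exact: tl_counit tlD.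
by move=> g; rewrite /= f_gen (tl_counit_gen tlD) (tl_counit_gen tlD').
Qed.

(** Both composites are algebra maps into the opposite algebra, hence determined by the
    generators. *)
Lemma taft_like_map_antipode a : f (hantipode a) = hantipode (f a).
Proof.
have [f_lin f1 fm] := fM; have [S_lin S1 SM] := tl_antipode tlD.
move: a; apply: (alg_map_ext (mulW := fun u v => hmul v u) (oneW := hone D')
  (tl_span tlD)).
- split=> [||a b] /=; [exact: (linear_comp S_lin f_lin) | by rewrite S1 |].
  by rewrite SM fm.
- exact: (alg_map_comp fM (tl_antipode tlD')).
move=> g; rewrite /= f_gen (tl_antipode_gen tlD) (tl_antipode_gen tlD').
by case: g => i /=; rewrite ?f_gen // (linN f_lin) fm !f_gen.
Qed.

End TaftLikeMorphism.

(** * Fourier inversion on the exponent lattice *)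

Section Pairing.
Variable n : nat.
Local Notation Lat := {ffun 'I_n -> int}.

Definition latdot (a b : Lat) : int := \sum_i a i * b i.

Lemma latdotC a b : latdot a b = latdot b a.
Proof. by apply: eq_bigr => i _; rewrite mulrC. Qed.

Lemma latdotDl a b c : latdot (a + b) c = latdot a c + latdot b c.
Proof. by rewrite -big_split; apply: eq_bigr => i _; rewrite ffunE mulrDl. Qed.

Lemma latdotDr a b c : latdot c (a + b) = latdot c a + latdot c b.
Proof. by rewrite ![latdot c _]latdotC latdotDl. Qed.

Lemma latdotNl a b : latdot (- a) b = - latdot a b.
Proof. by rewrite -sumrN; apply: eq_bigr => i _; rewrite ffunE mulNr. Qed.

Lemma latdotNr a b : latdot b (- a) = - latdot b a.
Proof. by rewrite ![latdot b _]latdotC latdotNl. Qed.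

Lemma latdot0l a : latdot 0 a = 0.
Proof. by apply: big1 => i _; rewrite ffunE mul0r. Qed.

Lemma latdot0r a : latdot a 0 = 0.
Proof. by rewrite latdotC latdot0l. Qed.

Lemma latdotMnl a b m : latdot (a *+ m) b = latdot a b *+ m.
Proof. by elim: m => [|m IH]; rewrite ?mulr0n ?latdot0l // !mulrS latdotDl IH. Qed.

Lemma latdotMnr a b m : latdot b (a *+ m) = latdot b a *+ m.
Proof. by rewrite ![latdot b _]latdotC latdotMnl. Qed.

Lemma latdot_epsr a i : latdot a (eps i) = a i.
Proof.
rewrite /latdot (bigD1 i) //= big1 ?addr0 ?ffunE ?eqxx ?mulr1 // => j /negPf ji.
by rewrite ffunE ji mulr0.
Qed.

End Pairing.

Section Fourier.
Variables (k : fieldType) (l n : nat) (q : k).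
Hypothesis q_prim : l.-primitive_root q.
Local Notation Lat := {ffun 'I_n -> int}.
Local Notation box := {ffun 'I_n -> 'I_l}.

Lemma prim_root_neq0 : q != 0.
Proof.
have := prim_expr_order q_prim; apply: contra_eq_neq => ->.
by rewrite expr0n gtn_eqF ?(prim_order_gt0 q_prim) // eq_sym oner_eq0.
Qed.

Lemma exprzD_root a b : q ^ (a + b) = q ^ a * q ^ b.
Proof. by rewrite expfzDr // prim_root_neq0. Qed.

Lemma exprzMn_root (a : int) : q ^ (a *+ l) = 1.
Proof. by rewrite -mulr_natl -exprz_exp natz -exprnP (prim_expr_order q_prim) exp1rz. Qed.

Definition box_val (b : box) : Lat := [ffun i => (b i : nat)%:Z].

(** Orthogonality of the characters of Z/l: for a <> b the ratio z satisfies z^l = 1 and z <> 1, so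
    the geometric sum vanishes. *)
Lemma prim_root_sum (a b : 'I_l) :
  \sum_(c < l) (q ^+ a / q ^+ b) ^+ c = l%:R *+ (a == b).
Proof.
case: eqVneq => [->|ab].
  rewrite divff ?expf_neq0 ?prim_root_neq0 //.
  rewrite (eq_bigr (fun=> 1)) => [|i _]; last by rewrite expr1n.
  by rewrite sumr_const card_ord.
apply/eqP; have z1 : q ^+ a / q ^+ b - 1 != 0.
  rewrite subr_eq0 -(inj_eq (mulIf (expf_neq0 b prim_root_neq0))).
  rewrite divfK ?expf_neq0 ?prim_root_neq0 // mul1r (eq_prim_root_expr q_prim).
  by rewrite !modn_small.
rewrite mulr0n -(inj_eq (mulfI z1)) mulr0 -subrX1 expr_div_n -!exprM.
by rewrite ![(_ * l)%N]mulnC !exprM !(prim_expr_order q_prim) !expr1n divr1 subrr.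
Qed.

(** Only g modulo l matters, so g is replaced by its residue [b0] in the box. For fixed b the sum
    over c then factors over the coordinates into geometric sums, which leave only b = [b0]. *)
Lemma fourier_sum (F : Lat -> k) (g : Lat) :
  (forall a d, F (a + d *+ l) = F a) ->
  \sum_(b : box) \sum_(c : box)
     q ^ (- latdot (box_val c) (box_val b)) * F (box_val b) * q ^ (latdot (box_val c) g)
  = l%:R ^+ n * F g.
Proof.
move=> F_per; have l_gt0 := prim_order_gt0 q_prim.
have lz : l%:Z != 0 by lia.
have lt_mod i : (`|(g i %% l)%Z| < l)%N.
  by have := ltz_pmod (g i) (d := l) l_gt0; have := modz_ge0 (g i) lz; lia.
pose b0 : box := [ffun i => Ordinal (lt_mod i)].
have gE : g = box_val b0 + [ffun i => (g i %/ l)%Z] *+ l.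
  apply/ffunP => i; rewrite !ffunE ffunMnE ffunE /= gez0_abs ?modz_ge0 //.
  by rewrite {1}(divz_eq (g i) l) addrC -mulr_natr natz.
rewrite gE F_per.
have inner b : \sum_(c : box) q ^ (- latdot (box_val c) (box_val b)) * F (box_val b)
      * q ^ (latdot (box_val c) (box_val b0 + [ffun i => (g i %/ l)%Z] *+ l))
    = (l%:R ^+ n * F (box_val b)) *+ (b0 == b).
  transitivity (F (box_val b) * \prod_(i < n) \sum_(c < l) (q ^+ b0 i / q ^+ b i) ^+ c).
    rewrite bigA_distr_bigA mulr_sumr; apply: eq_bigr => c _.
    rewrite latdotDr latdotMnr exprzD_root exprzMn_root mulr1 mulrAC mulrC; congr (_ * _).
    rewrite -exprzD_root -latdotNr -latdotDr.
    rewrite /latdot (big_morph (fun z => q ^ z) exprzD_root (expr0z q)).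
    apply: eq_bigr => i _; rewrite !ffunE mulrC -exprz_exp; congr (_ ^+ _).
    by rewrite exprzD_root mulrC exprnN.
  under eq_bigr do rewrite prim_root_sum.
  case: eqVneq => [<-|neq].
    under eq_bigr do rewrite eqxx.
    by rewrite prodr_const card_ord mulrC.
  have /existsP[i bi] : [exists i, b0 i != b i].
    by apply: contra_neqT neq => /existsPn e; apply/ffunP=> i; apply/eqP/negPn/e.
  by rewrite (bigD1 i) //= (negPf bi) mulr0n mul0r mulr0.
rewrite (eq_bigr _ (fun b _ => inner b)) (bigD1 b0) //= eqxx big1 ?addr0 // => b.
by rewrite eq_sym => /negPf ->.
Qed.

(** [p.1] is the sample point and [p.2] the frequency: a periodic F is the combination of the
    functions q^(c.g) weighted by these coefficients and the samples of F. *)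
Definition fourier_coef (p : box * box) : k :=
  (l%:R ^+ n)^-1 * q ^ (- latdot (box_val p.2) (box_val p.1)).

Lemma fourier_inversion (F : Lat -> k) (g : Lat) : l%:R != 0 :> k ->
  (forall a d, F (a + d *+ l) = F a) ->
  \sum_p fourier_coef p * F (box_val p.1) * q ^ (latdot (box_val p.2) g) = F g.
Proof.
move=> l0 F_per; have ln0 : l%:R ^+ n != 0 :> k by rewrite expf_neq0.
apply: (mulfI ln0); rewrite -(fourier_sum g F_per) pair_bigA mulr_sumr.
by apply: eq_bigr => p _; rewrite /fourier_coef !mulrA divff // mul1r.
Qed.

End Fourier.

(** * The bigrading and the twist by a bicharacter *)

Lemma scaler_lincomb (k : fieldType) (V : lmodType k) (c x : k) (u v : V) :
  c *: (x *: u + v) = x *: (c *: u) + c *: v.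
Proof. by rewrite scalerDr !scalerA mulrC. Qed.

(* The conversion of [hsort H] with [hsort (twist s t)] is very slow when H is
   a concrete Hopf algebra, hence the explicit cast. *)
Definition to_twist (k : fieldType) (H : hopf_data k) (s t : H -> H -> k)
  (x : H) : twist s t := x.

(** * Linearity of iterated Sweedler sums *)

Section SweedlerLinear.
Variables (k : fieldType) (H : hopf_data k) (U W : lmodType k).
Hypothesis comul_lin : linear (@hcomul k H).

Lemma sweedler_linear (f : H -> H -> W) : bilin f -> linear (sweedler f).
Proof.
move=> fB a x y; rewrite (sweedlerE f x) (sweedlerE f y) sweedlerE.
exact: (linear_comp comul_lin (lift2_linear fB)).
Qed.

Lemma sweedler_param (h : U -> H -> H -> W) a :
  (forall x y, linear (fun u => h u x y)) -> (forall u, bilin (h u)) ->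
  linear (fun u => sweedler (h u) a).
Proof.
move=> hl hB c x y; rewrite (sweedlerE (h x) a) (sweedlerE (h y) a) sweedlerE.
exact: (linear_lift2_param _ hl hB).
Qed.

End SweedlerLinear.

Section Sweedler3Linear.
Variables (k : fieldType) (H : hopf_data k) (U W : lmodType k).
Hypothesis comul_lin : linear (@hcomul k H).

Definition trilin (f : H -> H -> H -> W) : Prop :=
  [/\ forall b c, linear (fun a => f a b c),
      forall a c, linear (fun b => f a b c)
    & forall a b, linear (fun c => f a b c)].

Lemma sweedler3_linear (f : H -> H -> H -> W) : trilin f -> linear (sweedler3 f).
Proof.
move=> [f1 f2 f3]; have fB a : bilin (f a) by split=> [c|b].
apply: sweedler_linear => //; split=> [b|a]; last exact: sweedler_linear.
exact: sweedler_param.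
Qed.

Lemma sweedler3_param (h : U -> H -> H -> H -> W) a :
  (forall x y z, linear (fun u => h u x y z)) -> (forall u, trilin (h u)) ->
  linear (fun u => sweedler3 (h u) a).
Proof.
move=> hl hT; apply: sweedler_param => [x a'|u].
  apply: sweedler_param => [y z|u]; first exact: hl.
  by have [_ f2 f3] := hT u; split=> [c|b].
have [f1 f2 f3] := hT u; have fB b : bilin (h u b) by split=> [c|d].
split=> [b|b]; last exact: sweedler_linear.
exact: sweedler_param.
Qed.

Lemma sweedler2_linear (F : H -> H -> H -> H -> W) a :
  (forall a1 a2, bilin (F a1 a2)) ->
  (forall b1 b2, bilin (fun a1 a2 => F a1 a2 b1 b2)) ->
  linear (fun b => sweedler (fun a1 a2 => sweedler (F a1 a2) b) a).
Proof.
move=> Fr Fl; apply: sweedler_param => [a1 a2|b]; first exact: sweedler_linear.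
by split=> [a2|a1]; apply: sweedler_param => // x y; case: (Fl x y).
Qed.

End Sweedler3Linear.

(** * Degrees of letters and words *)

Section Degrees.
Variables (k : fieldType) (q : k) (n : nat).
Local Notation Lat := {ffun 'I_n -> int}.

(** The two degrees are read off the coproduct: a character kills x_i, so x_i (x) 1 + K_i (x) x_i
    leaves the weight of K_i on the left and that of 1 on the right. *)
Definition ldeg (g : taft_gen n) : Lat :=
  match g with GenK i => eps i | GenKinv i => - eps i | GenX i => eps i end.

Definition rdeg (g : taft_gen n) : Lat :=
  match g with GenK i => eps i | GenKinv i => - eps i | GenX i => 0 end.

Definition wldeg (w : seq (taft_gen n)) : Lat := \sum_(g <- w) ldeg g.
Definition wrdeg (w : seq (taft_gen n)) : Lat := \sum_(g <- w) rdeg g.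

Definition gen_char (c : Lat) (g : taft_gen n) : k :=
  if g is GenX _ then 0 else q ^ latdot c (ldeg g).

Definition characters (D : hopf_data k) (gen : taft_gen n -> D)
    (chi : Lat -> D -> k) : Prop :=
  (forall c, is_alg_map (W := k^o) (@hmul k D) (hone D) *%R 1 (chi c))
  /\ (forall c g, chi c (gen g) = gen_char c g).

(* The power of q by which the product of the letters of a word is multiplied
   in the twist. *)
Fixpoint twexp (wt : Lat -> Lat) (w : seq (taft_gen n)) : int :=
  if w is g :: w' then
    latdot (wt (wldeg w')) (ldeg g) - latdot (wt (wrdeg w')) (rdeg g) + twexp wt w'
  else 0.

(** This is what makes the rescalings of words by a form and by its inverse cancel. *)
Lemma twexpN wt w : twexp (fun a => - wt a) w = - twexp wt w.
Proof.
by elim: w => [|g w IH] /=; rewrite ?oppr0 // IH !latdotNl !opprD.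
Qed.

End Degrees.

(** * Shifts by characters and homogeneous elements *)

Section Grading.
Variables (k : fieldType) (l n : nat) (q : k).
Hypothesis q_prim : l.-primitive_root q.
Local Notation Lat := {ffun 'I_n -> int}.
Variables (D : hopf_data k) (gen : taft_gen n -> D) (chi : Lat -> D -> k).
Hypothesis tlD : taft_like gen.
Hypothesis chiP : characters q gen chi.

Let qD := exprzD_root q_prim.
Let algD := tl_alg tlD.
Let spanD := tl_span tlD.
Let comulM := tl_comul tlD.
Let counitM := tl_counit tlD.
Let antipodeM := tl_antipode tlD.
Let comul_lin : linear (@hcomul k D). Proof. by case: comulM. Qed.
Let counit_lin : scalar (@hcounit k D). Proof. by case: counitM. Qed.
Let antipode_lin : linear (@hantipode k D). Proof. by case: antipodeM. Qed.
Let mul_linl b : linear ((@hmul k D)^~ b). Proof. by case: algD. Qed.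
Let mul_linr a : linear (@hmul k D a). Proof. by case: algD. Qed.
Let hmA : associative (@hmul k D). Proof. by case: algD. Qed.
Let hm1l : left_id (hone D) (@hmul k D). Proof. by case: algD. Qed.
Let hm1r : right_id (hone D) (@hmul k D). Proof. by case: algD. Qed.
Let chiM c : is_alg_map (W := k^o) (@hmul k D) (hone D) *%R 1 (chi c).
Proof. by case: chiP. Qed.
Let chi_lin c : scalar (chi c). Proof. by case: (chiM c). Qed.
Let chi_linear c : linear (chi c : D -> k^o). Proof. exact: chi_lin. Qed.
Let chiZ c x a : chi c (x *: a) = x * chi c a.
Proof. exact: (linZ (chi_linear c)). Qed.
Let chiD c a b : chi c (a + b) = chi c a + chi c b.
Proof. exact: (linD (chi_linear c)). Qed.
Let chiN c a : chi c (- a) = - chi c a.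
Proof. exact: (linN (chi_linear c)). Qed.
Let chi1 c : chi c (hone D) = 1. Proof. by case: (chiM c). Qed.
Let chi_mul c a b : chi c (hmul a b) = chi c a * chi c b.
Proof. by case: (chiM c). Qed.
Let chi_gen c g : chi c (gen g) = gen_char q c g. Proof. by case: chiP. Qed.

Local Notation word w := (mon (@hmul k D) (hone D) gen w).

Definition lshift (c : Lat) (a : D) : D :=
  lift2 (fun a1 a2 : D => chi c a1 *: a2) (hcomul a).
Definition rshift (c : Lat) (a : D) : D :=
  lift2 (fun a1 a2 : D => chi c a2 *: a1) (hcomul a).

Let chiB (c : Lat) : bilin (fun a b : D => chi c a *: b).
Proof. exact: bilin_scale. Qed.

Let chiB' (c : Lat) : bilin (fun a b : D => chi c b *: a).
Proof. exact: bilin_swap. Qed.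

Lemma lshift_alg_map c :
  is_alg_map (@hmul k D) (hone D) (@hmul k D) (hone D) (lshift c).
Proof.
apply: (alg_map_comp comulM); apply: (lift2_alg_map algD algD (chiB c)).
  by rewrite chi1 scale1r.
move=> a b a' b'.
by rewrite chi_mul (linZ (mul_linl _)) (linZ (mul_linr _)) scalerA.
Qed.

Lemma rshift_alg_map c :
  is_alg_map (@hmul k D) (hone D) (@hmul k D) (hone D) (rshift c).
Proof.
apply: (alg_map_comp comulM); apply: (lift2_alg_map algD algD (chiB' c)).
  by rewrite chi1 scale1r.
move=> a b a' b'.
by rewrite chi_mul (linZ (mul_linl _)) (linZ (mul_linr _)) scalerA.
Qed.

Lemma lshift_sweedler c (W : lmodType k) (f : D -> W) a :
  linear f -> sweedler (fun a1 a2 => chi c a1 *: f a2) a = f (lshift c a).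
Proof.
move=> f_lin; rewrite sweedlerE /lshift (lift2_comp _ (chiB c) f_lin).
by apply: eq_lift2 => x y; rewrite (linZ f_lin).
Qed.

Lemma rshift_sweedler c (W : lmodType k) (f : D -> W) a :
  linear f -> sweedler (fun a1 a2 => chi c a2 *: f a1) a = f (rshift c a).
Proof.
move=> f_lin; rewrite sweedlerE /rshift (lift2_comp _ (chiB' c) f_lin).
by apply: eq_lift2 => x y; rewrite (linZ f_lin).
Qed.

(** The left side is the convolution of the characters d and c. It is again an algebra map to k, and
    its exponents add on generators. *)
Lemma chi_shift c d a : chi c (lshift d a) = chi (d + c) a.
Proof.
move: a; apply: (alg_map_ext (mulW := *%R) (W := k^o) (oneW := 1) spanD).
- exact: (alg_map_comp (lshift_alg_map d) (chiM c)).
- exact: chiM.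
move=> g; rewrite /= /lshift (lift2_comul_gen tlD) //.
case: g => i /=; rewrite ?chiD !chiZ !chi_gen /= ?chi1
  ?mul0r ?mulr0 ?addr0 // -qD latdotDl //.
Qed.

Lemma chi_antipode c a : chi c (hantipode a) = chi (- c) a.
Proof.
have [S_lin S1 SM] := antipodeM.
move: a; apply: (alg_map_ext (mulW := *%R) (W := k^o) (oneW := 1) spanD).
- split=> [||a b] /=; [exact: (linear_comp S_lin (chi_linear c)) | by rewrite S1 |].
  by rewrite SM chi_mul mulrC.
- exact: chiM.
move=> g; rewrite (tl_antipode_gen tlD) chi_gen.
case: g => i; rewrite /= ?chiN ?chi_mul !chi_gen /=.
- by rewrite latdotNr latdotNl.
- by rewrite latdotNr latdotNl opprK.
- by rewrite mulr0 oppr0.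
Qed.

Lemma chi0 a : chi 0 a = hcounit a.
Proof.
move: a; apply: (alg_map_ext (mulW := *%R) (W := k^o) (oneW := 1) spanD) => // g.
rewrite (tl_counit_gen tlD) chi_gen; case: g => i //=; rewrite latdot0l //.
Qed.

Lemma chi_periodic c d a : chi (c + d *+ l) a = chi c a.
Proof.
move: a; apply: (alg_map_ext (mulW := *%R) (W := k^o) (oneW := 1) spanD) => // g.
rewrite !chi_gen; case: g => i //=; rewrite latdotDl latdotMnl qD;
  by rewrite (exprzMn_root q_prim) mulr1.
Qed.

(** Bidegrees are tested by eigenvalues, so they count modulo [l] only, and 0 has every bidegree. *)
Definition homog (m : D) (g h : Lat) : Prop :=
  forall c, lshift c m = q ^ latdot c g *: m /\ rshift c m = q ^ latdot c h *: m.

Lemma homog1 : homog (hone D) 0 0.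
Proof.
move=> c; have [_ -> _] := lshift_alg_map c; have [_ -> _] := rshift_alg_map c.
by rewrite latdot0r scale1r.
Qed.

Lemma homog_mul a b g h g' h' :
  homog a g h -> homog b g' h' -> homog (hmul a b) (g + g') (h + h').
Proof.
move=> ha hb c; have [_ _ ->] := lshift_alg_map c.
have [_ _ ->] := rshift_alg_map c.
have [-> ->] := ha c; have [-> ->] := hb c.
rewrite !(linZ (mul_linl _)) !(linZ (mul_linr _)) !scalerA.
by rewrite !latdotDr !qD.
Qed.

Lemma homog_scale a g h x : homog a g h -> homog (x *: a) g h.
Proof.
move=> ha c; have [L _ _] := lshift_alg_map c; have [R _ _] := rshift_alg_map c.
by rewrite (linZ L) (linZ R) !(ha c).1 !(ha c).2 !scalerA ![x * _]mulrC.
Qed.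

Lemma homog_gen g : homog (gen g) (ldeg g) (rdeg g).
Proof.
move=> c; rewrite /lshift /rshift !(lift2_comul_gen tlD) //.
case: g => i; rewrite /= !chi_gen /= ?chi1 //.
by rewrite !scale0r add0r addr0 latdot0r.
Qed.

Lemma homog_word w : homog (word w) (wldeg w) (wrdeg w).
Proof.
rewrite /wldeg /wrdeg; elim: w => [|g w IH].
  by rewrite mon_nil !big_nil; apply: homog1.
by rewrite mon_cons !big_cons; apply: homog_mul (homog_gen g) IH.
Qed.

(** Words are homogeneous and span; linear identities below are therefore checked on homogeneous
    elements, one argument after the other. *)
Lemma homog_ext (W : lmodType k) (f1 f2 : D -> W) :
  linear f1 -> linear f2 -> (forall m g h, homog m g h -> f1 m = f2 m) ->
  f1 =1 f2.
Proof.
move=> f1_lin f2_lin ef; apply: (spanned_ext spanD) => // w.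
exact: ef (homog_word w).
Qed.

(** The character c is the counit after [lshift c], of which m is an eigenvector. *)
Lemma chi_hom c m g h : homog m g h -> chi c m = q ^ latdot c g * hcounit m.
Proof.
move=> hm; have -> : chi c m = hcounit (lshift c m) by rewrite -chi0 chi_shift addr0.
by rewrite (hm c).1 -!chi0 chiZ.
Qed.

(** The antipode exchanges and negates the degrees: x_i of bidegree (e_i, 0) goes to - K_i^-1 x_i of
    bidegree (0, - e_i). As it reverses products, this propagates along words. *)
Lemma homog_antipode_word w : homog (hantipode (word w)) (- wrdeg w) (- wldeg w).
Proof.
have [_ S1 SM] := antipodeM; rewrite /wldeg /wrdeg.
elim: w => [|g w IH].
  by rewrite mon_nil !big_nil S1 oppr0; apply: homog1.
rewrite mon_cons !big_cons SM (opprD (rdeg g)) (opprD (ldeg g)).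
rewrite (addrC (- rdeg g)) (addrC (- ldeg g)).
apply: homog_mul IH _; rewrite (tl_antipode_gen tlD).
have hg := homog_gen; case: g => i /=.
- exact: hg (GenKinv i).
- by rewrite opprK; apply: hg (GenK i).
rewrite -scaleN1r; apply: homog_scale; have := homog_mul (hg (GenKinv i)) (hg (GenX i)).
by rewrite /= addNr oppr0 addr0.
Qed.

(* The counit vanishes on words containing a letter x_i. *)
Lemma counit_word_deg w : hcounit (word w) = 0 \/ wldeg w = wrdeg w.
Proof.
have [_ e1 eM] := counitM; rewrite /wldeg /wrdeg.
elim: w => [|g w [IH|IH]]; first by right; rewrite !big_nil.
  by left; rewrite mon_cons eM IH mulr0.
rewrite mon_cons eM !big_cons IH (tl_counit_gen tlD).
by case: g => i /=; [right | right | left; rewrite mul0r].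
Qed.

(* The coproduct of a word is of this form; as the inner degrees agree, the
   inner factors of the twisted product cancel and the coproduct stays
   multiplicative. *)
Inductive cospan (g h : Lat) : tens 2 D -> Prop :=
| CospanTens u v f : homog u g f -> homog v f h -> cospan g h (tens2 u v)
| Cospan0 : cospan g h 0
| CospanP x s t : cospan g h s -> cospan g h t -> cospan g h (x *: s + t).

Let Tl (t : tens 2 D) : linear ((lmul (@hmul k D))^~ t).
Proof. by case: (tens2_alg algD). Qed.
Let Tr (t : tens 2 D) : linear (lmul (@hmul k D) t).
Proof. by case: (tens2_alg algD). Qed.

Lemma cospan_mul s t g h g' h' :
  cospan g h s -> cospan g' h' t ->
  cospan (g + g') (h + h') (lmul (@hmul k D) s t).
Proof.
elim=> [u v f hu hv||x s1 s2 _ IH1 _ IH2] ht; last 2 first.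
- by rewrite (lin0 (Tl _)); apply: Cospan0.
- by rewrite (Tl _ x); apply: CospanP; [apply: IH1 | apply: IH2].
elim: ht => [u' v' f' hu' hv'||x s1 s2 _ IH1 _ IH2].
- rewrite (lmul_tens2 algD).
  by apply: (CospanTens (f := f + f')); apply: homog_mul.
- by rewrite (lin0 (Tr _)); apply: Cospan0.
- by rewrite (Tr _ x); apply: CospanP.
Qed.

Lemma cospan_comul_word w : cospan (wldeg w) (wrdeg w) (hcomul (word w)).
Proof.
have [_ c1 cM] := comulM; rewrite /wldeg /wrdeg; elim: w => [|g w IH].
  by rewrite mon_nil !big_nil c1; apply: CospanTens homog1 homog1.
rewrite mon_cons !big_cons cM; apply: cospan_mul => //.
rewrite (tl_comul_gen tlD); have hg := homog_gen.
case: g => i /=; first exact: CospanTens (hg (GenK i)) (hg (GenK i)).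
  exact: CospanTens (hg (GenKinv i)) (hg (GenKinv i)).
rewrite -[tens2 (gen (GenX i)) _]scale1r; apply: CospanP.
  exact: CospanTens (hg (GenX i)) homog1.
exact: CospanTens (hg (GenK i)) (hg (GenX i)).
Qed.

(** * Linear combinations of characters *)

Section Functionals.
Variables (I : finType) (C : I -> k) (E : I -> Lat).

Definition chi_comb (a : D) : k := \sum_i C i * chi (E i) a.

Let chi_fB c (W : lmodType k) (f : D -> W) :
  linear f -> bilin (fun a b : D => chi c a *: f b).
Proof.
by move=> f_lin; split=> [b|a]; [apply: linear_scale | apply: linearZ_fun].
Qed.

Lemma chi_comb_linear : scalar chi_comb.
Proof.
move=> x a b; rewrite /chi_comb mulr_sumr -big_split; apply: eq_bigr => i _ /=.
by rewrite chiD chiZ mulrDr mulrCA.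
Qed.

(** Each character contracts the left leg to [lshift], whose eigenvalue on a is a power of q. *)
Lemma chi_comb_left (W : lmodType k) (f : D -> W) a g h : linear f -> homog a g h ->
  sweedler (fun a1 a2 => chi_comb a1 *: f a2) a
  = (\sum_i C i * q ^ latdot (E i) g) *: f a.
Proof.
move=> f_lin ha; rewrite sweedlerE.
have -> : (fun a1 a2 : D => chi_comb a1 *: f a2)
    = (fun a1 a2 : D => \sum_i C i *: (chi (E i) a1 *: f a2)).
  apply/funext => x; apply/funext => y; rewrite scaler_suml.
  by apply: eq_bigr => i _; rewrite scalerA.
have B i : bilin (fun a1 a2 => chi (E i) a1 *: f a2).
  exact: chi_fB.
rewrite lift2_sum => [|i].
  rewrite scaler_suml; apply: eq_bigr => i _.
  rewrite -(lift2_comp _ (B i) (linearZ_fun (linear_id W) (C i))).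
  rewrite -sweedlerE lshift_sweedler // (ha _).1 (linZ f_lin).
  by rewrite scalerA.
by case: (B i) => Bl Br; split=> [y|x]; apply: linearZ_fun.
Qed.

Lemma chi_comb_right (W : lmodType k) (f : D -> W) a g h : linear f -> homog a g h ->
  sweedler (fun a1 a2 => chi_comb a2 *: f a1) a
  = (\sum_i C i * q ^ latdot (E i) h) *: f a.
Proof.
move=> f_lin ha; rewrite sweedlerE.
have -> : (fun a1 a2 : D => chi_comb a2 *: f a1)
    = (fun a1 a2 : D => \sum_i C i *: (chi (E i) a2 *: f a1)).
  apply/funext => x; apply/funext => y; rewrite scaler_suml.
  by apply: eq_bigr => i _; rewrite scalerA.
have B i : bilin (fun a1 a2 => chi (E i) a2 *: f a1).
  exact: (bilin_swap (chi_fB (E i) f_lin)).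
rewrite lift2_sum => [|i].
  rewrite scaler_suml; apply: eq_bigr => i _.
  rewrite -(lift2_comp _ (B i) (linearZ_fun (linear_id W) (C i))).
  rewrite -sweedlerE rshift_sweedler // (ha _).2 (linZ f_lin).
  by rewrite scalerA.
by case: (B i) => Bl Br; split=> [y|x]; apply: linearZ_fun.
Qed.

End Functionals.

Hypothesis l0 : l%:R != 0 :> k.
Local Notation box := {ffun 'I_n -> 'I_l}.

(* The bilinear form with (K(a), K(b)) |-> q ^ latdot (wt b) a, obtained by
   Fourier inversion on (Z/l)^n from the characters, which vanish on the x_i. *)
Definition torus_form (wt : Lat -> Lat) (a b : D) : k :=
  chi_comb (fun p : box * box => fourier_coef q p * chi (wt (box_val p.1)) a)
    (fun p => box_val p.2) b.

(** * The bicharacter form *)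

Section Form.
Variable wt : Lat -> Lat.
Hypothesis wtD : {morph wt : a b / a + b}.

Let wt0 : wt 0 = 0 := morphD0 wtD.

Let wtMn := morphDMn wtD.

Let wtN := morphDN wtD.

Lemma form_bilinear : is_bilinear_form (torus_form wt).
Proof.
split=> [b x a a'|a]; last exact: chi_comb_linear.
rewrite /torus_form /chi_comb mulr_sumr -big_split; apply: eq_bigr => p _ /=.
by rewrite chiD chiZ mulrDr mulrDl !mulrA [_ * x]mulrC !mulrA.
Qed.

Let form_linr a : linear (torus_form wt a : D -> k^o).
Proof. exact: (proj2 form_bilinear a). Qed.

Lemma chi_wt_periodic a (c d : Lat) : chi (wt (c + d *+ l)) a = chi (wt c) a.
Proof. by rewrite wtD wtMn chi_periodic. Qed.

(** The scalar supplied by [chi_comb_left] is the Fourier expansion of the periodic function c |->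
    [chi (wt c) a] at the left degree of b. *)
Lemma form_left (W : lmodType k) (f : D -> W) a b g h : linear f -> homog b g h ->
  sweedler (fun b1 b2 => torus_form wt a b1 *: f b2) b = chi (wt g) a *: f b.
Proof.
move=> f_lin hb; rewrite (chi_comb_left _ _ f_lin hb).
by rewrite (fourier_inversion q_prim g l0 (chi_wt_periodic a)).
Qed.

Lemma form_right (W : lmodType k) (f : D -> W) a b g h : linear f -> homog b g h ->
  sweedler (fun b1 b2 => torus_form wt a b2 *: f b1) b = chi (wt h) a *: f b.
Proof.
move=> f_lin hb; rewrite (chi_comb_right _ _ f_lin hb).
by rewrite (fourier_inversion q_prim h l0 (chi_wt_periodic a)).
Qed.

(** The hypothesis says that the characters see b as the grouplike K(g); this yields the prescribed
    values of sigma on the torus. *)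
Lemma form_chi a b (g : Lat) : (forall c, chi c b = q ^ latdot c g) ->
  torus_form wt a b = chi (wt g) a.
Proof.
move=> chib; rewrite -(fourier_inversion q_prim g l0 (chi_wt_periodic a)).
by apply: eq_bigr => p _; rewrite chib.
Qed.

(** Write b as the Sweedler sum of b_(1) counit(b_(2)) and apply [form_left] with the counit as
    f. *)
Lemma form_hom a b g h : homog b g h -> torus_form wt a b = chi (wt g) a * hcounit b.
Proof.
move=> hb; have e_lin : linear (@hcounit k D : D -> k^o) by apply: counit_lin.
rewrite -[RHS](form_left a e_lin hb) sweedlerE -{1}(counit_right tlD b).
rewrite (lift2_comp _ (bilin_swap (bilin_scale D counit_lin)) (form_linr a)).
apply: (eq_lift2 (W := k^o)) => x y.
by rewrite (linZ (form_linr a)) [RHS]mulrC.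
Qed.

Lemma form_one a : torus_form wt a (hone D) = hcounit a /\ torus_form wt (hone D) a = hcounit a.
Proof.
have [_ e1 _] := counitM; split; first by rewrite (form_hom a homog1) wt0 chi0 e1 mulr1.
apply: (homog_ext (f1 := torus_form wt (hone D) : D -> k^o) (f2 := @hcounit k D)) => [||m g h hm].
- exact: form_linr.
- exact: counit_lin.
- by rewrite (form_hom _ hm) chi1 mul1r.
Qed.

End Form.

Let scal_mull (f : D -> k) y : scalar f -> linear (fun x => f x * y : k^o).
Proof.
move=> f_lin c x x'.
by rewrite (f_lin c x x') mulrDl -[c *: _]/(c * _) mulrA.
Qed.

Let scal_mulr (f : D -> k) y : scalar f -> linear (fun x => y * f x : k^o).
Proof.
move=> f_lin c x x'.
by rewrite (f_lin c x x') mulrDr -[c *: _]/(c * _) mulrCA.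
Qed.

Section Convolution.
Variables wt1 wt2 : Lat -> Lat.
Hypothesis wt1D : {morph wt1 : a b / a + b}.
Hypothesis wt2D : {morph wt2 : a b / a + b}.
Hypothesis wt12 : forall g, wt1 g + wt2 g = 0.

(** For b of left degree g the inner sum is, up to the counit of b, the character [wt1 g] of a_(1)
    times the character [wt2 g] of a_(2). Since the exponents are opposite, these convolve to the
    trivial character, the counit. *)
Lemma form_conv a b :
  sweedler (W := k^o) (fun a1 a2 =>
    sweedler (W := k^o) (fun b1 b2 => torus_form wt1 a1 b1 * torus_form wt2 a2 b2) b) a
  = hcounit a * hcounit b.
Proof.
have [l1 r1] := form_bilinear wt1; have [l2 r2] := form_bilinear wt2.
move: b; apply: (homog_ext (W := k^o)).
- apply: (sweedler2_linear comul_lin (W := k^o)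
    (F := fun a1 a2 b1 b2 => torus_form wt1 a1 b1 * torus_form wt2 a2 b2)) => x y;
    split=> z; by [apply: scal_mull | apply: scal_mulr].
- exact: scal_mulr.
move=> b g h hb; have chi_b : linear (fun y => chi (wt2 g) y * hcounit b : k^o).
  exact: scal_mull.
transitivity (sweedler (W := k^o) (fun a1 a2 =>
    chi (wt1 g) a1 *: (chi (wt2 g) a2 * hcounit b : k^o)) a).
  apply: (eq_sweedler (W := k^o)) => x y.
  by rewrite (form_left wt1D x (r2 y : linear (torus_form wt2 y : D -> k^o)) hb)
    (form_hom wt2D y hb).
by rewrite (lshift_sweedler _ _ chi_b) chi_shift wt12 chi0.
Qed.

End Convolution.

(** * Products rescaled by a bicharacter of the bidegrees *)

Section Deformation.
Variables (wt : Lat -> Lat) (tw : D -> D -> D) (twS : D -> D).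
Hypothesis wtD : {morph wt : a b / a + b}.
Hypothesis twB : bilin tw.
Hypothesis tw_hom : forall a b g h g' h', homog a g h -> homog b g' h' ->
  tw a b = q ^ (latdot (wt g') g - latdot (wt h') h) *: hmul a b.
Hypothesis twS_lin : linear twS.
Hypothesis twS_hom : forall a g h, homog a g h ->
  twS a = q ^ (latdot (wt h) h - latdot (wt g) g) *: hantipode a.

Let wt0 : wt 0 = 0 := morphD0 wtD.
Let wtN := morphDN wtD.

Let tw_linl b : linear (tw ^~ b). Proof. exact: (proj1 twB b). Qed.
Let tw_linr a : linear (tw a). Proof. exact: (proj2 twB a). Qed.

Lemma homog_deform a b g h g' h' : homog a g h -> homog b g' h' ->
  homog (tw a b) (g + g') (h + h').
Proof.
by move=> ha hb; rewrite (tw_hom ha hb); apply: homog_scale; apply: homog_mul.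
Qed.

(** The exponent is biadditive in the bidegrees and degrees add under the product, so both
    bracketings of a triple product get the same factor. The unit has bidegree (0, 0), which gives
    factor 1. *)
Lemma deform_alg : is_alg tw (hone D).
Proof.
split; [exact: tw_linl | exact: tw_linr | | |].
- move=> a b c; move: a.
  apply: homog_ext => [||a ga ha Ha]; [exact: tw_linl | |].
    exact: (linear_comp (tw_linl b) (tw_linl c)).
  move: b; apply: homog_ext => [||b gb hb Hb].
  + exact: (linear_comp (tw_linl c) (tw_linr a)).
  + exact: (linear_comp (tw_linr a) (tw_linl c)).
  move: c; apply: homog_ext => [||c gc hc Hc].
  + exact: (linear_comp (tw_linr b) (tw_linr a)).
  + exact: tw_linr.
  rewrite (tw_hom Ha (homog_deform Hb Hc)) (tw_hom Hb Hc).
  rewrite (tw_hom (homog_deform Ha Hb) Hc) (tw_hom Ha Hb).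
  rewrite (linZ (mul_linr _)) (linZ (mul_linl _)) !scalerA -!qD hmA !wtD.
  by congr (q ^ _ *: _); rewrite !(latdotDl, latdotDr); ring.
- apply: (homog_ext (f1 := tw (hone D)) (f2 := id)) => [||a ga ha Ha].
  + exact: tw_linr.
  + exact: linear_id.
  + by rewrite (tw_hom homog1 Ha) !latdot0r subrr scale1r hm1l.
- apply: (homog_ext (f1 := tw^~ (hone D)) (f2 := id)) => [||a ga ha Ha].
  + exact: tw_linl.
  + exact: linear_id.
  + by rewrite (tw_hom Ha homog1) wt0 !latdot0l subrr scale1r hm1r.
Qed.

Lemma deform_word w : mon tw (hone D) gen w = q ^ twexp wt w *: word w.
Proof.
elim: w => [|g w IH]; first by rewrite !mon_nil scale1r.
rewrite !mon_cons IH /= (linZ (tw_linr _)) (tw_hom (homog_gen g) (homog_word w)).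
by rewrite scalerA -qD addrC.
Qed.

(** A word for the deformed product is an invertible multiple of the same word for the old one. *)
Lemma deform_spanned : spanned tw (hone D) gen.
Proof.
move=> P P0 PD Pw; apply: spanD => // w.
rewrite -[word w]scale1r -(expr0z q) -(addNr (twexp wt w)) qD -scalerA -deform_word.
by rewrite -[_ *: _]addr0; apply: PD.
Qed.

Lemma cospan_deform s t g h g' h' : cospan g h s -> cospan g' h' t ->
  lmul tw s t = q ^ (latdot (wt g') g - latdot (wt h') h) *: lmul (@hmul k D) s t.
Proof.
have [Wl Wr _ _ _] := tens2_alg deform_alg.
elim=> [u v f hu hv||x s1 s2 _ IH1 _ IH2] ht; last 2 first.
- by rewrite (lin0 (Tl _)) (lin0 (Wl _)) scaler0.
- rewrite (Wl t x s1 s2) (Tl t x s1 s2) (IH1 ht) (IH2 ht).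
  by rewrite -scaler_lincomb.
elim: ht => [u' v' f' hu' hv'||x s1 s2 _ IH1 _ IH2]; last 2 first.
- by rewrite (lin0 (Tr _)) (lin0 (Wr _)) scaler0.
- rewrite (Wr (tens2 u v) x s1 s2) (Tr (tens2 u v) x s1 s2) IH1 IH2.
  by rewrite -scaler_lincomb.
rewrite (lmul_tens2 deform_alg) (lmul_tens2 algD).
rewrite (tw_hom hu hu') (tw_hom hv hv').
have [B1 B2] := tens2_bilin D.
rewrite (linZ (B1 _)) (linZ (B2 _)) scalerA -qD; congr (q ^ _ *: _).
by ring.
Qed.

Lemma deform_comul_alg_map :
  is_alg_map tw (hone D) (lmul tw) (tens2 (hone D) (hone D)) (@hcomul k D).
Proof.
have [_ c1 cM] := comulM; have [Wl Wr _ _ _] := tens2_alg deform_alg.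
split=> // a b; move: a; apply: (spanned_ext spanD) => [||w].
- exact: (linear_comp (tw_linl b) comul_lin).
- exact: (linear_comp comul_lin (Wl _)).
move: b; apply: (spanned_ext spanD) => [||w'].
- exact: (linear_comp (tw_linr _) comul_lin).
- exact: (linear_comp comul_lin (Wr _)).
rewrite (tw_hom (homog_word w) (homog_word w')) (linZ comul_lin) cM.
by rewrite (cospan_deform (cospan_comul_word w) (cospan_comul_word w')).
Qed.

(** If the counit is nonzero on both words, their left and right degrees agree and the rescaling
    factor is 1; otherwise both sides vanish. *)
Lemma deform_counit_alg_map :
  is_alg_map (W := k^o) tw (hone D) *%R 1 (@hcounit k D).
Proof.
have [_ e1 eM] := counitM.
have e_lin : linear (@hcounit k D : D -> k^o) by apply: counit_lin.
split=> // a b; move: a; apply: (spanned_ext (W := k^o) spanD) => [||w].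
- exact: (linear_comp (tw_linl b) e_lin).
- exact: scal_mull.
move: b; apply: (spanned_ext (W := k^o) spanD) => [||w'].
- exact: (linear_comp (tw_linr _) e_lin).
- exact: scal_mulr.
rewrite (tw_hom (homog_word w) (homog_word w')) (linZ e_lin) eM.
case: (counit_word_deg w) => [->|->]; first by rewrite !mul0r scaler0.
case: (counit_word_deg w') => [->|->]; first by rewrite !mulr0 scaler0.
by rewrite subrr scale1r.
Qed.

(** Put Q(g) = wt g . g. The polarisation of Q supplies the bicharacter in both orders: one cancels
    the factor of the product ab, the other is the factor of S(b) S(a), whose degrees are exchanged
    and negated. *)
Lemma deform_antipode_alg_map :
  is_alg_map tw (hone D) (fun u v => tw v u) (hone D) twS.
Proof.
have [_ S1 SM] := antipodeM.
split=> //; first by rewrite (twS_hom homog1) S1 !latdot0r subrr scale1r.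
move=> a b; move: a; apply: (spanned_ext spanD) => [||w].
- exact: (linear_comp (tw_linl b) twS_lin).
- exact: (linear_comp twS_lin (tw_linr _)).
move: b; apply: (spanned_ext spanD) => [||w'].
- exact: (linear_comp (tw_linr _) twS_lin).
- exact: (linear_comp twS_lin (tw_linl _)).
rewrite (twS_hom (homog_deform (homog_word w) (homog_word w'))).
rewrite (tw_hom (homog_word w) (homog_word w')) (linZ antipode_lin) SM.
rewrite (twS_hom (homog_word w)) (twS_hom (homog_word w')).
rewrite (linZ (tw_linl _)) (linZ (tw_linr _)).
rewrite (tw_hom (homog_antipode_word w') (homog_antipode_word w)).
rewrite !scalerA -!qD; congr (q ^ _ *: _).
by rewrite !wtD !wtN !(latdotDl, latdotDr, latdotNl, latdotNr); ring.
Qed.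

End Deformation.

(** * The cocycle twist *)

Section Twist.
Variable wt : Lat -> Lat.
Hypothesis wtD : {morph wt : a b / a + b}.

Let sigma := torus_form wt.
Let tau := torus_form (fun a => - wt a).
Let wtND : {morph (fun a => - wt a) : a b / a + b}.
Proof. by move=> a b; rewrite wtD opprD. Qed.
Let wt0 : wt 0 = 0 := morphD0 wtD.
Let wtN := morphDN wtD.

Let sl b : linear (sigma ^~ b : D -> k^o).
Proof. exact: (proj1 (form_bilinear wt) b). Qed.
Let sr a : linear (sigma a : D -> k^o).
Proof. exact: (proj2 (form_bilinear wt) a). Qed.
Let tl b : linear (tau ^~ b : D -> k^o).
Proof. exact: (proj1 (form_bilinear _) b). Qed.
Let tr a : linear (tau a : D -> k^o).
Proof. exact: (proj2 (form_bilinear _) a). Qed.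

(** For b and c of left degrees g' and g, both sides equal the character wt g + wt g' of a times
    q^(wt g . g') times the counits of b and c. On the right the power of q comes from shifting b;
    on the left it is the character wt g evaluated at b. *)
Lemma form_cocycle a b c :
  sweedler (W := k^o) (fun a1 a2 =>
    sweedler (W := k^o) (fun b1 b2 => sigma a1 b1 * sigma (hmul a2 b2) c) b) a
  = sweedler (W := k^o) (fun b1 b2 =>
    sweedler (W := k^o) (fun c1 c2 => sigma b1 c1 * sigma a (hmul b2 c2)) c) b.
Proof.
have mull_s y c' : linear (fun x => sigma (hmul x y) c' : k^o).
  exact: (linear_comp (mul_linl y) (sl c')).
have mulr_s x c' : linear (fun y => sigma (hmul x y) c' : k^o).
  exact: (linear_comp (mul_linr x) (sl c')).
have smull x y : linear (fun z => sigma x (hmul z y) : k^o).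
  exact: (linear_comp (mul_linl y) (sr x)).
have smulr x y : linear (fun z => sigma x (hmul y z) : k^o).
  exact: (linear_comp (mul_linr y) (sr x)).
have FBb c' x y : bilin (fun b1 b2 => sigma x b1 * sigma (hmul y b2) c' : k^o).
  by split=> z; [apply: scal_mull (sr _) | apply: scal_mulr (mulr_s _ _)].
have FBa c' x y : bilin (fun a1 a2 => sigma a1 x * sigma (hmul a2 y) c' : k^o).
  by split=> z; [apply: scal_mull (sl _) | apply: scal_mulr (mull_s _ _)].
move: c; apply: (homog_ext (W := k^o)).
- apply: (sweedler_param (W := k^o)) => [x y|c'].
    by apply: (sweedler_param (W := k^o)) => [z t|c']; [apply: scal_mulr (sr _) | apply: FBb].
  split=> z; apply: (sweedler_param (W := k^o)) => [x y|t];
    by [case: (FBa c' x y) | apply: FBb].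
- apply: (sweedler2_linear comul_lin (W := k^o)
    (F := fun b1 b2 c1 c2 => sigma b1 c1 * sigma a (hmul b2 c2))) => x y; split=> z.
  + exact: scal_mull (sr _).
  + exact: scal_mulr (smulr _ _).
  + exact: scal_mull (sl _).
  + exact: scal_mulr (smull _ _).
move=> c g h hc.
have rhsE b' : sweedler (W := k^o) (fun b1 b2 =>
    sweedler (W := k^o) (fun c1 c2 => sigma b1 c1 * sigma a (hmul b2 c2)) c) b'
    = sigma a (hmul (lshift (wt g) b') c).
  rewrite -(lshift_sweedler (wt g) b' (smull a c)).
  apply: (eq_sweedler (W := k^o)) => x y.
  exact: (form_left wtD x (smulr a y) hc).
rewrite rhsE; move: b; apply: (homog_ext (W := k^o)).
- exact: (sweedler2_linear comul_lin (W := k^o)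
    (F := fun a1 a2 b1 b2 => sigma a1 b1 * sigma (hmul a2 b2) c)).
- have [L _ _] := lshift_alg_map (wt g).
  exact: (linear_comp L (smull a c)).
move=> b g' h' hb.
rewrite (hb (wt g)).1 (linZ (mul_linl _)) (linZ (sr _)).
rewrite [sigma a _](form_hom wtD a (homog_mul hb hc)) wtD.
transitivity (sweedler (W := k^o) (fun a1 a2 =>
    chi (wt g') a1 *: (sigma (hmul a2 b) c : k^o)) a).
  apply: (eq_sweedler (W := k^o)) => x y.
  exact: (form_left wtD x (mulr_s y c) hb).
rewrite (lshift_sweedler _ _ (mull_s b c)) [sigma _ c](form_hom wtD _ hc).
have [_ e1 eM] := counitM.
rewrite chi_mul chi_shift eM -[RHS]/(_ * (_ * (_ * _))).
by rewrite (chi_hom (wt g) hb); ring.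
Qed.

Lemma form_hopf_2cocycle : hopf_2cocycle sigma tau.
Proof.
split; [by split; apply: form_bilinear | | |exact: form_cocycle] => a.
- by move=> b; split; apply: form_conv => // g; rewrite (addrN, addNr).
- exact: form_one.
Qed.

Local Notation tw := (@twist_mul k D sigma tau).

Lemma twist_mul_bilin : bilin tw.
Proof.
have T1 a1 a2 a3 : trilin (fun b1 b2 b3 => (sigma a1 b1 * tau a3 b3) *: hmul a2 b2).
  split=> b c.
  - exact: (linear_scale _ (scal_mull _ (sr a1))).
  - exact: (linearZ_fun (mul_linr a2)).
  - exact: (linear_scale _ (scal_mulr _ (tr a3))).
have T2 b1 b2 b3 : trilin (fun a1 a2 a3 => (sigma a1 b1 * tau a3 b3) *: hmul a2 b2).
  split=> b c.
  - exact: (linear_scale _ (scal_mull _ (sl b1))).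
  - exact: (linearZ_fun (mul_linl b2)).
  - exact: (linear_scale _ (scal_mulr _ (tl b3))).
have T3 b : trilin (fun a1 a2 a3 => sweedler3 (fun b1 b2 b3 =>
    (sigma a1 b1 * tau a3 b3) *: hmul a2 b2) b).
  by split=> x y; apply: sweedler3_param => // b1 b2 b3; case: (T2 b1 b2 b3).
split=> [b|a]; first exact: (sweedler3_linear comul_lin (T3 b)).
apply: sweedler3_param => // a1 a2 a3.
exact: (sweedler3_linear comul_lin (T1 a1 a2 a3)).
Qed.

(** [form_left] and [form_right] contract the outer legs of b, leaving the character [wt g'] on
    a_(1) and [- wt h'] on a_(3). These act on a as a left and a right shift, hence by scalars. *)
Lemma twist_mul_hom a b g h g' h' : homog a g h -> homog b g' h' ->
  tw a b = q ^ (latdot (wt g') g - latdot (wt h') h) *: hmul a b.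
Proof.
move=> ha hb.
have tB a3 : bilin (fun b2 b3 : D => tau a3 b3 *: b2).
  by apply: bilin_swap; apply: bilin_scale; apply: tr.
have inner a1 a2 a3 :
    sweedler3 (fun b1 b2 b3 => (sigma a1 b1 * tau a3 b3) *: hmul a2 b2) b
    = chi (wt g') a1 *: (chi (- wt h') a3 *: hmul a2 b).
  pose phi b' := sweedler (fun b2 b3 => tau a3 b3 *: hmul a2 b2) b'.
  have phiB : bilin (fun b2 b3 => tau a3 b3 *: hmul a2 b2).
    by split=> [y|x]; [apply: linearZ_fun | apply: linear_scale; apply: tr].
  have phi_lin : linear phi := sweedler_linear comul_lin phiB.
  transitivity (sweedler (fun b1 b' => sigma a1 b1 *: phi b') b).
    apply: eq_sweedler => x y; rewrite /phi (sweedlerE _ y) [in RHS]sweedlerE.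
    rewrite (lift2_comp _ phiB (linearZ_fun (linear_id D) (sigma a1 x))).
    by apply: eq_lift2 => z t; rewrite scalerA.
  rewrite (form_left wtD a1 phi_lin hb); congr (_ *: _).
  exact: (form_right wtND a3 (mul_linr a2) hb).
pose psi a' := sweedler (fun a2 a3 => chi (- wt h') a3 *: hmul a2 b) a'.
have psiE a' : psi a' = hmul (rshift (- wt h') a') b.
  exact: (rshift_sweedler _ _ (mul_linl b)).
have psi_lin : linear psi.
  apply: (sweedler_linear comul_lin).
  by split=> [y|x]; [apply: linearZ_fun | apply: linear_scale].
transitivity (sweedler (fun a1 a' => chi (wt g') a1 *: psi a') a).
  apply: eq_sweedler => x y; rewrite /psi (sweedlerE _ y) [in RHS]sweedlerE.
  have B : bilin (fun a2 a3 => chi (- wt h') a3 *: hmul a2 b).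
    by split=> [z|z]; [apply: linearZ_fun | apply: linear_scale].
  rewrite (lift2_comp _ B (linearZ_fun (linear_id D) (chi (wt g') x))).
  by apply: eq_lift2 => z t; rewrite inner.
rewrite (lshift_sweedler _ _ psi_lin) (ha _).1 (linZ psi_lin) psiE (ha _).2.
by rewrite (linZ (mul_linl b)) scalerA -qD latdotNl.
Qed.

(** The antipode negates the exponent of a character and the characters on the two legs convolve, so
    U is again a combination of characters. [twist_UinvE] is the same computation, in which the sign
    of wt and that of the antipode cancel. *)
Lemma twist_UE a : twist_U sigma a =
  chi_comb (fourier_coef q) (fun p : box * box => wt (box_val p.1) - box_val p.2) a.
Proof.
rewrite /twist_U /chi_comb sweedlerE.
pose F (p : box * box) (x y : D) : k^o :=
  chi (wt (box_val p.1)) x *: (fourier_coef q p * chi (- box_val p.2) y : k^o).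
have f_lin (p : box * box) :
    linear (fun y => fourier_coef q p * chi (- box_val p.2) y : k^o).
  exact: scal_mulr.
transitivity (lift2 (fun x y => \sum_p F p x y) (hcomul a)).
  apply: (eq_lift2 (W := k^o)) => x y; apply: eq_bigr => p _.
  by rewrite chi_antipode /F -[_ *: _]/(_ * _) mulrCA mulrA.
rewrite lift2_sum => [|p]; last first.
  by split=> [y|x]; [apply: linear_scale | apply: linearZ_fun].
apply: eq_bigr => p _; rewrite -sweedlerE (lshift_sweedler _ _ (f_lin p)).
by rewrite chi_shift.
Qed.

Lemma twist_UinvE a : twist_Uinv tau a =
  chi_comb (fourier_coef q) (fun p : box * box => wt (box_val p.1) + box_val p.2) a.
Proof.
rewrite /twist_Uinv /chi_comb sweedlerE.
pose F (p : box * box) (x y : D) : k^o :=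
  chi (wt (box_val p.1)) x *: (fourier_coef q p * chi (box_val p.2) y : k^o).
have f_lin (p : box * box) :
    linear (fun y => fourier_coef q p * chi (box_val p.2) y : k^o).
  exact: scal_mulr.
transitivity (lift2 (fun x y => \sum_p F p x y) (hcomul a)).
  apply: (eq_lift2 (W := k^o)) => x y; apply: eq_bigr => p _.
  by rewrite chi_antipode opprK /F -[_ *: _]/(_ * _) mulrCA mulrA.
rewrite lift2_sum => [|p]; last first.
  by split=> [y|x]; [apply: linear_scale | apply: linearZ_fun].
apply: eq_bigr => p _; rewrite -sweedlerE (lshift_sweedler _ _ (f_lin p)).
by rewrite chi_shift.
Qed.

Let U_lin : scalar (twist_U sigma).
Proof. by move=> x a b; rewrite !twist_UE chi_comb_linear. Qed.
Let V_lin : scalar (twist_Uinv tau).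
Proof. by move=> x a b; rewrite !twist_UinvE chi_comb_linear. Qed.

Local Notation twS := (@twist_antipode k D sigma tau).

Lemma twist_antipode_linear : linear twS.
Proof.
apply: (sweedler3_linear comul_lin); split=> x y.
- exact: (linear_scale _ (scal_mull _ U_lin)).
- exact: (linearZ_fun antipode_lin).
- exact: (linear_scale _ (scal_mulr _ V_lin)).
Qed.

(** The eigenvalue of U on left degree g is the Fourier expansion of q^(wt c . g) at c = - g; that
    of its inverse on right degree h is the expansion of q^(wt c . h) at c = h. *)
Lemma twist_antipode_hom a g h : homog a g h ->
  twS a = q ^ (latdot (wt h) h - latdot (wt g) g) *: hantipode a.
Proof.
move=> ha; pose phi a' := sweedler (fun a2 a3 : D => twist_Uinv tau a3 *: hantipode a2) a'.
have B : bilin (fun a2 a3 : D => twist_Uinv tau a3 *: hantipode a2).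
  by split=> [y|x]; [apply: (linearZ_fun antipode_lin) | apply: (linear_scale _ V_lin)].
have phi_lin : linear phi := sweedler_linear comul_lin B.
have per b (c d : Lat) : q ^ latdot (wt (c + d *+ l)) b = q ^ latdot (wt c) b.
  by rewrite wtD (morphDMn wtD) latdotDl latdotMnl qD (exprzMn_root q_prim) mulr1.
transitivity (sweedler (fun a1 a' => twist_U sigma a1 *: phi a') a).
  apply: eq_sweedler => x y; rewrite /phi (sweedlerE _ y) [in RHS]sweedlerE.
  rewrite (lift2_comp _ B (linearZ_fun (linear_id D) (twist_U sigma x))).
  by apply: eq_lift2 => z t; rewrite scalerA.
rewrite (funext twist_UE) (chi_comb_left _ _ phi_lin ha) /phi.
rewrite (funext twist_UinvE) (chi_comb_right _ _ antipode_lin ha) scalerA addrC qD.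
congr (_ * _ *: _).
  rewrite -latdotNl -wtN -(fourier_inversion q_prim (F := fun c => q ^ latdot (wt c) g) (- g) l0 (per g)).
  by apply: eq_bigr => p _; rewrite latdotDl latdotNl qD latdotNr mulrA.
rewrite -(fourier_inversion q_prim (F := fun c => q ^ latdot (wt c) h) h l0 (per h)).
by apply: eq_bigr => p _; rewrite latdotDl qD mulrA.
Qed.

Let twA := deform_alg wtD twist_mul_bilin twist_mul_hom.

Lemma twist_word w :
  mon tw (hone D) gen w = q ^ twexp wt w *: word w.
Proof. exact: (deform_word twist_mul_bilin twist_mul_hom). Qed.

Lemma twist_taft_like :
  taft_like (fun g => to_twist sigma tau (gen g)).
Proof.
change (taft_like (D := twist sigma tau) gen).
have hg := homog_gen.
split.
- exact: twA.
- exact: (deform_spanned twist_mul_bilin twist_mul_hom).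
- exact: (deform_comul_alg_map wtD twist_mul_bilin twist_mul_hom).
- exact: (deform_counit_alg_map twist_mul_bilin twist_mul_hom).
- exact: (deform_antipode_alg_map wtD twist_mul_bilin twist_mul_hom
    twist_antipode_linear twist_antipode_hom).
- exact: tl_comul_gen tlD.
- exact: tl_counit_gen tlD.
- move=> g; rewrite [LHS](twist_antipode_hom (homog_gen g)) (tl_antipode_gen tlD).
  case: g => i /=; rewrite ?subrr ?scale1r //.
  (* The twisted antipode of x_i and the twisted product K_i^-1 x_i carry the same factor q^(- wt
     e_i . e_i). *)
  rewrite [X in _ = - X](twist_mul_hom (hg (GenKinv i)) (hg (GenX i))) /=.
  by rewrite scalerN wt0 !latdot0l subr0 latdotNr sub0r.
- move=> i; rewrite [LHS](twist_mul_hom (hg (GenK i)) (hg (GenKinv i))) /= subrr scale1r.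
  exact: tl_KV tlD i.
- move=> i; rewrite [LHS](twist_mul_hom (hg (GenKinv i)) (hg (GenK i))) /= subrr scale1r.
  exact: tl_VK tlD i.
Qed.

End Twist.

End Grading.

(** * The Taft algebra *)

Section QBinomial.
Variables (k : fieldType) (q : k).

(* [qbinom i j] is the Gaussian binomial coefficient (i + j choose i)_q. *)
Fixpoint qbinom (i : nat) : nat -> k :=
  if i is i'.+1 then
    fix aux (j : nat) : k :=
      if j is j'.+1 then qbinom i' j + q ^+ i * aux j' else 1
  else fun=> 1.

Arguments qbinom : simpl never.

Lemma qbinom0n j : qbinom 0 j = 1. Proof. by []. Qed.
Lemma qbinomn0 i : qbinom i 0 = 1. Proof. by case: i. Qed.
Lemma qbinomSS i j :
  qbinom i.+1 j.+1 = qbinom i j.+1 + q ^+ i.+1 * qbinom i.+1 j.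
Proof. by []. Qed.

(** The ratio of neighbouring Gaussian coefficients with the same total i + j + 1, cleared of
    denominators, since the q-factorials may vanish at a root of unity. *)
Lemma qbinom_shift i j :
  (1 - q ^+ i.+1) * qbinom i.+1 j = (1 - q ^+ j.+1) * qbinom i j.+1.
Proof.
elim: i j => [|i IHi] j.
  elim: j => [|j IHj]; first by rewrite qbinomn0.
  rewrite qbinomSS mulrDr mulrCA IHj !qbinom0n [in RHS]exprS.
  by rewrite !expr1 !exprS; ring.
elim: j => [|j IHj].
  rewrite qbinomn0 mulr1 qbinomSS qbinomn0 mulr1 mulrDr -IHi qbinomn0 !exprS expr0.
  by ring.
rewrite qbinomSS mulrDr mulrCA IHj [qbinom _ j.+2]qbinomSS [in RHS]mulrDr -IHi !exprS.
by ring.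
Qed.

(** By [qbinom_shift], the factor 1 - q^l = 0 kills the coefficient at i = 1. The vanishing then
    moves upwards in i, as 1 - q^i is invertible for 0 < i < l. *)
Lemma qbinom_prim_root l i j : l.-primitive_root q -> (i + j = l)%N ->
  (0 < i)%N -> (0 < j)%N -> qbinom i j = 0.
Proof.
move=> q_prim; case: i => // i ij _; elim: i j ij => [|i IH] [|j] // ij _.
  have e := qbinom_shift 0 j.+1.
  rewrite qbinom0n [j.+2]ij (prim_expr_order q_prim) subrr mul0r in e.
  apply/eqP; move/eqP: e; rewrite mulf_eq0 => /orP[|//].
  rewrite subr_eq0 eq_sym -(prim_order_dvd q_prim) dvdn1 => /eqP l1.
  by move: ij; rewrite l1.
have e := qbinom_shift i.+1 j.+1.
rewrite (IH j.+2) ?mulr0 // in e; last by rewrite -ij !addSn !addnS.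
apply/eqP; move/eqP: e; rewrite mulf_eq0 => /orP[|//].
rewrite subr_eq0 eq_sym -(prim_order_dvd q_prim) gtnNdvd //.
by rewrite -ij !addSn !addnS !ltnS leq_addr.
Qed.

Variables (W : lmodType k) (mul : W -> W -> W) (one : W) (algW : is_alg mul one).
Variables a b : kring algW.
Hypothesis ba : b * a = q *: (a * b).

Lemma qcomm_exp m : b * a ^+ m = q ^+ m *: (a ^+ m * b).
Proof.
elim: m => [|m IH]; first by rewrite mulr1 mul1r scale1r.
by rewrite exprS mulrA ba -kscalerAl -mulrA IH -kscalerAr scalerA -exprS mulrA.
Qed.

(** The new factor is multiplied on the left, and b crosses a^i at the cost q^i, which is the weight
    in the recursion of [qbinom]. *)
Lemma qbinomial_sum m :
  (a + b) ^+ m = \sum_(i < m.+1) qbinom i (m - i) *: (a ^+ i * b ^+ (m - i)).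
Proof.
elim: m => [|m IH]; first by rewrite big_ord1 expr0 mulr1 scale1r.
rewrite exprS IH mulrDl !mulr_sumr [in RHS]big_ord_recl [in RHS]big_ord_recr /=.
rewrite big_ord_recr [X in _ + X = _]big_ord_recl /= !subnn !subn0 !expr0 !mul1r !mulr1.
rewrite !qbinomn0 !scale1r -!exprS addrACA [X in X + _ = _]addrC -addrA; congr (_ + _).
rewrite addrCA addrC; congr (_ + _); rewrite -big_split; apply: eq_bigr => i _ /=.
rewrite /bump /= !add1n !subSS.
have -> : (m - i = (m - i.+1).+1)%N by rewrite -subSn // ltn_ord.
rewrite -kscalerAr mulrA -exprS -kscalerAr mulrA qcomm_exp -kscalerAl -mulrA -exprS.
by rewrite scalerA -scalerDl [qbinom i.+1 _ * _]mulrC.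
Qed.

Lemma qbinomial_prim_root l : l.-primitive_root q ->
  (a + b) ^+ l = a ^+ l + b ^+ l.
Proof.
move=> q_prim; have := prim_order_gt0 q_prim; case: l q_prim => // l q_prim _.
rewrite qbinomial_sum big_ord_recl big_ord_recr /= big1 ?add0r => [|i _].
  by rewrite subn0 subnn !expr0 mul1r mulr1 qbinomn0 !scale1r addrC.
rewrite /bump /= !add1n subSS (qbinom_prim_root q_prim) ?scale0r //.
  by rewrite addSn subnKC // ltnW.
by rewrite subn_gt0.
Qed.

End QBinomial.

Definition gen_at n (i : 'I_n) (g : taft_gen 1) : taft_gen n :=
  match g with
  | GenK _ => GenK i
  | GenKinv _ => GenKinv i
  | GenX _ => GenX i
  end.

Definition gen_idx n (g : taft_gen n) : 'I_n :=
  match g with GenK i => i | GenKinv i => i | GenX i => i end.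

Definition gen_base n (g : taft_gen n) : taft_gen 1 :=
  match g with
  | GenK _ => GenK ord0
  | GenKinv _ => GenKinv ord0
  | GenX _ => GenX ord0
  end.

Lemma gen_atK n (i : 'I_n) g : gen_base (gen_at i g) = g.
Proof. by case: g => j; rewrite (ord1 j). Qed.

Lemma gen_idx_at n (i : 'I_n) g : gen_idx (gen_at i g) = i.
Proof. by case: g. Qed.

(** * The commutation exponent of the lattice *)

Section Commutation.
Variable n : nat.
Local Notation Lat := {ffun 'I_n -> int}.

(** The vector representing b |-> a * b by the dot product, so that the weight of a form can be
    taken from it. *)
Definition up (a : Lat) : Lat := [ffun j : 'I_n => \sum_(i < n | (j < i)%N) a i].

Lemma starE (a b : Lat) : star a b = latdot (up a) b.
Proof.
by apply: eq_bigr => j _; rewrite ffunE mulr_suml.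
Qed.

Lemma upD : {morph up : a b / a + b}.
Proof.
by move=> a b; apply/ffunP => j; rewrite !ffunE -big_split; apply: eq_bigr => i _; rewrite ffunE.
Qed.

(** By [starE] this is the exponent a * b - b * a of theta. *)
Definition star_comm (a b : Lat) : int := latdot (up a) b - latdot (up b) a.

Lemma star_commC a b : star_comm a b = - star_comm b a.
Proof. by rewrite /star_comm opprB. Qed.

Lemma star_comm0r a : star_comm a 0 = 0.
Proof. by rewrite /star_comm latdot0r (morphD0 upD) latdot0l subrr. Qed.

Lemma star_comm0l a : star_comm 0 a = 0.
Proof. by rewrite star_commC star_comm0r oppr0. Qed.

Lemma star_commNr a b : star_comm a (- b) = - star_comm a b.
Proof. by rewrite /star_comm latdotNr (morphDN upD) latdotNl -opprD. Qed.

Lemma star_commNl a b : star_comm (- a) b = - star_comm a b.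
Proof. by rewrite star_commC star_commNr [in RHS]star_commC. Qed.

End Commutation.

(** The defining relations inside an algebra given by a bare product, so that they make sense for
    opposite, tensor square and twisted products alike; powers are iterates for the same reason. *)
Record taft_rels (k : fieldType) (l n : nat) (q : k) (W : lmodType k) (mul : W -> W -> W) (one : W)
    (f : taft_gen n -> W) : Prop := TaftRels {
  tr_KV : forall i, mul (f (GenK i)) (f (GenKinv i)) = one;
  tr_VK : forall i, mul (f (GenKinv i)) (f (GenK i)) = one;
  tr_KK : forall i j, mul (f (GenK i)) (f (GenK j)) = mul (f (GenK j)) (f (GenK i));
  tr_Kl : forall i, iter l (mul (f (GenK i))) one = one;
  tr_KX : forall i j, mul (mul (f (GenK i)) (f (GenX j))) (f (GenKinv i))
    = (theta q (eps i) (eps j) * q ^+ (i == j)) *: f (GenX j);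
  tr_XX : forall i j, mul (f (GenX i)) (f (GenX j))
    = theta q (eps i) (eps j) *: mul (f (GenX j)) (f (GenX i));
  tr_Xl : forall i, iter l (mul (f (GenX i))) one = 0 }.

Section TaftRelations.
Variables (k : fieldType) (l n : nat) (q : k).
Hypothesis q_prim : l.-primitive_root q.

Lemma taft_relsP (W : lmodType k) (mul : W -> W -> W) (one : W)
    (f : taft_gen n -> W) :
  is_alg mul one ->
  taft_rels l q mul one f <->
  (forall x y, taft_rel l q x y -> fext mul one f x = fext mul one f y).
Proof.
move=> algW; have L := fext_linear mul one f.
have G1 := fext_fgen f algW; have G2 := fext_fgen2 f algW.
have G3 := fext_fgen3 f algW; have GX := fext_fgen_exp f algW.
have E1 := fext1 mul one f; have LZ := linZ L; have E0 := lin0 L.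
split=> [[KV VK KK Kl KX XX Xl] x y|frel].
  case=> [i|i|i j|i|i j|i j|i].
  - by rewrite (G2 (GenK i) (GenKinv i)) KV E1.
  - by rewrite (G2 (GenKinv i) (GenK i)) VK E1.
  - exact: (etrans (G2 _ _) (etrans (KK i j) (esym (G2 _ _)))).
  - by rewrite (GX (GenK i) l) Kl E1.
  - by rewrite (G3 (GenK i) (GenX j) (GenKinv i)) KX LZ (G1 (GenX j)).
  - by rewrite (G2 (GenX i) (GenX j)) XX LZ (G2 (GenX j) (GenX i)).
  - by rewrite (GX (GenX i) l) Xl E0.
split=> [i|i|i j|i|i j|i j|i].
- by have := frel _ _ (TaftKKinv l q i); rewrite G2 E1.
- by have := frel _ _ (TaftKinvK l q i); rewrite G2 E1.
- exact: (etrans (esym (G2 _ _)) (etrans (frel _ _ (TaftKC l q i j)) (G2 _ _))).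
- by have := frel _ _ (TaftKl l q i); rewrite GX E1.
- have := frel _ _ (TaftKX l q i j).
  by rewrite (G3 (GenK i) (GenX j) (GenKinv i)) LZ (G1 (GenX j)).
- have := frel _ _ (TaftXX l q i j).
  by rewrite (G2 (GenX i) (GenX j)) LZ (G2 (GenX j) (GenX i)).
- by have := frel _ _ (TaftXl l q i); rewrite GX E0.
Qed.

(* These relations define the Taft algebra for [B = star_comm] and the tensor
   power for [B = 0]; twisting changes only [B], see [qcomm_deform]. *)
Definition qcomm_rels (B : {ffun 'I_n -> int} -> {ffun 'I_n -> int} -> int)
    (W : lmodType k) (mul : W -> W -> W) (one : W) (f : taft_gen n -> W) : Prop :=
  (forall i, taft_rels (n := 1) l q mul one (fun g => f (gen_at i g)))
  /\ (forall g h, gen_idx g != gen_idx h ->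
      mul (f g) (f h)
      = q ^ (B (ldeg g) (ldeg h) - B (rdeg g) (rdeg h)) *: mul (f h) (f g)).

(** * Consequences of the Taft relations *)

Section Derived.
Variables (W : lmodType k) (mul : W -> W -> W) (one : W) (f : taft_gen n -> W).
Hypothesis algW : is_alg mul one.
Hypothesis fR : taft_rels l q mul one f.

Local Notation R := (kring algW).
Local Notation K i := (f (GenK i) : R).
Local Notation V i := (f (GenKinv i) : R).
Local Notation X i := (f (GenX i) : R).
Let th i j : k := theta q (eps i : lattice n) (eps j).
Let c i j : k := th i j * q ^+ (i == j).

Let KV i : K i * V i = 1. Proof. exact: tr_KV fR i. Qed.
Let VK i : V i * K i = 1. Proof. exact: tr_VK fR i. Qed.
Let KK i j : K i * K j = K j * K i. Proof. exact: tr_KK fR i j. Qed.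
Let Kl i : K i ^+ l = 1.
Proof. by rewrite -kring_expE; apply: tr_Kl fR i. Qed.
Let KXV i j : K i * X j * V i = c i j *: X j. Proof. exact: tr_KX fR i j. Qed.
Let XX i j : X i * X j = th i j *: (X j * X i). Proof. exact: tr_XX fR i j. Qed.
Let Xl i : X i ^+ l = 0.
Proof. by rewrite -kring_expE; apply: tr_Xl fR i. Qed.

Let q0 := prim_root_neq0 q_prim.

Lemma theta_opp i j : th i j * th j i = 1.
Proof. by rewrite /th /theta -expfzDr // addrA subrK subrr. Qed.

Lemma theta_diag i : th i i = 1.
Proof. by rewrite /th /theta subrr. Qed.

Let KX i j : K i * X j = c i j *: (X j * K i).
Proof. by rewrite kscalerAl -KXV -mulrA VK mulr1. Qed.

Let XV i j : X j * V i = c i j *: (V i * X j).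
Proof. by rewrite kscalerAr -KXV !mulrA VK mul1r. Qed.

Let KVc i j : K i * V j = V j * K i.
Proof.
rewrite -[LHS]mul1r -(VK j) -!mulrA; congr (_ * _).
by rewrite mulrA KK -mulrA KV mulr1.
Qed.

Let VV i j : V i * V j = V j * V i.
Proof.
rewrite -[LHS]mul1r -(VK j) -!mulrA; congr (_ * _).
by rewrite mulrA KVc -mulrA KV mulr1.
Qed.

Let Vl i : V i ^+ l = 1.
Proof. by rewrite -[LHS]mul1r -(Kl i) -exprMn_comm ?KV ?expr1n //; apply: KVc. Qed.

Definition opp_gen (g : taft_gen n) : W :=
  match g with
  | GenK i => f (GenKinv i)
  | GenKinv i => f (GenK i)
  | GenX i => - mul (f (GenKinv i)) (f (GenX i))
  end.

(** Conjugation yields the commutation rules of the inverse letters that the presentation leaves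
    implicit, so that any two letters of different index q-commute. *)
Lemma taft_qcomm : qcomm_rels (@star_comm n) mul one f.
Proof.
split=> [i|g h gh].
  have thE (a b : 'I_1) : theta q (eps a) (eps b) = 1 by rewrite (ord1 a) (ord1 b) /theta subrr.
  split=> [a|a|a b|a|a b|a b|a] /=; rewrite ?thE.
  - exact: KV.
  - exact: VK.
  - exact: KK.
  - exact: tr_Kl fR i.
  - by rewrite (ord1 a) (ord1 b) -(theta_diag i) [LHS](KXV i i) /c !eqxx.
  - by rewrite scale1r.
  - exact: tr_Xl fR i.
have thq i j : th i j = q ^ star_comm (eps i) (eps j) by rewrite /th /theta !starE.
have cE i j : i != j -> c i j = q ^ star_comm (eps i) (eps j).
  by rewrite /c thq => /negPf ->; rewrite mulr1.
have qK i j (u : R) : q ^ (- star_comm (eps i) (eps j)) *: (q ^ star_comm (eps i) (eps j) *: u) = u.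
  by rewrite scalerA -expfzDr // addNr scale1r.
case: g h gh => i [] j /= ij; rewrite ?(star_comm0r, star_comm0l, star_commNr, star_commNl) ?subr0
  ?subrr ?scale1r.
- exact: KK.
- exact: KVc.
- by rewrite -cE //; apply: KX.
- exact: (esym (KVc j i)).
- exact: VV.
- have -> : mul (f (GenX j)) (f (GenKinv i)) = c i j *: (V i * X j) by apply: XV.
  by rewrite cE // qK.
- have -> : mul (f (GenK j)) (f (GenX i)) = c j i *: (X i * K j) by apply: KX.
  by rewrite cE 1?eq_sym // star_commC qK.
- by rewrite -star_commC -cE 1?eq_sym //; apply: XV.
- by rewrite -thq; apply: XX.
Qed.

Lemma opp_rels : taft_rels l q (fun u v => mul v u) one opp_gen.
Proof.
have iter_op (u : W) m : iter m (fun v => mul v u) one = (u : R) ^+ m.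
  by elim: m => // m IH; rewrite exprSr /= IH.
(* The scalar may stay unspecified, because the l-th power is killed by x_i^l = 0. *)
have VXl i m : exists a, (V i * X i) ^+ m = a *: (V i ^+ m * X i ^+ m).
  elim: m => [|m [a IH]]; first by exists 1; rewrite mul1r scale1r.
  have [b comm] : exists b, X i * V i ^+ m = b *: (V i ^+ m * X i).
    elim: m {IH} => [|m [b IH]]; first by exists 1; rewrite mulr1 mul1r scale1r.
    exists (c i i * b); rewrite exprS mulrA XV -kscalerAl -mulrA IH.
    by rewrite -kscalerAr scalerA mulrA.
  exists (a * b); rewrite exprS IH -kscalerAr mulrA -[V i * X i * _]mulrA comm.
  by rewrite -kscalerAr -kscalerAl scalerA !mulrA -exprS -mulrA -exprS.
split=> [i|i|i j|i|i j|i j|i].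
- exact: KV.
- exact: VK.
- exact: VV.
- by rewrite iter_op; apply: Vl.
- change (K i * (- (V j * X j) * V i) = c i j *: (- (V j * X j) : R)).
  rewrite mulNr mulrN scalerN; congr (- _).
  by rewrite !mulrA KVc -!mulrA [K i * _]mulrA KXV -kscalerAr.
- change ((- (V j * X j)) * (- (V i * X i)) = th i j *: ((- (V i * X i)) * (- (V j * X j)) : R)).
  rewrite !mulrNN !mulrA -[V j * X j * V i]mulrA -[V i * X i * V j]mulrA !XV.
  rewrite -!kscalerAr -!kscalerAl !mulrA [V j * V i]VV -!mulrA (XX i j).
  rewrite -!kscalerAr !scalerA; congr (_ *: _); rewrite /c eq_sym.
  rewrite -[LHS]mul1r -(theta_opp i j); move: (th i j) (th j i) (q ^+ _) => x y z.
  by ring.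
- rewrite iter_op; change ((- (V i * X i)) ^+ l = 0 :> R); rewrite exprNn.
  by have [a ->] := VXl i l; rewrite Xl mulr0 scaler0 mulr0.
Qed.

Definition comul_gen (g : taft_gen n) : tens 2 W :=
  match g with
  | GenK i => tens2 (f (GenK i)) (f (GenK i))
  | GenKinv i => tens2 (f (GenKinv i)) (f (GenKinv i))
  | GenX i => tens2 (f (GenX i)) one + tens2 (f (GenK i)) (f (GenX i))
  end.

Lemma comul_rels : taft_rels l q (lmul mul) (tens2 one one) comul_gen.
Proof.
have alg2 := tens2_alg algW; have [Tl Tr _ _ _] := alg2.
have [B1 B2] := tens2_bilin W.
pose t2 (u v : R) : kring alg2 := tens2 (u : W) (v : W).
have t2M u v u' v' : t2 u v * t2 u' v' = t2 (u * u') (v * v').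
  exact: (lmul_tens2 algW).
have t2X u v m : t2 u v ^+ m = t2 (u ^+ m) (v ^+ m).
  by elim: m => [|m IH] //; rewrite !exprS IH t2M.
have t2Zl x u v : t2 (x *: u) v = x *: t2 u v by rewrite /t2 (linZ (B1 v)).
have t2Zr x u v : t2 u (x *: v) = x *: t2 u v by rewrite /t2 (linZ (B2 u)).
have t20r u : t2 u 0 = 0 by rewrite /t2 (lin0 (B2 u)).
have t20l u : t2 0 u = 0 by rewrite /t2 (lin0 (B1 u)).
split=> [i|i|i j|i|i j|i j|i].
- by change (t2 (K i) (K i) * t2 (V i) (V i) = t2 1 1); rewrite t2M KV.
- by change (t2 (V i) (V i) * t2 (K i) (K i) = t2 1 1); rewrite t2M VK.
- change (t2 (K i) (K i) * t2 (K j) (K j) = t2 (K j) (K j) * t2 (K i) (K i)).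
  by rewrite !t2M KK.
- rewrite (kring_expE alg2); change (t2 (K i) (K i) ^+ l = t2 1 1).
  by rewrite t2X Kl.
- change (t2 (K i) (K i) * (t2 (X j) 1 + t2 (K j) (X j)) * t2 (V i) (V i)
    = c i j *: (t2 (X j) 1 + t2 (K j) (X j))).
  rewrite mulrDr mulrDl !t2M mulr1 KV !KXV scalerDr t2Zl t2Zr.
  by rewrite KK -mulrA KV mulr1.
- change ((t2 (X i) 1 + t2 (K i) (X i)) * (t2 (X j) 1 + t2 (K j) (X j))
    = th i j *: ((t2 (X j) 1 + t2 (K j) (X j)) * (t2 (X i) 1 + t2 (K i) (X i)))).
  case: (eqVneq i j) => [->|ij]; first by rewrite theta_diag scale1r.
  have cE i' j' : i' != j' -> c i' j' = th i' j'.
    by rewrite /c => /negPf ->; rewrite mulr1.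
  rewrite !mulrDl !mulrDr !t2M !mul1r !mulr1 !(KX _ _) !cE // 1?eq_sym // (XX i j) (KK i j).
  rewrite !t2Zl !t2Zr !scalerDr !scalerA theta_opp scale1r.
  by rewrite addrACA.
- rewrite (kring_expE alg2); change ((t2 (X i) 1 + t2 (K i) (X i)) ^+ l = 0).
  (* With a = x_i (x) 1 and b = K_i (x) x_i one has b a = q a b, and both l-th powers vanish. *)
  rewrite (qbinomial_prim_root (q := q)) //.
    by rewrite !t2X Xl t20l t20r addr0.
  have cii : c i i = q by rewrite /c theta_diag eqxx mul1r expr1.
  by rewrite (t2M (K i)) (t2M (X i)) KX cii t2Zl mulr1 mul1r.
Qed.

End Derived.

End TaftRelations.

(** * The presented algebra and its characters *)

Section TaftAlgebra.
Variables (k : fieldType) (l n : nat) (q : k).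
Hypothesis q_prim : l.-primitive_root q.

Local Notation T := (taft l q n).
Local Notation gen := (pgen (taft_rel l q (n := n)) : taft_gen n -> T).
Local Notation pmulT := (@pmul k _ (taft_rel l q (n := n))).

Lemma taft_gen_rels : taft_rels l q pmulT 1 gen.
Proof.
apply/(taft_relsP _ _ _ (palg_alg _)) => x y xy.
by rewrite !fext_pgen; apply: palg_pi_rel.
Qed.

Lemma taft_extend (W : lmodType k) (mul : W -> W -> W) (one : W) f :
  is_alg mul one -> taft_rels l q mul one f ->
  is_alg_map pmulT 1 mul one (pext mul one f)
  /\ forall g, pext mul one f (gen g) = f g.
Proof.
move=> algW /(taft_relsP l q f algW) fR.
split; first exact: (pext_alg_map algW fR).
by move=> g; apply: (pext_gen algW fR).
Qed.

Lemma scalar_rels (f : taft_gen n -> k) :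
  (forall i, f (GenK i) * f (GenKinv i) = 1) ->
  (forall i, f (GenK i) ^+ l = 1) -> (forall i, f (GenX i) = 0) ->
  taft_rels (W := k^o) l q *%R 1 f.
Proof.
move=> KV Kl X0.
have iterE (u : k) m : iter m ( *%R u) 1 = u ^+ m.
  by elim: m => // m IH; rewrite exprS /= IH.
split=> [i|i|i j|i|i j|i j|i].
- exact: KV.
- by rewrite mulrC KV.
- exact: mulrC.
- by rewrite iterE Kl.
- by rewrite X0 mulr0 mul0r scaler0.
- by rewrite !X0 mulr0 scaler0.
- by rewrite iterE X0 expr0n gtn_eqF // (prim_order_gt0 q_prim).
Qed.

Definition taft_char (c : {ffun 'I_n -> int}) : T -> k :=
  pext (W := k^o) *%R 1 (gen_char q c).

Lemma taft_characters : characters q gen taft_char.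
Proof.
have cR (c : {ffun 'I_n -> int}) : taft_rels (W := k^o) l q *%R 1 (gen_char q c).
  apply: scalar_rels => i //=; have qD := exprzD_root q_prim.
    by rewrite -qD -latdotDr addrN latdot0r.
  by rewrite exprnP exprz_exp -natz mulr_natr (exprzMn_root q_prim).
by split=> c; have [] := taft_extend (field_alg k) (cR c).
Qed.

Lemma taft_taft_like : taft_like gen.
Proof.
have algT : is_alg pmulT 1 := palg_alg _.
have [comM comG] := taft_extend (tens2_alg algT) (comul_rels q_prim algT taft_gen_rels).
have [antM antG] := taft_extend (opp_alg algT) (opp_rels q_prim algT taft_gen_rels).
have coR : taft_rels (W := k^o) l q *%R 1 (@gen_counit k n).
  by apply: scalar_rels => i //=; rewrite ?mulr1 ?expr1n.
have [couM couG] := taft_extend (field_alg k) coR.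
rewrite lmulE in comM comG.
split.
- exact: algT.
- exact: palg_spanned.
- by rewrite lmulE; exact: comM.
- exact: couM.
- exact: antM.
- by move=> g; rewrite [LHS]comG; case: g.
- exact: couG.
- by move=> g; rewrite [LHS]antG; case: g.
- exact: (tr_KV taft_gen_rels).
- exact: (tr_VK taft_gen_rels).
Qed.

End TaftAlgebra.

(** * Tensor powers *)

Section TensorFamily.
Variables (k : fieldType) (n : nat) (V : lmodType k).
Variables (mul : V -> V -> V) (one : V).
Hypothesis algV : is_alg mul one.
Local Notation m := (lmul mul).
Local Notation one_n := (ptens [ffun=> one] : tens n V).

Definition slot (i : 'I_n) (a : V) : tens n V :=
  ptens [ffun j => if j == i then a else one].

Let Tl (t : tens n V) : linear (m ^~ t). Proof. exact: lmul_linl algV t. Qed.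
Let Tr (t : tens n V) : linear (m t). Proof. exact: lmul_linr algV t. Qed.
Let mul1l : left_id one mul. Proof. by case: algV. Qed.
Let mul1r : right_id one mul. Proof. by case: algV. Qed.

Lemma tens_mul_ext (W : lmodType k) (mulW : W -> W -> W) (oneW : W)
    (f : tens n V -> W) : is_alg mulW oneW -> linear f ->
  (forall a b : {ffun 'I_n -> V},
     f (ptens [ffun i => mul (a i) (b i)]) = mulW (f (ptens a)) (f (ptens b))) ->
  forall s t, f (m s t) = mulW (f s) (f t).
Proof.
move=> [Wl Wr _ _ _] f_lin fM s t; move: s.
apply: tens_ext => [||a]; first exact: (linear_comp (Tl t) f_lin).
  exact: (linear_comp f_lin (Wl _)).
move: t; apply: tens_ext => [||b]; first exact: (linear_comp (Tr _) f_lin).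
  exact: (linear_comp f_lin (Wr _)).
by rewrite (lmul_ptens algV).
Qed.

Lemma slot_alg_map i : is_alg_map mul one m one_n (slot i).
Proof.
split=> [||a b].
- apply: (linear_ptens_upd (v := [ffun=> one]) (i := i)) => u.
  by apply/ffunP=> j; rewrite !ffunE.
- by congr ptens; apply/ffunP=> j; rewrite !ffunE if_same.
rewrite (lmul_ptens algV); congr ptens; apply/ffunP=> j; rewrite !ffunE.
by case: eqP => // _; rewrite mul1l.
Qed.

Lemma slot_comm i j a b : i != j -> m (slot i a) (slot j b) = m (slot j b) (slot i a).
Proof.
move=> ij; rewrite !(lmul_ptens algV); congr ptens; apply/ffunP=> h; rewrite !ffunE.
case: (eqVneq h i) => [->|_]; first by rewrite (negPf ij) mul1l mul1r.
by case: eqP => _; rewrite ?mul1l ?mul1r.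
Qed.

Lemma big_slot (v : {ffun 'I_n -> V}) :
  \big[m/one_n]_(i < n) slot i (v i) = ptens v.
Proof.
have gen s : uniq s -> \big[m/one_n]_(i <- s) slot i (v i)
    = ptens [ffun i => if i \in s then v i else one].
  elim: s => [_|i s IH /= /andP[nis us]].
    by rewrite big_nil; congr ptens; apply/ffunP=> j; rewrite !ffunE.
  rewrite big_cons IH // (lmul_ptens algV); congr ptens; apply/ffunP=> j.
  rewrite !ffunE inE; case: eqP => [->|_] /=; last by rewrite mul1l.
  by rewrite (negPf nis) mul1r.
rewrite gen ?index_enum_uniq //; congr ptens; apply/ffunP=> i.
by rewrite ffunE mem_index_enum.
Qed.

Variables (W : lmodType k) (mulW : W -> W -> W) (oneW : W).
Hypothesis algW : is_alg mulW oneW.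
Variable E : 'I_n -> V -> W.
Hypothesis EM : forall i, is_alg_map mul one mulW oneW (E i).
Hypothesis E_comm : forall i j a b, i != j ->
  mulW (E i a) (E j b) = mulW (E j b) (E i a).

Definition family_prod (v : {ffun 'I_n -> V}) : W :=
  \big[mulW/oneW]_(i < n) E i (v i).

Lemma family_prod_multilinear : multilinear family_prod.
Proof.
have [Wl Wr _ _ _] := algW; have E_lin i : linear (E i) by case: (EM i).
move=> v i a u w; rewrite /family_prod.
have notin x s : i \notin s ->
    \big[mulW/oneW]_(j <- s) E j (upd v i x j) = \big[mulW/oneW]_(j <- s) E j (v j).
  move=> nis; rewrite big_seq [RHS]big_seq; apply: eq_bigr => j js.
  by rewrite ffunE; case: eqP => // ji; rewrite -ji js in nis.
have gen s : uniq s -> i \in s ->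
    \big[mulW/oneW]_(j <- s) E j (upd v i (a *: u + w) j)
    = a *: \big[mulW/oneW]_(j <- s) E j (upd v i u j)
      + \big[mulW/oneW]_(j <- s) E j (upd v i w j).
  elim: s => //= j s IH /andP[njs us]; rewrite inE !big_cons.
  case: (eqVneq i j) => [ij _|ij /= si].
    by rewrite -ij in njs *; rewrite !notin // !ffunE eqxx E_lin Wl.
  by rewrite IH // !ffunE eq_sym (negPf ij) Wr.
by rewrite gen ?index_enum_uniq ?mem_index_enum.
Qed.

Lemma family_slot i a : llift family_prod (slot i a) = E i a.
Proof.
have [_ _ mulA mul1l' mul1r'] := algW.
rewrite (llift_ptens _ family_prod_multilinear) /family_prod.
have E1 j : E j one = oneW by case: (EM j).
have gen s : uniq s ->
    \big[mulW/oneW]_(j <- s) E j ([ffun j => if j == i then a else one] j)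
    = if i \in s then E i a else oneW.
  elim: s => [|j s IH /= /andP[njs us]]; first by rewrite big_nil.
  rewrite big_cons IH // ffunE inE (eq_sym j i); case: (eqVneq i j) => [ij|ij] /=.
    by rewrite ij (negPf njs) mul1r'.
  by rewrite E1 mul1l'.
by rewrite gen ?index_enum_uniq // mem_index_enum.
Qed.

(** The universal property of the tensor power of an algebra: commuting algebra maps on the slots
    combine into one. It produces the coproduct, the counit, the characters and the maps out of the
    tensor power. *)
Lemma family_alg_map : is_alg_map m one_n mulW oneW (llift family_prod).
Proof.
have L := llift_linear family_prod_multilinear.
have LE := fun v => llift_ptens v family_prod_multilinear.
split=> //.
  rewrite LE; apply: (big_ind (fun x => x = oneW)) => // [_ _ -> ->|i _].
    by case: algW.
  by rewrite ffunE; case: (EM i).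
apply: (tens_mul_ext algW L) => a b; rewrite !LE.
rewrite /family_prod; have [_ _ mulA mul1l' mul1r'] := algW.
have EMm i : E i (mul (a i) (b i)) = mulW (E i (a i)) (E i (b i)) by case: (EM i).
(* [mulW] need not be commutative, so the interleaved product is sorted by moving the image of b_j
   past the factors of other slots. *)
have comm j s : j \notin s ->
    mulW (E j (b j)) (\big[mulW/oneW]_(i <- s) E i (a i))
    = mulW (\big[mulW/oneW]_(i <- s) E i (a i)) (E j (b j)).
  elim: s => [|i s IH]; first by rewrite big_nil mul1l' mul1r'.
  rewrite inE negb_or big_cons => /andP[ji js].
  by rewrite mulA (E_comm _ _ ji) -mulA IH // mulA.
have gen s : uniq s ->
    \big[mulW/oneW]_(i <- s) E i ([ffun i => mul (a i) (b i)] i)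
    = mulW (\big[mulW/oneW]_(i <- s) E i (a i)) (\big[mulW/oneW]_(i <- s) E i (b i)).
  elim: s => [|i s IH /= /andP[nis us]]; first by rewrite !big_nil mul1l'.
  by rewrite !big_cons IH // ffunE EMm -!mulA; congr mulW; rewrite !mulA comm.
by rewrite gen ?index_enum_uniq.
Qed.

End TensorFamily.

(** * The tensor power on Taft generators *)

Section HopfPower.
Variables (k : fieldType) (l n : nat) (q : k).
Hypothesis q_prim : l.-primitive_root q.
Variables (D : hopf_data k) (gen1 : taft_gen 1 -> D).
Variable chi1 : {ffun 'I_1 -> int} -> D -> k.
Hypothesis tl1 : taft_like gen1.
Hypothesis chi1P : characters q gen1 chi1.

Local Notation P := (hpow D n).
Local Notation one_n := (ptens [ffun=> hone D] : tens n D).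
Local Notation mulP := (lmul (@hmul k D) : tens n D -> tens n D -> tens n D).
Local Notation sl i := (@slot k n D (hone D) i).

Let algD := tl_alg tl1.
Let algP : is_alg mulP one_n := tens_alg n algD.
Let alg2 : is_alg (lmul mulP) (tens2 one_n one_n) := tens2_alg algP.
Let slotM (i : 'I_n) := slot_alg_map algD i.

Definition pow_gen (g : taft_gen n) : P := sl (gen_idx g) (gen1 (gen_base g)).

Let slot2 (i : 'I_n) (t : tens 2 D) : tens 2 (tens n D) :=
  lift2 (fun x y => tens2 (sl i x) (sl i y)) t.

Let slot2B i : bilin (fun x y => tens2 (sl i x) (sl i y)).
Proof.
have [L _ _] := slotM i; have [B1 B2] := tens2_bilin (tens n D).
by split=> [y|x]; [apply: (linear_comp L (B1 _)) | apply: (linear_comp L (B2 _))].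
Qed.

Let slot2M i : is_alg_map (lmul (@hmul k D)) (tens2 (hone D) (hone D))
  (lmul mulP) (tens2 one_n one_n) (slot2 i).
Proof.
have [_ s1 sM] := slotM i.
apply: (lift2_alg_map algD alg2 (slot2B i)); first by rewrite s1.
by move=> a b c d; rewrite !sM (lmul_tens2 algP).
Qed.

Let slot2_comm i j s t : i != j ->
  lmul mulP (slot2 i s) (slot2 j t) = lmul mulP (slot2 j t) (slot2 i s).
Proof.
move=> ij; apply: (lift2_commute s t alg2 (slot2B i) (slot2B j)) => a b c d.
apply: (etrans (lmul_tens2 algP _ _ _ _)); apply: (etrans _ (esym (lmul_tens2 algP _ _ _ _))).
by apply: f_equal2; apply: (slot_comm algD _ _ ij).
Qed.

Let comulE (i : 'I_n) (a : D) := slot2 i (hcomul a).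

Let comulEM i : is_alg_map (@hmul k D) (hone D) (lmul mulP) (tens2 one_n one_n) (comulE i).
Proof. exact: (alg_map_comp (tl_comul tl1) (slot2M i)). Qed.

Let comulE_comm i j a b : i != j ->
  lmul mulP (comulE i a) (comulE j b) = lmul mulP (comulE j b) (comulE i a).
Proof. exact: slot2_comm. Qed.

Let hpow_comulE : @hcomul k P
  = llift (family_prod (lmul mulP) (tens2 one_n one_n) comulE).
Proof.
by rewrite /comulE /slot2 /lift2 /family_prod !lmulE llift.unlock.
Qed.

Let counitE (i : 'I_n) : is_alg_map (W := k^o) (@hmul k D) (hone D) *%R 1 (@hcounit k D).
Proof. exact: tl_counit tl1. Qed.

Let hpow_counitE : @hcounit k P
  = llift (W := k^o) (family_prod (W := k^o) *%R 1 (fun=> @hcounit k D)).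
Proof. by rewrite llift.unlock. Qed.

Let antip_ML : multilinear (fun a : {ffun 'I_n -> D} => ptens [ffun i => hantipode (a i)]).
Proof.
have [L _ _] := tl_antipode tl1.
move=> v i; have updE x : [ffun j => hantipode (upd v i x j)]
    = upd [ffun j => hantipode (v j)] i (hantipode x).
  by apply/ffunP => j; rewrite !ffunE; case: eqP.
move=> a u w; rewrite (updE (a *: u + w)) (updE u) (updE w) L.
exact: ptens_multilinear.
Qed.

Let hpow_antipodeE : @hantipode k P
  = llift (fun a : {ffun 'I_n -> D} => ptens [ffun i => hantipode (a i)]).
Proof. by rewrite llift.unlock. Qed.

Let antipode_slot i a : hantipode (sl i a : P) = sl i (hantipode a).
Proof.
rewrite hpow_antipodeE (llift_ptens _ antip_ML); congr ptens.
apply/ffunP=> j; rewrite !ffunE; case: eqP => // _.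
by case: (tl_antipode tl1).
Qed.

(** [insp] is membership in the span of the words. It is closed under products by concatenation and
    contains every slot image, hence also every pure tensor by [big_slot]. *)
Lemma pow_spanned : spanned mulP one_n pow_gen.
Proof.
pose insp (x : tens n D) := forall Q : tens n D -> Prop, Q 0 ->
  (forall a x y, Q x -> Q y -> Q (a *: x + y)) ->
  (forall w, Q (mon mulP one_n pow_gen w)) -> Q x.
suff all_insp x : insp x by move=> Q Q0 QD Qm y; apply: (all_insp y).
have insp_mon w : insp (mon mulP one_n pow_gen w) by move=> Q _ _; apply.
have insp0 : insp 0 by move=> Q.
have inspD a y z : insp y -> insp z -> insp (a *: y + z).
  by move=> iy iz Q Q0 QD Qm; apply: (QD a y z (iy Q Q0 QD Qm) (iz Q Q0 QD Qm)).
have [Wl Wr _ _ _] := algP.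
have inspM y z : insp y -> insp z -> insp (mulP y z).
  move=> iy iz; apply: (iy (fun y => insp (mulP y z))) => [|a u v iu iv|w].
  - by rewrite (lin0 (Wl z)).
  - by rewrite (Wl z a u v); apply: inspD.
  apply: (iz (fun z => insp (mulP _ z))) => [|a u v iu iv|w'].
  - by rewrite (lin0 (Wr _)).
  - by rewrite (Wr _ a u v); apply: inspD.
  by rewrite -mon_cat.
have insp_slot i a : insp (sl i a).
  have [L _ _] := slotM i; move: a; apply: (tl_span tl1) => [|a y z iy iz|w].
  - by rewrite (lin0 L).
  - by rewrite L; apply: inspD.
  rewrite (mon_map _ _ (slotM i)).
  rewrite [mon _ _ _ w](_ : _ = mon mulP one_n pow_gen (map (gen_at i) w)) //.
  elim: w => [|g w IH]; first by rewrite !mon_nil.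
  by rewrite /= !mon_cons IH /pow_gen gen_idx_at gen_atK.
elim/tens_ind: x => // v; rewrite -(big_slot algD v).
apply: (big_ind insp) => //.
by rewrite -(mon_nil mulP one_n pow_gen); apply: insp_mon.
Qed.

Let pow_comul_gen g : hcomul (pow_gen g) = gen_comul pow_gen g.
Proof.
have comG := family_slot alg2 comulEM.
rewrite hpow_comulE; apply: (etrans (comG (gen_idx g) (gen1 (gen_base g)))).
apply: (etrans (f_equal (slot2 (gen_idx g)) (tl_comul_gen tl1 (gen_base g)))).
have slot2E i a b : slot2 i (tens2 a b) = tens2 (sl i a) (sl i b).
  exact: (lift2_tens2 a b (slot2B i)).
have slot2D i s t : slot2 i (s + t) = slot2 i s + slot2 i t.
  exact: (linD (lift2_linear (slot2B i)) s t).
case: g => i; [exact: slot2E | exact: slot2E |].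
apply: (etrans (slot2D i _ _)); apply: f_equal2; last exact: slot2E.
by apply: (etrans (slot2E i _ _)); apply: f_equal2 => //; case: (slotM i).
Qed.

Lemma pow_taft_like : taft_like pow_gen.
Proof.
have comM := family_alg_map algD alg2 comulEM comulE_comm.
have coC (i j : 'I_n) (a b : D) : i != j -> hcounit a * hcounit b = hcounit b * hcounit a :> k^o.
  by move=> _; apply: mulrC.
have couM := family_alg_map algD (field_alg k) counitE coC.
have couG := family_slot (field_alg k) counitE.
have [B1 B2] := tens2_bilin (tens n D).
split.
- by rewrite -[@hmul k P]lmulE; apply: algP.
- by rewrite -[@hmul k P]lmulE; apply: pow_spanned.
- by rewrite -[@hmul k P]lmulE hpow_comulE; apply: comM.
- by rewrite -[@hmul k P]lmulE hpow_counitE; apply: couM.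
- rewrite -[@hmul k P]lmulE hpow_antipodeE.
  have L := llift_linear antip_ML; have [_ S1 SM] := tl_antipode tl1.
  split=> //.
    by rewrite (llift_ptens _ antip_ML); congr ptens; apply/ffunP => i; rewrite !ffunE S1.
  apply: (tens_mul_ext algD (opp_alg algP) L) => a b.
  rewrite !(llift_ptens _ antip_ML) (lmul_ptens algD); congr ptens.
  by apply/ffunP=> i; rewrite !ffunE SM.
- exact: pow_comul_gen.
- move=> g; rewrite hpow_counitE [LHS]couG (tl_counit_gen tl1).
  by case: g.
- move=> g; rewrite [LHS]antipode_slot (tl_antipode_gen tl1).
  case: g => i //; have [sL _ sM] := slotM i.
  apply: (etrans (linN sL _)); apply: f_equal; apply: (etrans (sM _ _)).
  by rewrite lmulE.
- move=> i; rewrite -[@hmul k P]lmulE; have [_ s1 sM] := slotM i.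
  by apply: (etrans (esym (sM _ _))); rewrite (tl_KV tl1) s1.
- move=> i; rewrite -[@hmul k P]lmulE; have [_ s1 sM] := slotM i.
  by apply: (etrans (esym (sM _ _))); rewrite (tl_VK tl1) s1.
Qed.

Definition pow_char (c : {ffun 'I_n -> int}) : P -> k :=
  llift (W := k^o) (family_prod (W := k^o) *%R 1 (fun i => chi1 [ffun=> c i])).

Let chiE (c : {ffun 'I_n -> int}) (i : 'I_n) :
  is_alg_map (W := k^o) (@hmul k D) (hone D) *%R 1 (chi1 [ffun=> c i]).
Proof. by case: chi1P. Qed.

Let chi_comm (c : {ffun 'I_n -> int}) (i j : 'I_n) (a b : D) : i != j ->
  (chi1 [ffun=> c i] a : k^o) * chi1 [ffun=> c j] b
  = (chi1 [ffun=> c j] b : k^o) * chi1 [ffun=> c i] a.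
Proof. by move=> _; apply: mulrC. Qed.

Lemma pow_char_ptens c (v : {ffun 'I_n -> D}) :
  pow_char c (ptens v) = \prod_(i < n) chi1 [ffun=> c i] (v i).
Proof.
exact: (llift_ptens _ (family_prod_multilinear (field_alg k) (chiE c))).
Qed.

Lemma pow_characters : characters q pow_gen pow_char.
Proof.
split=> c.
  rewrite -[@hmul k P]lmulE.
  exact: (family_alg_map algD (field_alg k) (chiE c) (@chi_comm c)).
move=> g; rewrite [LHS](family_slot (field_alg k) (chiE c)).
rewrite (proj2 chi1P); case: g => i //=; rewrite ?latdotNr !latdot_epsr ffunE //.
Qed.

End HopfPower.

(** * Twisting the commutation relations *)

Lemma theta1 (k : fieldType) (q : k) (a b : 'I_1) : theta q (eps a) (eps b) = 1.
Proof. by rewrite (ord1 a) (ord1 b) /theta subrr. Qed.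

Lemma taft_rels_map (k : fieldType) (l n : nat) (q : k) (U W : lmodType k)
    (mulU : U -> U -> U) (oneU : U) (mulW : W -> W -> W) (oneW : W)
    (h : U -> W) (f : taft_gen n -> U) :
  is_alg_map mulU oneU mulW oneW h -> taft_rels l q mulU oneU f ->
  taft_rels l q mulW oneW (h \o f).
Proof.
move=> [h_lin h1 hM] [KV VK KK Kl KX XX Xl].
have hiter x m : iter m (mulW (h x)) oneW = h (iter m (mulU x) oneU).
  by elim: m => //= m ->; rewrite hM.
split=> [i|i|i j|i|i j|i j|i] /=.
- by rewrite -hM KV.
- by rewrite -hM VK.
- by rewrite -!hM KK.
- by rewrite hiter Kl.
- by rewrite -!hM KX (linZ h_lin).
- by rewrite -!hM XX (linZ h_lin).
- by rewrite hiter Xl (lin0 h_lin).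
Qed.

Section QComm.
Variables (k : fieldType) (l n : nat) (q : k).
Hypothesis q_prim : l.-primitive_root q.
Local Notation Lat := {ffun 'I_n -> int}.

(** Converse of [taft_qcomm]: relations with one index come from rank one, those with two indices
    from q-commutation. *)
Lemma qcomm_taft (W : lmodType k) (mul : W -> W -> W) (one : W)
    (f : taft_gen n -> W) : is_alg mul one ->
  qcomm_rels l q (@star_comm n) mul one f -> taft_rels l q mul one f.
Proof.
move=> [Wl Wr mulA _ mul1r] [S C].
have th_diag (i : 'I_n) : theta q (eps i) (eps i) = 1 by rewrite /theta subrr.
have thE (i j : 'I_n) : theta q (eps i) (eps j) = q ^ star_comm (eps i) (eps j).
  by rewrite /theta !starE.
have KV i : mul (f (GenK i)) (f (GenKinv i)) = one := tr_KV (S i) ord0.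
split=> [i|i|i j|i|i j|i j|i].
- exact: KV.
- exact: (tr_VK (S i) ord0).
- case: (eqVneq i j) => [->//|ij].
  by rewrite (C (GenK i) (GenK j) ij) /= subrr scale1r.
- exact: (tr_Kl (S i) ord0).
- case: (eqVneq i j) => [<-|ij].
    by have := tr_KX (S i) ord0 ord0; rewrite theta1 th_diag.
  rewrite (C (GenK i) (GenX j) ij) /= star_comm0r subr0 (linZ (Wl _)) -mulA KV mul1r.
  by rewrite mulr1 thE.
- case: (eqVneq i j) => [<-|ij]; first by rewrite th_diag scale1r.
  by rewrite (C (GenX i) (GenX j) ij) /= star_comm0r subr0 thE.
- exact: (tr_Xl (S i) ord0).
Qed.

Section Deformation.
Variables (D : hopf_data k) (gen : taft_gen n -> D) (chi : Lat -> D -> k).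
Hypothesis tlD : taft_like gen.
Hypothesis chiP : characters q gen chi.
Variables (wt : Lat -> Lat) (tw : D -> D -> D).
Hypothesis wtD : {morph wt : a b / a + b}.
Hypothesis twB : bilin tw.
Hypothesis tw_hom : forall a b g h g' h', homog q chi a g h -> homog q chi b g' h' ->
  tw a b = q ^ (latdot (wt g') g - latdot (wt h') h) *: hmul a b.

(** An unspecified z suffices for the relations on l-th powers: for K_i the two degrees coincide and
    the exponent is 0, while for x_i the power itself vanishes. *)
Lemma deform_iter a g h m : homog q chi a g h ->
  exists z, iter m (tw a) (hone D)
    = q ^ ((latdot (wt g) g - latdot (wt h) h) * z) *: iter m (hmul a) (hone D).
Proof.
move=> ha; have wtMn := morphDMn wtD.
have hiter j : homog q chi (iter j (hmul a) (hone D)) (g *+ j) (h *+ j).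
  elim: j => [|j IH]; first exact: (homog1 tlD chiP).
  by rewrite !mulrS; apply: (homog_mul q_prim tlD chiP ha IH).
case: m => [|m]; first by exists 0; rewrite mulr0 scale1r.
elim: m => [|m [z IH]].
  exists 0; rewrite mulr0 scale1r /= (tw_hom ha (homog1 tlD chiP)).
  by rewrite (morphD0 wtD) !latdot0l subrr scale1r.
exists (z + m.+1%:R); rewrite iterS IH (linZ (proj2 twB a)) (tw_hom ha (hiter m.+1)).
rewrite -iterS scalerA -(exprzD_root q_prim) !wtMn !latdotMnl; congr (q ^ _ *: _).
by rewrite mulrDr mulr_natr mulrnBl.
Qed.

(** Exchanging two letters compares the factors of the two orders of multiplication, so B grows by
    the antisymmetrised bicharacter, while relations within one index survive. *)
Lemma qcomm_deform (B : Lat -> Lat -> int) :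
  qcomm_rels l q B (@hmul k D) (hone D) gen ->
  qcomm_rels l q (fun a b => B a b + (latdot (wt b) a - latdot (wt a) b)) tw (hone D) gen.
Proof.
move=> [S C]; have hg := homog_gen tlD chiP; have qD := exprzD_root q_prim.
have wt0 := morphD0 wtD; have wtN := morphDN wtD.
split=> [i|g h gh]; last first.
  rewrite (tw_hom (hg g) (hg h)) (tw_hom (hg h) (hg g)) (C g h gh) !scalerA -!qD.
  by congr (q ^ _ *: _); ring.
have hK := hg (GenK i); have hV := hg (GenKinv i); have hX := hg (GenX i).
split=> [a|a|a b|a|a b|a b|a] /=; rewrite ?theta1.
- by rewrite (tw_hom hK hV) subrr scale1r; apply: (tr_KV (S i) ord0).
- by rewrite (tw_hom hV hK) subrr scale1r; apply: (tr_VK (S i) ord0).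
- by [].
- have [z ->] := deform_iter l hK.
  by rewrite subrr mul0r scale1r; apply: (tr_Kl (S i) ord0).
(* The first multiplication contributes q^(wt e_i . e_i), the second its inverse. *)
- rewrite (tw_hom hK hX) (linZ (proj1 twB _)).
  rewrite (tw_hom (homog_mul q_prim tlD chiP hK hX) hV) scalerA -qD /=.
  have := tr_KX (S i) ord0 ord0; rewrite theta1 (ord1 a) (ord1 b) /= => ->.
  rewrite scalerA wtN wt0 !latdotDr !latdotNl latdot0l latdot0r.
  by rewrite (_ : _ - 0 + _ = 0) ?mul1r //; ring.
- by rewrite scale1r.
- have [z ->] := deform_iter l hX.
  by rewrite [iter l _ _](tr_Xl (S i) ord0) scaler0.
Qed.

End Deformation.

Section Power.
Variables (D : hopf_data k) (gen1 : taft_gen 1 -> D).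
Hypothesis algD : is_alg (@hmul k D) (hone D).
Hypothesis rels1 : taft_rels l q (@hmul k D) (hone D) gen1.

Lemma pow_qcomm : qcomm_rels l q (fun _ _ => 0) (@hmul k (hpow D n))
  (hone (hpow D n)) (pow_gen gen1).
Proof.
rewrite -[@hmul k (hpow D n)]lmulE; split=> [i|g h gh].
  have -> : (fun g => pow_gen gen1 (gen_at i g)) = @slot k n D (hone D) i \o gen1.
    by apply/funext => g; rewrite /pow_gen gen_idx_at gen_atK.
  exact: (taft_rels_map (slot_alg_map algD i) rels1).
by rewrite subrr scale1r; apply: (slot_comm algD).
Qed.

End Power.

End QComm.

Lemma word_commute (k : fieldType) (X : Type) (U W : lmodType k)
    (mulU : U -> U -> U) (oneU : U) (mulW : W -> W -> W) (oneW : W)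
    (f : X -> U) (h : U -> W) (z : W) :
  is_alg mulW oneW -> spanned mulU oneU f -> is_alg_map mulU oneU mulW oneW h ->
  (forall g, mulW z (h (f g)) = mulW (h (f g)) z) ->
  forall a, mulW z (h a) = mulW (h a) z.
Proof.
move=> [Wl Wr mulA mul1l mul1r] Uspan hM comm.
have [h_lin h1 hm] := hM; apply: (spanned_ext Uspan) => [||w].
- exact: (linear_comp h_lin (Wr z)).
- exact: (linear_comp h_lin (Wl z)).
elim: w => [|g w IH]; first by rewrite mon_nil h1 mul1l mul1r.
by rewrite mon_cons hm mulA comm -mulA IH mulA.
Qed.

(** * The isomorphism *)

(** Held by the Taft algebra for [star_comm] and by the tensor power for 0. Uniqueness of h is left
    to [alg_map_ext]. *)
Definition qcomm_universal (k : fieldType) (l n : nat) (q : k)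
    (B : {ffun 'I_n -> int} -> {ffun 'I_n -> int} -> int)
    (D : hopf_data k) (gen : taft_gen n -> D) : Prop :=
  forall (W : lmodType k) (mul : W -> W -> W) (one : W) (f : taft_gen n -> W),
    is_alg mul one -> qcomm_rels l q B mul one f ->
    exists h : D -> W, is_alg_map (@hmul k D) (hone D) mul one h
      /\ forall g, h (gen g) = f g.

Section TwistIso.
Variables (k : fieldType) (l n : nat) (q : k).
Hypothesis q_prim : l.-primitive_root q.
Hypothesis l0 : l%:R != 0 :> k.
Local Notation Lat := {ffun 'I_n -> int}.
Variables (T P : hopf_data k) (genT : taft_gen n -> T) (genP : taft_gen n -> P).
Variables (chiT : Lat -> T -> k) (chiP : Lat -> P -> k).
Hypotheses (tlT : taft_like genT) (tlP : taft_like genP).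
Hypotheses (chT : characters q genT chiT) (chP : characters q genP chiP).
Variables (wt : Lat -> Lat) (B : Lat -> Lat -> int).
Hypothesis wtD : {morph wt : a b / a + b}.
Hypothesis wtB : forall a b, latdot (wt b) a - latdot (wt a) b = B a b.
Hypothesis relT : qcomm_rels l q B (@hmul k T) (hone T) genT.
Hypothesis relP : qcomm_rels l q (fun _ _ => 0) (@hmul k P) (hone P) genP.
Hypothesis univT : qcomm_universal l q B genT.
Hypothesis univP : qcomm_universal l q (fun _ _ => 0) genP.

Let sigmaP := torus_form l q chiP wt.
Let tauP := torus_form l q chiP (fun a => - wt a).
Let sigmaT := torus_form l q chiT (fun a => - wt a).
Let tauT := torus_form l q chiT (fun a => - - wt a).
Local Notation twP := (@twist_mul k P sigmaP tauP).
Local Notation twT := (@twist_mul k T sigmaT tauT).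
Local Notation wordP w := (mon (@hmul k P) (hone P) genP w).
Local Notation wordT w := (mon (@hmul k T) (hone T) genT w).

Let wtND : {morph (fun a => - wt a) : a b / a + b}.
Proof. by move=> a b; rewrite wtD opprD. Qed.

Let tlTwP := twist_taft_like q_prim tlP chP l0 wtD.
Let tlTwT := twist_taft_like q_prim tlT chT l0 wtND.

Let twP_rels : qcomm_rels l q B twP (hone P) genP.
Proof.
have qc := qcomm_deform q_prim tlP chP wtD (twist_mul_bilin l tlP chP _)
  (twist_mul_hom q_prim tlP chP l0 wtD) relP.
have <- : (fun a b => 0 + (latdot (wt b) a - latdot (wt a) b)) = B; last exact: qc.
by apply/funext => a; apply/funext => b; rewrite add0r wtB.
Qed.

(** The weight - wt subtracts from B exactly what wt added to 0 in [twP_rels]. *)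
Let twT_rels : qcomm_rels l q (fun _ _ => 0) twT (hone T) genT.
Proof.
have qc := qcomm_deform q_prim tlT chT wtND (twist_mul_bilin l tlT chT _)
  (twist_mul_hom q_prim tlT chT l0 wtND) relT.
have <- : (fun a b => B a b + (latdot (- wt b) a - latdot (- wt a) b))
    = (fun _ _ => 0); last exact: qc.
apply/funext => a; apply/funext => b.
by rewrite -wtB !latdotNl -opprD addrN.
Qed.

Theorem twist_iso : exists phi : T -> twist sigmaP tauP,
  hopf_iso phi /\ forall g, phi (genT g) = to_twist sigmaP tauP (genP g).
Proof.
have [phi [phiM phi_gen]] := univT (tl_alg tlTwP) twP_rels.
have [psi [psiM psi_gen]] := univP (tl_alg tlTwT) twT_rels.
have phi_word w : phi (wordT w) = q ^ twexp wt w *: wordP w.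
  rewrite (mon_map _ _ phiM) -(twist_word q_prim tlP chP l0 wtD).
  by apply: eq_mon => g; apply: phi_gen.
have psi_word w : psi (wordP w) = q ^ twexp (fun a => - wt a) w *: wordT w.
  rewrite (mon_map _ _ psiM) -(twist_word q_prim tlT chT l0 wtND).
  by apply: eq_mon => g; apply: psi_gen.
have [phiL phi1 phim] := phiM; have [psiL _ _] := psiM.
exists phi; split=> //; split; [split | split | | |].
- exact: phiL.
(* [psi] is multiplicative into the twist of [T], whereas [phi] is multiplicative into the twist of
   [P]. They are inverse as linear maps on the untwisted carriers. *)
- exists psi.
    apply: (spanned_ext (tl_span tlT)) => [||w];
      [exact: (linear_comp phiL psiL) | by [] |].
    rewrite /= phi_word (linZ psiL) psi_word scalerA twexpN -(exprzD_root q_prim).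
    by rewrite addrN scale1r.
  apply: (spanned_ext (tl_span tlP)) => [||w];
    [exact: (linear_comp psiL phiL) | by [] |].
  rewrite /= psi_word (linZ phiL) phi_word scalerA twexpN -(exprzD_root q_prim).
  by rewrite addNr scale1r.
- exact: phim.
- exact: phi1.
- exact: (taft_like_map_comul tlT tlTwP phiM phi_gen).
- exact: (taft_like_map_counit tlT tlTwP phiM phi_gen).
- exact: (taft_like_map_antipode tlT tlTwP phiM phi_gen).
Qed.

End TwistIso.

(** * The cocycle on the tensor power of the Taft algebra *)

Section Main.
Variables (k : fieldType) (l n : nat) (q : k).
Hypothesis q_prim : l.-primitive_root q.
Hypothesis l0 : l%:R != 0 :> k.
Local Notation Lat := {ffun 'I_n -> int}.

Local Notation T1 := (taft l q 1).
Local Notation gen1 := (pgen (taft_rel l q (n := 1)) : taft_gen 1 -> T1).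
Local Notation T := (taft l q n).
Local Notation genT := (pgen (taft_rel l q (n := n)) : taft_gen n -> T).
Local Notation P := (taft_pow l q n).
Local Notation genP := (pow_gen (n := n) gen1 : taft_gen n -> P).

Definition pow_chi (c : Lat) : P -> k := pow_char (@taft_char k l 1 q) c.

Let tl1 : taft_like gen1 := taft_taft_like 1 q_prim.
Let tlT : taft_like genT := taft_taft_like n q_prim.
Let tlP : taft_like genP := pow_taft_like n tl1.
Let chT := taft_characters n q_prim.
Let chP : characters q genP pow_chi := pow_characters n tl1 (taft_characters 1 q_prim).

Let downD : {morph (fun a : Lat => - up a) : a b / a + b}.
Proof. by move=> a b; rewrite upD opprD. Qed.

(** With weight [- up] the pair K(a), K(b) goes to q^(- up b . a), that is q^(- b * a). The double
    sign in the inverse is the negated weight. *)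
Definition pow_sigma : P -> P -> k := torus_form l q pow_chi (fun a => - up a).
Definition pow_sigma_inv : P -> P -> k := torus_form l q pow_chi (fun a => - - up a).

Let chi_T m (c : {ffun 'I_m -> int}) :
  is_alg_map (W := k^o) (@taft_mul k l q m) 1 *%R 1 (@taft_char k l m q c).
Proof. exact: (proj1 (taft_characters m q_prim) c). Qed.

Let chi_TX m (c : {ffun 'I_m -> int}) (x : taft_alg l q m) e :
  taft_char c (x ^+ e) = taft_char c x ^+ e.
Proof.
have [_ u1 uM] := chi_T c; elim: e => [|e IH]; first exact: u1.
by rewrite !exprS -IH; apply: uM.
Qed.

Lemma taft_char_Kpow m (c b : {ffun 'I_m -> int}) :
  taft_char c (tKpow l q b) = q ^ latdot c b.
Proof.
have [_ u1 uM] := chi_T c; have gE := proj2 (taft_characters m q_prim) c.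
rewrite /latdot (big_morph (fun z => q ^ z) (exprzD_root q_prim) (expr0z q)).
rewrite /tKpow (big_morph (taft_char c) uM u1); apply: eq_bigr => i _.
have := gE (GenKinv i); have := gE (GenK i); rewrite /= latdotNr latdot_epsr => gK gV.
case: (b i) => e; rewrite chi_TX.
  by rewrite -exprz_exp -exprnP; congr (_ ^+ _).
by rewrite NegzE mulrN -mulNr -exprz_exp -exprnP; congr (_ ^+ _).
Qed.

Let eps_Mz (z : int) : (eps (ord0 : 'I_1) *~ z : lattice 1) = [ffun=> z].
Proof.
apply/ffunP => j; rewrite ffunE (ord1 j).
by case: z => e; rewrite /intmul ?ffunE ffunMnE ffunE eqxx ?NegzE pmulrn mulrzz mul1r.
Qed.

Let latdot1 (x y : int) : latdot ([ffun=> x] : {ffun 'I_1 -> int}) [ffun=> y] = x * y.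
Proof. by rewrite /latdot big_ord1 !ffunE. Qed.

Lemma pow_chi_K c a : pow_chi c (powK l q a) = q ^ latdot c a.
Proof.
apply: (etrans (pow_char_ptens (taft_characters 1 q_prim) c _)).
rewrite /latdot (big_morph (fun z => q ^ z) (exprzD_root q_prim) (expr0z q)).
by apply: eq_bigr => i _; rewrite ffunE taft_char_Kpow eps_Mz latdot1.
Qed.

(** A slot with nonzero exponent contributes a positive power of the value 0 at x. *)
Lemma pow_chi_XK c (d a : Lat) : d != 0 -> pow_chi c (powXK l q d a) = 0.
Proof.
move=> d0; have /existsP[i di] : [exists i, d i != 0].
  apply: contra_neqT d0 => /existsPn e.
  by apply/ffunP=> i; rewrite ffunE; apply/eqP/negPn/e.
apply: (etrans (pow_char_ptens (taft_characters 1 q_prim) c _)).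
rewrite (bigD1 i) //= ffunE; have [_ _ uM] := chi_T ([ffun=> c i] : {ffun 'I_1 -> int}).
have gX := proj2 (taft_characters 1 q_prim) [ffun=> c i] (GenX ord0).
have -> : taft_char [ffun=> c i] (tX l q (ord0 : 'I_1) ^+ `|d i|
    * tKpow l q (eps (ord0 : 'I_1) *~ a i)) = 0; last exact: mul0r.
apply: (etrans (uM _ _)); rewrite chi_TX.
have -> : taft_char [ffun=> c i] (tX l q (ord0 : 'I_1)) = 0 by apply: gX.
by rewrite expr0n gtn_eqF ?absz_gt0 // mul0r.
Qed.

(** With all x-exponents 0 the vector would be K(a) itself, so outside the span of the K(a) some
    exponent is nonzero. *)
Lemma basis_vector_cases u : is_basis_vector u -> ~ in_spanK u ->
  forall c, pow_chi c u = 0.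
Proof.
move=> [d [a [_ _ ->]]] notK c; apply: pow_chi_XK; apply/negP => /eqP d0.
apply: notK; exists [:: (1, a)]; rewrite big_seq1 scale1r.
by congr ptens; apply/ffunP=> i; rewrite !ffunE d0 ffunE expr0 mul1r.
Qed.

Lemma pow_sigma_spec : taft_cocycle_spec pow_sigma.
Proof.
split=> [a b|u v ub vb [uK|vK]].
- apply: (etrans (form_chi q_prim tlP chP l0 downD (powK l q a) (pow_chi_K^~ b))).
  by rewrite pow_chi_K latdotNl starE.
- have u0 := basis_vector_cases ub uK.
  by apply: big1 => p _; rewrite u0 mulr0 mul0r.
- have v0 := basis_vector_cases vb vK.
  by apply: big1 => p _; rewrite v0 mulr0.
Qed.

Lemma taft_universal : qcomm_universal l q (@star_comm n) genT.
Proof.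
move=> W mul one f algW fR; exists (pext mul one f).
exact: (taft_extend algW (qcomm_taft algW fR)).
Qed.

(** The presentation of the rank one algebra gives a map on each slot. For B = 0 letters of
    different slots have commuting images, and [word_commute], once per factor, extends this to all
    elements. *)
Lemma pow_universal : qcomm_universal l q (fun _ _ => 0) genP.
Proof.
move=> W mul one f algW [S C].
pose psi (i : 'I_n) : T1 -> W := pext mul one (fun g => f (gen_at i g)).
have psiP i := taft_extend algW (S i).
have psi_comm i j a b : i != j -> mul (psi i a) (psi j b) = mul (psi j b) (psi i a).
  move=> ij; have span1 := tl_span tl1.
  apply: (word_commute algW span1 (proj1 (psiP j))) => h.
  symmetry; apply: (word_commute algW span1 (proj1 (psiP i))) => g; symmetry.
  rewrite (proj2 (psiP i) g) (proj2 (psiP j) h).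
  have gh : gen_idx (gen_at i g) != gen_idx (gen_at j h) by rewrite !gen_idx_at.
  by rewrite (C _ _ gh) subrr scale1r.
exists (llift (family_prod mul one psi)); split.
  have := family_alg_map (tl_alg tl1) algW (fun i => proj1 (psiP i)) psi_comm.
  by rewrite lmulE.
move=> g; apply: (etrans (family_slot algW (fun i => proj1 (psiP i)) _ _)).
by apply: (etrans (proj2 (psiP _) _)); case: g.
Qed.

(** The link between the cocycle and the Taft relations: antisymmetrising - b * a gives the exponent
    of theta. *)
Lemma down_star_comm (a b : Lat) :
  latdot (- up b) a - latdot (- up a) b = star_comm a b.
Proof. by rewrite /star_comm !latdotNl opprK addrC. Qed.

End Main.

(** The values on [tK] and [tX] determine [phi] as an algebra map, which makes precise in what sense
    it is natural. The condition on [l] serves the division in [fourier_inversion]. *)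
Theorem taft_twist (k : fieldType) (l n : nat) (q : k) :
  l%:R != 0 :> k -> l.-primitive_root q ->
  exists sigma sigma_inv : taft_pow l q n -> taft_pow l q n -> k,
    [/\ taft_cocycle_spec sigma,
        hopf_2cocycle sigma sigma_inv,
        is_hopf (taft l q n) /\ is_hopf (twist sigma sigma_inv)
      & exists phi : taft l q n -> twist sigma sigma_inv,
          [/\ hopf_iso phi,
              forall i : 'I_n, phi (tK l q i) = hslot i (tK l q ord0 : taft l q 1)
            & forall i : 'I_n, phi (tX l q i) = hslot i (tX l q ord0 : taft l q 1)]].
Proof.
move=> l0 q_prim.
have downD : {morph (fun a : {ffun 'I_n -> int} => - up a) : a b / a + b}.
  by move=> a b; rewrite upD opprD.
have tl1 := taft_taft_like 1 q_prim; have tlT := taft_taft_like n q_prim.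
have tlP := pow_taft_like n tl1.
have ch1 := taft_characters 1 q_prim; have chT := taft_characters n q_prim.
have chP := pow_characters n tl1 ch1.
have rel1 := taft_gen_rels l 1 q.
have relT := taft_qcomm q_prim (tl_alg tlT) (taft_gen_rels l n q).
have relP := pow_qcomm n (tl_alg tl1) rel1.
have [phi [phi_iso phi_gen]] := twist_iso q_prim l0 tlT tlP chT chP downD
  (@down_star_comm n) relT relP (@taft_universal k l n q) (pow_universal (n := n) q_prim).
exists (@pow_sigma k l n q), (@pow_sigma_inv k l n q); split.
- exact: pow_sigma_spec.
- exact: (form_hopf_2cocycle q_prim tlP chP l0 downD).
- split; first exact: (taft_like_hopf tlT).
  exact: (taft_like_hopf (twist_taft_like q_prim tlP chP l0 downD)).
exists phi; split=> [|i|i].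
- exact: phi_iso.
- exact: (phi_gen (GenK i)).
- exact: (phi_gen (GenX i)).
Qed.

Theorem theorem3p8 (k : closedFieldType) (l n : nat) (q : k)
    (char0 : [pchar k] =i pred0)
    (n_gt0 : (0 < n)%N)
    (q_prim : l.-primitive_root q) :
  exists sigma sigma_inv : taft_pow l q n -> taft_pow l q n -> k,
    [/\ taft_cocycle_spec sigma,
        hopf_2cocycle sigma sigma_inv,
        is_hopf (taft l q n) /\ is_hopf (twist sigma sigma_inv)
      & exists phi : taft l q n -> twist sigma sigma_inv,
          [/\ hopf_iso phi,
              forall i : 'I_n, phi (tK l q i) = hslot i (tK l q ord0 : taft l q 1)
            & forall i : 'I_n, phi (tX l q i) = hslot i (tX l q ord0 : taft l q 1)]].
Proof.
have l0 : l%:R != 0 :> k.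
  by rewrite (proj1 (pcharf0P k) char0) -lt0n (prim_order_gt0 q_prim).
exact: taft_twist l0 q_prim.
Qed.
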